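(* Let $\Sigma=(A,B,C,D;\mathcal X,\mathcal U,\mathcal Y)$ be a minimal system. Then the set $\mathrm{RI}_\Sigma$ of generalized solutions of the Riccati inequality associated to $\Sigma$ is nonempty if and only if the transfer function $\theta_\Sigma$ coincides with a Schur class function in a neighborhood of zero.
   Context: A system $\Sigma=(A,B,C,D;\mathcal X,\mathcal U,\mathcal Y)$ is the discrete time-invariant linear system $x_{n+1}=Ax_n+Bu_n$, $y_n=Cx_n+Du_n$ $(n\ge 0)$, where $A:\mathcal X\to\mathcal X$, $B:\mathcal U\to\mathcal X$, $C:\mathcal X\to\mathcal Y$, $D:\mathcal U\to\mathcal Y$ are bounded linear operators between separable (complex) Hilbert spaces. Its transfer function is $\theta_\Sigma(\lambda)=D+\lambda C(I-\lambda A)^{-1}B$, defined for those $\lambda\in\mathbb C$ for which $I-\lambda A$ is boundedly invertible. Put $\operatorname{Im}(A|B)=\operatorname{span}\{\operatorname{Im}A^nB\mid n\ge 0\}$ (linear span, not closed) and $\operatorname{Ker}(C|A)=\bigcap_{n\ge0}\operatorname{Ker}CA^n$. $\Sigma$ is minimal if $\operatorname{Im}(A|B)$ is dense in $\mathcal X$ and $\operatorname{Ker}(C|A)=\{0\}$. The Schur class $\mathcal S(\mathcal U,\mathcal Y)$ consists of the functions $\theta$ analytic on the open unit disc $\mathbb D$ with values bounded operators $\mathcal U\to\mathcal Y$ with $\|\theta(z)\|\le1$ for all $z\in\mathbb D$. For a bounded selfadjoint operator $T$ on a Hilbert space $\mathcal H$, put $\mathcal H_1=\overline{T\mathcal H}$,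 $\mathcal H_2=\operatorname{Ker}T=\mathcal H\ominus\mathcal H_1$, $T_1=T|_{\mathcal H_1}$ (injective on $\mathcal H_1$). The Moore--Penrose pseudo-inverse $T^{[-1]}$ is the (possibly unbounded) selfadjoint operator with domain $\operatorname{Im}T_1\oplus\mathcal H_2$ acting as $T_1^{-1}$ on $\operatorname{Im}T_1$ and as $0$ on $\mathcal H_2$. $\mathcal D(\cdot)$ denotes the domain of an operator. A (possibly unbounded) selfadjoint operator $H$ in $\mathcal X$ is a generalized solution of the Riccati inequality associated to $\Sigma$ if: (1) $\langle Hx,x\rangle>0$ for each $0\ne x\in\mathcal D(H)$; (2) $A\mathcal D(H^{1/2})\subset\mathcal D(H^{1/2})$ and $B\mathcal U\subset\mathcal D(H^{1/2})$ (so $H^{1/2}B:\mathcal U\to\mathcal X$ is bounded); (3) the operator $\delta_\Sigma(H)=I_{\mathcal U}-D^*D-(H^{1/2}B)^*H^{1/2}B$ is bounded and nonnegative, and $\big(D^*C+(H^{1/2}B)^*H^{1/2}A\big)\mathcal D(H^{1/2})\subset\delta_\Sigma(H)^{1/2}\mathcal U$; (4) for each $x\in\mathcal D(H^{1/2})$, $$\|H^{1/2}x\|^2-\|H^{1/2}Ax\|^2-\|Cx\|^2\ \ge\ \big\|\big(\delta_\Sigma(H)^{1/2}\big)^{[-1]}\big(D^*C+(H^{1/2}B)^*H^{1/2}A\big)x\big\|^2 .$$ $\mathrm{RI}_\Sigma$ denotes the set of all such $H$. *)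

(* Defs.v *)
From HB Require Import structures.
From mathcomp Require Import all_boot all_order all_algebra.
From mathcomp Require Import complex.
From mathcomp Require Import all_classical all_reals all_analysis.

Set Implicit Arguments.
Unset Strict Implicit.
Unset Printing Implicit Defensive.

Import Order.TTheory GRing.Theory Num.Theory.
Import numFieldNormedType.Exports.

Local Open Scope classical_set_scope.
Local Open Scope ring_scope.
Local Open Scope complex_scope.

(* The inner product is linear in its first argument and conjugate-linear in
   its second one; it induces the norm of the underlying Banach space. *)
HB.mixin Record CompleteNormedModule_isHilbert (R : realType) V
    of CompleteNormedModule R[i] V := {
  inner : {dot V for (@Num.conj R[i])} ;
  normr_inner : forall x : V, `|x| ^+ 2 = inner x x
}.

#[short(type="hilbertType")]
HB.structure Definition Hilbert (R : realType) :=
  {V of CompleteNormedModule R[i] V & CompleteNormedModule_isHilbert R V}.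

Definition separable (T : topologicalType) := exists2 S : set T, countable S & dense S.

Definition lin_span (K : numFieldType) (V : normedModType K) (S : set V) : set V :=
  [set x | exists n (a : 'I_n -> K) (v : 'I_n -> V),
             (forall i, S (v i)) /\ x = \sum_(i < n) a i *: v i].

Definition bounded_operator (K : numFieldType) (V W : normedModType K)
    (T : V -> W) :=
  linear T /\ bounded_near T (nbhs (0 : V)).

(* Operators which need not be defined everywhere.  The values of [pact T]
   outside of [pdom T] are meaningless and never used. *)
Record partial_op (V W : Type) := PartialOp { pdom : set V ; pact :> V -> W }.

Section Operators.
Variable R : realType.

(* The Hilbert space adjoint of an everywhere defined operator: [adj T y] is
   the vector representing the functional [x |-> inner (T x) y]. *)
Definition adj (V W : hilbertType R) (T : V -> W) (y : W) : V :=
  xget 0 [set z | forall x, inner (T x) y = inner x z].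

Definition linear_partial_op (V W : hilbertType R) (T : partial_op V W) :=
  pdom T 0 /\
  forall (a : R[i]) x y, pdom T x -> pdom T y ->
    pdom T (a *: x + y) /\ T (a *: x + y) = a *: T x + T y.

(* The graph of the adjoint of a densely defined operator. *)
Definition adjoint_graph (V W : hilbertType R) (T : partial_op V W) (y : W) (z : V) :=
  forall x, pdom T x -> inner (T x) y = inner x z.

Definition selfadjoint (V : hilbertType R) (T : partial_op V V) :=
  [/\ linear_partial_op T, dense (pdom T) &
      forall y z, adjoint_graph T y z <-> pdom T y /\ T y = z].

Definition nonnegative (V : hilbertType R) (T : partial_op V V) :=
  forall x, pdom T x -> 0 <= inner (T x) x.

Definition everywhere (V W : hilbertType R) (T : V -> W) : partial_op V W :=
  PartialOp setT T.

Definition is_sqrt (V : hilbertType R) (T S : partial_op V V) :=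
  [/\ selfadjoint S, nonnegative S &
      forall x y, pdom T x /\ T x = y <->
                  [/\ pdom S x, pdom S (S x) & S (S x) = y]].

(* [sqrt_op T] is the nonnegative selfadjoint operator whose square is [T],
   domains included; it exists and is unique if [T] is selfadjoint and
   nonnegative, and is only used for such [T].  If [T] is everywhere defined,
   so is its square root. *)
Definition sqrt_op (V : hilbertType R) (T : partial_op V V) : partial_op V V :=
  xget (T : {classic partial_op V V}) [set S | is_sqrt T S].

(* With H1 the closure of the range of [T], the domain is T H1 + Ker T, and [y]
   is sent to the unique x in H1 such that y - T x is in Ker T. *)
Definition pinv_graph (V : hilbertType R) (T : V -> V) (y x : V) :=
  closure (range T) x /\ T (y - T x) = 0.

Definition pinv (V : hilbertType R) (T : V -> V) : partial_op V V :=
  PartialOp [set y | exists x, pinv_graph T y x]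
            (fun y => xget 0 [set x | pinv_graph T y x]).

(* Analyticity at [z0] of an operator valued function: near [z0] it is the sum
   of a power series, converging in operator norm, whose coefficients are
   bounded operators.  [0 : R[i]^o] is the zero of R[i] as a normed module over
   itself, which carries the usual topology of the complex plane. *)
Definition op_analytic_at (U Y : hilbertType R) (theta : R[i] -> U -> Y) (z0 : R[i]) :=
  exists c : nat -> U -> Y,
    (forall k, bounded_operator (c k)) /\
    \forall h \near (0 : R[i]^o), forall eps : R[i], 0 < eps ->
      \forall n \near \oo, forall u,
        `|theta (z0 + h) u - \sum_(k < n) h ^+ k *: c k u| <= eps * `|u|.

(* Values outside of the open unit disc are ignored. *)
Definition schur_class (U Y : hilbertType R) (theta : R[i] -> U -> Y) :=
  forall z : R[i], `|z| < 1 ->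
    [/\ bounded_operator (theta z), op_analytic_at theta z &
        forall u, `|theta z u| <= `|u|].

End Operators.

Record system (R : realType) (X U Y : hilbertType R) := System {
  sA : X -> X ;
  sB : U -> X ;
  sC : X -> Y ;
  sD : U -> Y ;
  sA_bounded : bounded_operator sA ;
  sB_bounded : bounded_operator sB ;
  sC_bounded : bounded_operator sC ;
  sD_bounded : bounded_operator sD
}.

Section Systems.
Variables (R : realType) (X U Y : hilbertType R) (Sigma : system X U Y).
Let A := sA Sigma.
Let B := sB Sigma.
Let C := sC Sigma.
Let D := sD Sigma.

Definition reachable_space : set X :=
  lin_span (\bigcup_n range (iter n A \o B)).

Definition unobservable_space : set X :=
  \bigcap_n [set x | C (iter n A x) = 0].

Definition minimal : Prop :=
  dense reachable_space /\ unobservable_space = [set 0].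

Definition boundedly_invertible (V : hilbertType R) (T : V -> V) :=
  exists T', [/\ bounded_operator T', cancel T T' & cancel T' T].

Definition pencil (lambda : R[i]) (x : X) : X := x - lambda *: A x.

Definition transfer_dom : set R[i] :=
  [set lambda | boundedly_invertible (pencil lambda)].

Definition transfer (lambda : R[i]) (u : U) : Y :=
  D u + lambda *: C (xget 0 [set x | pencil lambda x = B u]).

Section Riccati.
Variable H : partial_op X X.
Let S := sqrt_op H.
Let SA x := S (A x).
Let SB u := S (B u).

Definition riccati_delta (u : U) : U :=
  u - adj D (D u) - adj SB (SB u).

Definition riccati_cross (x : X) : U :=
  adj D (C x) + adj SB (SA x).

Let sqrt_delta := sqrt_op (everywhere riccati_delta).

Definition generalized_riccati_solution : Prop :=
  [/\ selfadjoint H /\ (forall x, pdom H x -> x != 0 -> 0 < inner (H x) x),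
      (forall x, pdom S x -> pdom S (A x)) /\ (forall u, pdom S (B u)),
      [/\ bounded_operator riccati_delta,
          nonnegative (everywhere riccati_delta) &
          forall x, pdom S x -> range sqrt_delta (riccati_cross x)] &
      forall x, pdom S x ->
        `|pinv sqrt_delta (riccati_cross x)| ^+ 2
          <= `|S x| ^+ 2 - `|S (A x)| ^+ 2 - `|C x| ^+ 2].

End Riccati.

Definition RI : set (partial_op X X) := [set H | generalized_riccati_solution H].

End Systems.

(* Main.v *)
(* If theta is a Schur function then the energy gain sum |y_n|^2 - |u_n|^2 of
   every finite trajectory starting at 0 is nonpositive: on a circle of radius
   r < 1 this is Parseval's identity, the Fourier coefficients of
   theta(z) sum z^k u_k being those of the output.  Hence the available storage
   V(x), the supremum of the energy gains starting at x, is finite at every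
   reachable state.  It is a closed quadratic form, densely defined by
   reachability and definite by observability, so V(x) = |H^(1/2) x|^2 for a
   positive selfadjoint H.  The dissipation inequality
     V(A x + B u) + |C x + D u|^2 <= V(x) + |u|^2
   is quadratic in u, and by Douglas' lemma it holds for all u exactly when the
   Riccati inequality holds at x.

   Conversely a solution H makes |H^(1/2) x|^2 satisfy the dissipation
   inequality (H^(1/2) B is bounded by a closed graph argument).  The operators
   D, CB, CAB, ... are then contractions, so that the power series of the
   transfer function converges in the unit disc, and feeding the system with the
   input u z^-n shows that its values are contractions. *)

Require Import Defs.
From HB Require Import structures.
From mathcomp Require Import all_boot all_order all_algebra.
From mathcomp Require Import complex ring lra.
From mathcomp Require Import all_classical all_reals all_analysis.

Set Implicit Arguments.
Unset Strict Implicit.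
Unset Printing Implicit Defensive.

Import Order.TTheory GRing.Theory Num.Theory.
Import numFieldNormedType.Exports.

Local Open Scope classical_set_scope.
Local Open Scope ring_scope.
Local Open Scope complex_scope.

(** * Norms, sequences and inner products *)

(** [theta] agrees with the transfer function only near 0, whereas passivity is read off on circles
    of radius close to 1. The link is [annulus_mean]: sums over the M-th roots of unity on two
    circles differ by at most a constant independent of M, so their means agree in the limit.
    Contour integrals are thus replaced by finite sums, for which Parseval is exact, and only a
    Taylor expansion with quadratic remainder is asked of [theta].

    H is obtained from its resolvent: (I + H)^-1 sends f to the minimizer of q(z) + |z|^2 - 2 Re <f,
    z>, with q the available storage; H and a square root of it are then expressed through square
    roots of bounded operators. Since [sqrt_op] is a choice among square roots, the form has to be
    identified for every one of them; this rests on the fact that a closed form is determined by its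
    minimizers.

    In the converse direction no square root of the given H is constructed: selfadjointness of
    [sqrt_op H] is enough, and its default value has it too. *)

Section RealValuedNorm.
Context {R : realType}.
Implicit Types (V : normedModType R[i]) (a b : R[i]).

(* The norm of a complex normed module takes values in R[i]; [cm] and [nr] are
   the modulus and the norm as elements of R. *)
Definition cm a : R := complex.Re `|a|.
Definition nr {V} (x : V) : R := complex.Re `|x|.

Lemma ltr0c (r : R) : (0 < r%:C) = (0 < r). Proof. by rewrite -ltcR. Qed.

Lemma cmE a : `|a| = (cm a)%:C.
Proof. by rewrite /cm RRe_real// normr_real. Qed.

Lemma nrE V (x : V) : `|x| = (nr x)%:C.
Proof. by rewrite /nr RRe_real// normr_real. Qed.

Lemma cm_ge0 a : 0 <= cm a. Proof. by rewrite -ler0c -cmE. Qed.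
Lemma nr_ge0 V (x : V) : 0 <= nr x. Proof. by rewrite -ler0c -nrE. Qed.

Lemma cmM a b : cm (a * b) = cm a * cm b.
Proof. by apply: complexI; rewrite rmorphM/= -!cmE normrM. Qed.

Lemma cmX a n : cm (a ^+ n) = cm a ^+ n.
Proof. by apply: complexI; rewrite rmorphXn/= -!cmE normrX. Qed.

Lemma cmV a : cm a^-1 = (cm a)^-1.
Proof. by apply: complexI; rewrite fmorphV/= -!cmE normfV. Qed.

Lemma cmN a : cm (- a) = cm a. Proof. by rewrite /cm normrN. Qed.
Lemma cm0 : cm 0 = 0. Proof. by rewrite /cm normr0. Qed.
Lemma cm1 : cm 1 = 1. Proof. by rewrite /cm normr1. Qed.

Lemma cm_eq0 a : (cm a == 0) = (a == 0).
Proof. by rewrite -(inj_eq (@complexI R)) -cmE normr_eq0. Qed.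

Lemma cm_gt0 a : (0 < cm a) = (a != 0).
Proof. by rewrite lt_def cm_eq0 cm_ge0 andbT. Qed.

Lemma cmD a b : cm (a + b) <= cm a + cm b.
Proof. by rewrite -lecR rmorphD/= -!cmE ler_normD. Qed.

Lemma cm_real (r : R) : cm r%:C = `|r|.
Proof. by rewrite /cm normc_def/= expr0n/= addr0 sqrtr_sqr. Qed.

Lemma cmI : cm ('i : R[i]) = 1.
Proof. by rewrite /cm normc_def/= expr0n/= add0r expr1n sqrtr1. Qed.

Lemma cm_sqr a : cm a ^+ 2 = complex.Re a ^+ 2 + complex.Im a ^+ 2.
Proof. by apply: complexI; rewrite add_Re2_Im2 cmE rmorphXn. Qed.

Lemma Re_le_cm a : complex.Re a <= cm a.
Proof.
rewrite (le_trans (ler_norm _))// -lecR -cmE; exact: normc_ge_Re.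
Qed.

Lemma nr0 V : nr (0 : V) = 0. Proof. by rewrite /nr normr0. Qed.
Lemma nrN V (x : V) : nr (- x) = nr x. Proof. by rewrite /nr normrN. Qed.
Lemma nrBC V (x y : V) : nr (x - y) = nr (y - x). Proof. by rewrite -nrN opprB. Qed.

Lemma nr_eq0 V (x : V) : (nr x == 0) = (x == 0).
Proof. by rewrite -(inj_eq (@complexI R)) -nrE normr_eq0. Qed.

Lemma nr_gt0 V (x : V) : (0 < nr x) = (x != 0).
Proof. by rewrite lt_def nr_eq0 nr_ge0 andbT. Qed.

Lemma nrD V (x y : V) : nr (x + y) <= nr x + nr y.
Proof. by rewrite -lecR rmorphD/= -!nrE ler_normD. Qed.

Lemma nrB V (x y : V) : nr (x - y) <= nr x + nr y.
Proof. by rewrite -(nrN y) nrD. Qed.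

Lemma nrZ V a (x : V) : nr (a *: x) = cm a * nr x.
Proof. by apply: complexI; rewrite rmorphM/= -cmE -!nrE normrZ. Qed.

Lemma nr_dist V (x y : V) : `|nr x - nr y| <= nr (x - y).
Proof.
have h (u v : V) : nr u - nr v <= nr (u - v).
  by rewrite lerBlDr (le_trans _ (nrD _ _))// subrK.
by rewrite ler_norml h andbT lerNl opprB nrBC h.
Qed.

Lemma nr_sum V n (F : 'I_n -> V) : nr (\sum_(i < n) F i) <= \sum_(i < n) nr (F i).
Proof.
elim/big_ind2: _ => [|x a y b xa yb|//]; first by rewrite nr0.
exact: le_trans (nrD _ _) (lerD xa yb).
Qed.

Lemma nr_sum_le V n (F : 'I_n -> V) (c : R) :
  (forall i, nr (F i) <= c) -> nr (\sum_(i < n) F i) <= n%:R * c.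
Proof.
move=> hF; apply: le_trans (nr_sum _) _.
by apply: le_trans (ler_sum _ (fun i _ => hF i)) _; rewrite sumr_const card_ord mulr_natl.
Qed.

End RealValuedNorm.

Section LinearProp.
Context {K : numFieldType} {V W : normedModType K} {T : V -> W}.
Hypothesis linT : linear T.

Lemma lin0 : T 0 = 0.
Proof. by have := linT (-1) 0 0; rewrite scaler0 add0r scaleN1r addNr. Qed.

Lemma linZ a x : T (a *: x) = a *: T x.
Proof. by have := linT a x 0; rewrite !addr0 lin0 addr0. Qed.

Lemma linD x y : T (x + y) = T x + T y.
Proof. by have := linT 1 x y; rewrite !scale1r. Qed.

Lemma linN x : T (- x) = - T x.
Proof. by rewrite -scaleN1r linZ scaleN1r. Qed.

Lemma linB x y : T (x - y) = T x - T y.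
Proof. by rewrite linD linN. Qed.

Lemma lin_sum n (F : 'I_n -> V) : T (\sum_(i < n) F i) = \sum_(i < n) T (F i).
Proof. by apply: (big_morph T linD lin0). Qed.

End LinearProp.

Section Sequences.
Context {R : realType}.
Implicit Types V : normedModType R[i].

Definition cvs {V} (x : nat -> V) (l : V) := nr (x n - l) @[n --> \oo] --> (0 : R).

Lemma cvsP V (x : nat -> V) l :
  cvs x l <-> forall e : R, 0 < e -> exists N, forall n, (N <= n)%N -> nr (x n - l) < e.
Proof.
split=> [h e e0|h].
  have /cvgrPdist_lt/(_ e e0)[N _ hN] := h.
  by exists N => n Nn; have := hN n Nn; rewrite /= sub0r normrN ger0_norm ?nr_ge0.
apply/cvgrPdist_lt => e e0; have [N hN] := h e e0.
by exists N => // n Nn /=; rewrite sub0r normrN ger0_norm ?nr_ge0// hN.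
Qed.

Lemma cvs_le V (x : nat -> V) l (r : nat -> R) :
  (forall n, nr (x n - l) <= r n) -> r @ \oo --> (0 : R) -> cvs x l.
Proof.
move=> h; apply: (@squeeze_cvgr _ _ _ _ (fun=> 0)); last exact: cvg_cst.
by near=> n; rewrite nr_ge0 h.
Unshelve. all: by end_near. Qed.

Lemma cvs_cst V (x : V) : cvs (fun=> x) x.
Proof. by rewrite /cvs subrr nr0; exact: cvg_cst. Qed.

Lemma cvsD V (x y : nat -> V) a b : cvs x a -> cvs y b ->
  cvs (fun n => x n + y n) (a + b).
Proof.
move=> xa yb; apply: (@cvs_le _ _ _ (fun n => nr (x n - a) + nr (y n - b))).
  by move=> n; rewrite opprD addrACA nrD.
by rewrite -(addr0 0); apply: cvgD.
Qed.

Lemma cvs_lin V (W : normedModType R[i]) (T : V -> W) (M : R) x l : linear T ->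
  (forall x, nr (T x) <= M * nr x) -> cvs x l -> cvs (T \o x) (T l).
Proof.
move=> lT hM xl; apply: (@cvs_le _ _ _ (fun n => M * nr (x n - l))).
  by move=> n /=; rewrite -(linB lT).
by rewrite -(mulr0 M); apply: cvgM => //; exact: cvg_cst.
Qed.

Lemma cvsZ V a (x : nat -> V) l : cvs x l -> cvs (fun n => a *: x n) (a *: l).
Proof.
apply: (@cvs_lin _ _ _ (cm a)) => [b u v|u]; last by rewrite nrZ.
by rewrite scalerDr !scalerA mulrC.
Qed.

Lemma cvsN V (x : nat -> V) l : cvs x l -> cvs (fun n => - x n) (- l).
Proof.
by move=> /(cvsZ (-1)); rewrite scaleN1r; under eq_fun do rewrite scaleN1r.
Qed.

Lemma cvsB V (x y : nat -> V) a b : cvs x a -> cvs y b ->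
  cvs (fun n => x n - y n) (a - b).
Proof. by move=> xa /cvsN; exact: cvsD. Qed.

Lemma cvs_nr V (x : nat -> V) l : cvs x l -> nr (x n) @[n --> \oo] --> nr l.
Proof.
move=> /cvsP h; apply/cvgrPdist_lt => e e0; have [N hN] := h e e0.
by exists N => // n Nn /=; rewrite (le_lt_trans (nr_dist _ _))// nrBC hN.
Qed.

Lemma cvs_unique V (x : nat -> V) a b : cvs x a -> cvs x b -> a = b.
Proof.
move=> xa xb; have := cvs_nr (cvsB xa xb).
under eq_fun do rewrite subrr.
move=> h; have := cvg_unique _ (@cvg_cst _ (nr (0 : V)) _ \oo _) h.
by rewrite nr0 => e; apply/eqP; rewrite -subr_eq0 -nr_eq0 -e.
Qed.

Lemma cvs_shift V (x : nat -> V) l k : cvs x l -> cvs (fun n => x (n + k)%N) l.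
Proof.
move=> /cvsP h; apply/cvsP => e /h[N hN]; exists N => n Nn.
by rewrite hN// (leq_trans Nn)// leq_addr.
Qed.

Lemma cauchy_cvs (V : completeNormedModType R[i]) (x : nat -> V) :
  (forall e : R, 0 < e -> exists N, forall m n, (N <= m)%N -> (N <= n)%N ->
     nr (x m - x n) < e) -> exists l, cvs x l.
Proof.
move=> h; have /cauchy_cvg /cvg_ex[l xl] : cauchy (x @ \oo).
  apply/cauchy_exP => _/posnumP[e]; set e' := complex.Re e%:num.
  have ee : e%:num = e'%:C by rewrite RRe_real// gtr0_real.
  have e0 : 0 < e' by rewrite -ltr0c -ee.
  have [N hN] := h e' e0; exists (x N); exists N => // n Nn.
  by rewrite -ball_normE /ball_/= nrE ee ltcR; apply: hN.
exists l; apply/cvsP => e e0; have e0' : 0 < e%:C by rewrite ltr0c.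
have /cvgrPdist_lt/(_ _ e0')[N _ hN] := xl.
by exists N => n /hN/=; rewrite nrE ltcR nrBC.
Qed.

(** Majorant principle: [r] is Cauchy and its increments control those of [x]. Both the square root
    iteration and power series converge this way. *)
Lemma dominated_cvs (V : completeNormedModType R[i]) (x : nat -> V) (r : nat -> R) :
  (forall n, nr (x n.+1 - x n) <= r n.+1 - r n) -> cvg (r @ \oo) ->
  exists l, cvs x l.
Proof.
move=> hx /cvg_cauchy/cauchy_ballP cr; apply: cauchy_cvs => e e0.
have hk k n : nr (x (n + k)%N - x n) <= r (n + k)%N - r n.
  elim: k => [|k IH]; first by rewrite addn0 !subrr nr0.
  rewrite addnS -(subrK (x (n + k)%N) (x (n + k).+1)) -addrA.
  by rewrite (le_trans (nrD _ _))// (le_trans (lerD (hx _) IH))// addrA subrK.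
have := cr e e0; move=> -[[A B] [[N1 _ hN1] [N2 _ hN2]] hAB].
exists (maxn N1 N2).
suff hmn m n : (maxn N1 N2 <= n)%N -> (n <= m)%N -> nr (x m - x n) < e.
  move=> m n hm hn; have [nm|/ltnW mn] := leqP n m; first exact: hmn.
  by rewrite nrBC hmn.
move=> hn nm; rewrite -(subnKC nm) (le_lt_trans (hk _ _))// subnKC//.
rewrite (le_lt_trans (ler_norm _))//.
have hm := leq_trans hn nm; move: hn hm; rewrite !geq_max => /andP[n1 n2] /andP[m1 m2].
exact: (hAB (r m, r n) (conj (hN1 m m1) (hN2 n n2))).
Qed.

End Sequences.

Section RealInner.
Context {R : realType}.
Implicit Types (V W : hilbertType R) (a : R[i]) (r : R).

(** Quadratic arguments only see this real inner product; [innerE] recovers the complex one by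
    rotating the second argument by i. *)
Definition rip {V} (x y : V) : R := complex.Re (inner x y).

Lemma ReD (a b : R[i]) : complex.Re (a + b) = complex.Re a + complex.Re b.
Proof. by case: a b => [? ?] [? ?]. Qed.

Lemma ReN (a : R[i]) : complex.Re (- a) = - complex.Re a.
Proof. by case: a. Qed.

Lemma ReZ r (a : R[i]) : complex.Re (r%:C * a) = r * complex.Re a.
Proof. by case: a => u v /=; rewrite mul0r subr0. Qed.

Lemma innerC V (x y : V) : inner x y = (inner y x)^*%C.
Proof. by rewrite {1}hermC expr0 mul1r. Qed.

Lemma ripC V (x y : V) : rip x y = rip y x.
Proof. by rewrite /rip innerC; case: (inner y x). Qed.

Lemma ripDl V (x y z : V) : rip (x + y) z = rip x z + rip y z.
Proof. by rewrite /rip linearDl ReD. Qed.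

Lemma ripDr V (x y z : V) : rip z (x + y) = rip z x + rip z y.
Proof. by rewrite ripC ripDl !(ripC z). Qed.

Lemma ripNl V (x z : V) : rip (- x) z = - rip x z.
Proof. by rewrite /rip linearNl ReN. Qed.

Lemma ripNr V (x z : V) : rip z (- x) = - rip z x.
Proof. by rewrite ripC ripNl ripC. Qed.

Lemma ripBl V (x y z : V) : rip (x - y) z = rip x z - rip y z.
Proof. by rewrite ripDl ripNl. Qed.

Lemma ripBr V (x y z : V) : rip z (x - y) = rip z x - rip z y.
Proof. by rewrite ripDr ripNr. Qed.

Lemma rip0l V (x : V) : rip 0 x = 0.
Proof. by rewrite /rip linear0l. Qed.

Lemma rip0r V (x : V) : rip x 0 = 0.
Proof. by rewrite ripC rip0l. Qed.

Lemma ripZl V r (x z : V) : rip (r%:C *: x) z = r * rip x z.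
Proof. by rewrite /rip linearZl_LR ReZ. Qed.

Lemma ripZr V r (x z : V) : rip z (r%:C *: x) = r * rip z x.
Proof. by rewrite ripC ripZl ripC. Qed.

Lemma innerE V (x y : V) : inner x y = rip x y +i* rip x ('i *: y).
Proof.
rewrite /rip linearZr_LR/=; case: (inner x y) => u v /=.
by rewrite mul0r sub0r !mulN1r opprK.
Qed.

Lemma ripi V (x y : V) : rip ('i *: x) y = - rip x ('i *: y).
Proof.
rewrite /rip linearZr_LR linearZl_LR/=; case: (inner x y) => u v /=.
by rewrite !mul0r !sub0r !mulN1r mul1r opprK.
Qed.

Lemma ripZZ V a (x y : V) : rip (a *: x) (a *: y) = cm a ^+ 2 * rip x y.
Proof.
rewrite /rip linearZl_LR/= linearZr_LR/= mulrA -sqr_normc cmE -rmorphXn/= ReZ.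
by [].
Qed.

Lemma nr2 V (x : V) : nr x ^+ 2 = rip x x.
Proof. by rewrite /rip -normr_inner nrE -rmorphXn. Qed.

Lemma inner_nr2 V (x : V) : inner x x = (nr x ^+ 2)%:C.
Proof. by rewrite -normr_inner nrE rmorphXn. Qed.

Lemma nr2D V (x y : V) : nr (x + y) ^+ 2 = nr x ^+ 2 + nr y ^+ 2 + 2 * rip x y.
Proof. by rewrite !nr2 ripDl !ripDr (ripC y x); ring. Qed.

Lemma nr2B V (x y : V) : nr (x - y) ^+ 2 = nr x ^+ 2 + nr y ^+ 2 - 2 * rip x y.
Proof. by rewrite nr2D nrN ripNr; ring. Qed.

Lemma parallelogram V (x y : V) :
  nr (x + y) ^+ 2 + nr (x - y) ^+ 2 = 2 * nr x ^+ 2 + 2 * nr y ^+ 2.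
Proof. by rewrite nr2D nr2B; ring. Qed.

Lemma rip_le V (x y : V) : rip x y <= nr x * nr y.
Proof.
have [->|x0] := eqVneq x 0; first by rewrite rip0l nr0 mul0r.
have [->|y0] := eqVneq y 0; first by rewrite rip0r nr0 mulr0.
have nx : 0 < nr x by rewrite nr_gt0.
have ny : 0 < nr y by rewrite nr_gt0.
have := sqr_ge0 (nr ((nr y)%:C *: x - (nr x)%:C *: y)).
rewrite nr2B !nrZ !cm_real !ger0_norm ?nr_ge0// ripZl ripZr => h.
rewrite -(ler_pM2l (mulr_gt0 nx ny)); nra.
Qed.

Lemma rip_norm_le V (x y : V) : `|rip x y| <= nr x * nr y.
Proof. by rewrite ler_norml rip_le andbT lerNl -ripNl -(nrN x) rip_le. Qed.

(** A unimodular [a] rotates [b] onto the positive half-line, where modulus and real part agree. *)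
Lemma cm_le_Re (b : R[i]) (K : R) :
  (forall a, cm a = 1 -> complex.Re (a * b) <= K) -> cm b <= K.
Proof.
move=> h; have [b0|b0] := eqVneq b 0.
  by have := h 1 cm1; rewrite b0 mulr0 cm0.
have ca : cm (b^-1 * (cm b)%:C) = 1.
  by rewrite cmM cmV cm_real ger0_norm ?cm_ge0// mulVf// cm_eq0.
by have := h _ ca; rewrite mulrAC mulVf// mul1r.
Qed.

Lemma cm_inner_le V (x y : V) : cm (inner x y) <= nr x * nr y.
Proof.
apply: cm_le_Re => a ca; have := rip_le (a *: x) y.
by rewrite nrZ ca mul1r /rip linearZl_LR.
Qed.

Lemma rip_eq0 V (x : V) : rip x x = 0 -> x = 0.
Proof. by rewrite -nr2 => /eqP; rewrite sqrf_eq0 nr_eq0 => /eqP. Qed.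

Lemma inner_eq0 V (x : V) : inner x x = 0 -> x = 0.
Proof. by move=> h; apply: rip_eq0; rewrite /rip h. Qed.

Lemma cvs_rip V (x : nat -> V) l y : cvs x l -> rip (x n) y @[n --> \oo] --> rip l y.
Proof.
move=> /cvsP h; apply/cvgrPdist_lt => e e0.
have n1 : 0 < nr y + 1 by rewrite ltr_wpDl ?nr_ge0.
have [N hN] := h _ (divr_gt0 e0 n1); exists N => // n Nn /=.
rewrite -ripBl (le_lt_trans (rip_norm_le _ _))// nrBC.
have := hN n Nn; rewrite ltr_pdivlMr// => h1; apply: le_lt_trans h1.
by rewrite ler_wpM2l ?nr_ge0// lerDl.
Qed.

End RealInner.

Section Dense.
Context {R : realType} {V : normedModType R[i]}.

Lemma closureP (S : set V) (x : V) :
  closure S x <-> forall e : R, 0 < e -> exists2 y, S y & nr (x - y) < e.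
Proof.
split=> [h e e0|h B /nbhs_ballP[_/posnumP[e] hB]].
  have /h[y [Sy]] : nbhs x (ball x e%:C) by apply: nbhsx_ballx; rewrite ltr0c.
  by rewrite -ball_normE/= nrE ltcR => xy; exists y.
have ee : e%:num = (complex.Re e%:num)%:C by rewrite RRe_real// gtr0_real.
have e0 : 0 < complex.Re e%:num by rewrite -ltr0c -ee.
have [y Sy xy] := h _ e0; exists y; split=> //; apply: hB.
by rewrite -ball_normE/= nrE ee ltcR.
Qed.

Lemma denseP (S : set V) :
  dense S <-> forall x (e : R), 0 < e -> exists2 y, S y & nr (x - y) < e.
Proof.
split=> [h x e e0|h O [x Ox] oO].
  have [|y [+ Sy]] := h (ball x e%:C) _ (ball_open _ _).
    by exists x; apply: ballxx; rewrite ltr0c.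
  by rewrite -ball_normE/= nrE ltcR; exists y.
have /(_ O (open_nbhs_nbhs (conj oO Ox)))[y [Sy Oy]] : closure S x.
  by apply/closureP => e; exact: h.
by exists y.
Qed.

Lemma closure_cvs (S : set V) x :
  closure S x -> exists2 u : nat -> V, (forall n, S (u n)) & cvs u x.
Proof.
move=> /closureP h.
have /choice[u hu] n : exists y, S y /\ nr (x - y) < n.+1%:R^-1.
  by have [|y Sy xy] := h n.+1%:R^-1; [rewrite invr_gt0|exists y].
exists u => [n|]; first by have [] := hu n.
apply: (@cvs_le _ _ _ _ (fun n => n.+1%:R^-1)); last exact: cvg_harmonic.
by move=> n; rewrite nrBC ltW//; have [] := hu n.
Qed.

Lemma cvs_closure (S : set V) x (u : nat -> V) :
  (forall n, S (u n)) -> cvs u x -> closure S x.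
Proof.
move=> Su /cvsP h; apply/closureP => e /h[N hN].
by exists (u N) => //; rewrite nrBC hN.
Qed.

Lemma dense_closure (S : set V) : dense S <-> forall x, closure S x.
Proof.
split=> [/denseP h x|h]; first by apply/closureP; exact: h.
by apply/denseP => x; exact/closureP.
Qed.

End Dense.

Section BoundedOperators.
Context {R : realType}.
Implicit Types V W : normedModType R[i].

Lemma bounded_operatorP V W (T : V -> W) :
  bounded_operator T <-> linear T /\ exists2 M : R, 0 <= M & forall x, nr (T x) <= M * nr x.
Proof.
split=> -[lT]; last first.
  move=> [M M0 hM]; split=> //; apply/ex_bound; exists M%:C.
  apply/nbhs_norm0P; exists 1 => //= x /=; rewrite !nrE lecR => x1.
  rewrite (le_trans (hM x))// ler_piMr//.
  by move: x1; rewrite -[1]/(1%:C) ltcR => /ltW.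
pose f := (HB.pack T (GRing.isLinear.Build _ _ _ _ _ lT) : {linear V -> W}).
move=> /(linear_boundedP f)/pinfty_ex_gt0[r r0 Bf]; split=> //.
have rr : r = (complex.Re r)%:C by rewrite RRe_real// gtr0_real.
exists (complex.Re r); first by rewrite ltW// -ltr0c -rr.
by move=> x; rewrite -lecR rmorphM/= -rr -!nrE; exact: Bf.
Qed.

End BoundedOperators.

Section Limits.
Context {R : realType}.

Lemma seq_lim_ge (r : nat -> R) a l : (forall n, a <= r n) -> r @ \oo --> l -> a <= l.
Proof.
move=> h rl; rewrite -(cvg_lim _ rl)//; apply: limr_ge; first by apply/cvg_ex; exists l.
by near=> n; exact: h.
Unshelve. all: by end_near. Qed.

Lemma seq_lim_le (r : nat -> R) a l : (forall n, r n <= a) -> r @ \oo --> l -> l <= a.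
Proof.
move=> h rl; rewrite -(cvg_lim _ rl)//; apply: limr_le; first by apply/cvg_ex; exists l.
by near=> n; exact: h.
Unshelve. all: by end_near. Qed.

Lemma quadratic_ge0_eq0 (a b : R) : (forall t, 0 <= t ^+ 2 * a + 2 * t * b) -> b = 0.
Proof.
move=> h; have a0 : 0 <= a by have := h 1; have := h (-1); nra.
have a1 : 0 < a + 1 by rewrite ltr_wpDl.
(* The vertex would be -b / a; the shift by 1 allows a = 0 and still gives a negative value unless b
   = 0. *)
have := h (- b / (a + 1)).
rewrite (_ : _ + _ = - (b ^+ 2 * (a + 2)) / (a + 1) ^+ 2); last by field; rewrite gt_eqF.
rewrite pmulr_lge0 ?invr_gt0 ?exprn_gt0// oppr_ge0 pmulr_lle0; last by nra.
by move=> h1; apply/eqP; rewrite -sqrf_eq0 eq_le h1 sqr_ge0.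
Qed.

Lemma exists_nat_gt (x : R) : exists N, x < N%:R.
Proof. by exists (Num.truncn x).+1; rewrite truncnS_gt. Qed.

Lemma exists_inv_lt (e : R) : 0 < e -> exists N, forall n, (N <= n)%N -> n.+1%:R^-1 < e.
Proof.
move=> e0; have [N hN] := exists_nat_gt e^-1; exists N => n Nn.
rewrite -[e]invrK ltf_pV2 ?posrE ?invr_gt0// (lt_le_trans hN)// ler_nat.
exact: leqW.
Qed.

Lemma cvs_sqr (V : normedModType R[i]) (u : nat -> V) l (C : R) :
  (forall n, nr (u n - l) ^+ 2 * n.+1%:R <= C) -> cvs u l.
Proof.
move=> h; apply/cvsP => e e0; have [N hN] := exists_nat_gt (C / e ^+ 2).
exists N => n Nn; rewrite -(ltr_pXn2r (ltn0Sn 1)) ?nnegrE ?nr_ge0 ?(ltW e0)//.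
rewrite -(ltr_pM2r (ltr0Sn _ n)) (le_lt_trans (h n))//.
rewrite mulrC -ltr_pdivrMr ?exprn_gt0// (lt_le_trans hN)// ler_nat.
exact: leqW.
Qed.

Lemma minimizing_seq (T : Type) (P : set T) (F : T -> R) (m : R) :
  P !=set0 -> (forall x, P x -> m <= F x) ->
  exists (i : R) (u : nat -> T), [/\ forall x, P x -> i <= F x,
    forall n, P (u n) & forall n, F (u n) <= i + n.+1%:R^-1].
Proof.
move=> [x0 Px0] hm; have infF : has_inf (F @` P).
  by split; [exists (F x0); exists x0|exists m => _ [x Px <-]; exact: hm].
have /choice[u hu] n : exists x, P x /\ F x <= inf (F @` P) + n.+1%:R^-1.
  have [|_ [x Px <-] hx] := @inf_adherent _ (F @` P) n.+1%:R^-1 _ infF.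
    by rewrite invr_gt0.
  by exists x; split=> //; exact: ltW.
exists (inf (F @` P)), u; split=> [x Px|n|n]; try by have [] := hu n.
by apply: ge_inf; [case: infF|exists x].
Qed.

(** Uniform convexity, as in the projection theorem: when two values are close to the lower bound
    [i], the value at the midpoint cannot fall below it, which forces [j x] and [j y] together. *)
Lemma minimizing_seq_cvs (V : completeNormedModType R[i]) (T : Type) (P : set T)
    (F : T -> R) (j : T -> V) (mid : T -> T -> T) (c i : R) (u : nat -> T) : 0 < c ->
  (forall x y, P x -> P y ->
     P (mid x y) /\ c * nr (j x - j y) ^+ 2 <= F x + F y - 2 * F (mid x y)) ->
  (forall x, P x -> i <= F x) -> (forall n, P (u n)) ->
  (forall n, F (u n) <= i + n.+1%:R^-1) ->
  exists l, cvs (j \o u) l.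
Proof.
move=> c0 hmid hi Pu hu; apply: cauchy_cvs => e e0.
have [|N hN] := @exists_inv_lt (c * e ^+ 2 / 2).
  by rewrite divr_gt0// mulr_gt0// exprn_gt0.
exists N => m n Nm Nn; have [/hi h1 h2] := hmid _ _ (Pu m) (Pu n).
rewrite -(ltr_pXn2r (ltn0Sn 1)) ?nnegrE ?nr_ge0 ?(ltW e0)// -(ltr_pM2l c0) /=.
have := hN _ Nm; have := hN _ Nn; have := hu m; have := hu n.
by move: n.+1%:R^-1 m.+1%:R^-1 => dn dm; lra.
Qed.

End Limits.

(** * Riesz representation and adjoints *)

Section Riesz.
Context {R : realType}.

(* The Riesz representation theorem, for a functional [l] which is only given
   on a subspace [P] and is bounded with respect to [nr \o j]. *)
Lemma riesz_relation (E : lmodType R[i]) (V : hilbertType R) (P : set E)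
    (j : E -> V) (l : E -> R[i]) (M : R) :
  0 <= M -> P 0 ->
  (forall a x y, P x -> P y -> [/\ P (a *: x + y), j (a *: x + y) = a *: j x + j y &
     l (a *: x + y) = a * l x + l y]) ->
  (forall x, P x -> cm (l x) <= M * nr (j x)) ->
  exists z, [/\ closure (j @` P) z, nr z <= M & forall x, P x -> l x = inner (j x) z].
Proof.
(* For the sought [z], F x = |j x - z|^2 - |z|^2: minimizing [F] approximates [z] from the image of
   [j]. *)
move=> M0 P0 hlin hM; pose F x := nr (j x) ^+ 2 - 2 * complex.Re (l x).
have hF x : P x -> - M ^+ 2 <= F x.
  move=> Px; have := hM x Px; have := Re_le_cm (l x); have := sqr_ge0 (nr (j x) - M).
  by rewrite /F; nra.
have [|i [u [hi Pu hu]]] := minimizing_seq _ hF; first by exists 0.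
have ju0 : j 0 = 0.
  have [_ + _] := hlin 1 0 0 P0 P0; rewrite scaler0 scale1r addr0 => /eqP.
  by rewrite -{1}[j 0]addr0 (inj_eq (addrI _)) eq_sym => /eqP.
have l0 : l 0 = 0.
  have [_ _ +] := hlin 1 0 0 P0 P0; rewrite scaler0 mul1r addr0 => /eqP.
  by rewrite -{1}[l 0]addr0 (inj_eq (addrI _)) eq_sym => /eqP.
have jZ a x : P x -> [/\ P (a *: x), j (a *: x) = a *: j x & l (a *: x) = a * l x].
  by move=> Px; have := hlin a x 0 Px P0; rewrite !addr0 ju0 l0 !addr0.
have h12 : 0 < 2^-1 :> R by rewrite invr_gt0.
have [z uz] : exists z, cvs (j \o u) z.
  apply: (minimizing_seq_cvs (P := P) (F := F) (c := 2^-1) (i := i)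
    (mid := fun x y => (2^-1)%:C *: (x + y))) => // x y Px Py.
  have [Pxy jxy lxy] := hlin 1 x y Px Py.
  rewrite !scale1r in Pxy jxy lxy; rewrite mul1r in lxy.
  have [Pm jm lm] := jZ (2^-1)%:C _ Pxy; split=> //.
  rewrite /F jm lm jxy lxy ReZ ReD nrZ cm_real ger0_norm ?(ltW h12)// exprMn nr2B nr2D.
  by rewrite le_eqVlt; apply/orP; left; apply/eqP; field.
have hRe h : P h -> complex.Re (l h) = rip (j h) z.
  move=> Ph; apply/eqP; rewrite -subr_eq0 -oppr_eq0 opprB; apply/eqP.
  apply: (@quadratic_ge0_eq0 _ (nr (j h) ^+ 2)) => t.
  apply: (@seq_lim_ge _ (fun n => n.+1%:R^-1 + (t ^+ 2 * nr (j h) ^+ 2 +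
     2 * t * (rip (j (u n)) (j h) - complex.Re (l h))))).
    move=> n; have [Pw jw lw] := hlin t%:C h (u n) Ph (Pu n).
    have := hi _ Pw; have := hu n; rewrite /F jw lw ReD ReZ nr2D nrZ ripZl cm_real.
    rewrite exprMn real_normK ?num_real// (ripC (j (u n))).
    by move: n.+1%:R^-1 => d; lra.
  rewrite -[X in _ --> X]add0r; apply: cvgD; first exact: cvg_harmonic.
  apply: cvgD; first exact: cvg_cst.
  apply: cvgM; first exact: cvg_cst.
  apply: cvgB; last exact: cvg_cst.
  by rewrite (ripC (j h)); exact: cvs_rip uz.
exists z; split.
- by apply: (cvs_closure _ uz) => n; exists (u n).
- have [->|z0] := eqVneq z 0; first by rewrite nr0.
  rewrite -(ler_pM2r (x := nr z)) ?nr_gt0// -expr2 nr2 -subr_ge0.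
  apply: (@seq_lim_ge _ (fun n => M * nr (j (u n)) - rip (j (u n)) z)).
    by move=> n; rewrite subr_ge0 -hRe// (le_trans (Re_le_cm _))// hM.
  apply: cvgB; last exact: cvs_rip uz.
  by apply: cvgM; [exact: cvg_cst|exact: cvs_nr uz].
- move=> x Px; have [Pix jix lix] := jZ 'i x Px.
  apply/eqP; rewrite eq_complex hRe// innerE/= eqxx/=; apply/eqP.
  apply: oppr_inj; rewrite -ripi -jix -hRe// lix.
  by case: (l x) => a b /=; rewrite mul0r sub0r mul1r.
Qed.

Lemma adjP (V W : hilbertType R) (T : V -> W) : bounded_operator T ->
  forall x y, inner (T x) y = inner x (adj T y).
Proof.
move=> /bounded_operatorP[lT [M M0 hM]] x y; rewrite /adj.
have [z [_ _ hz]] := @riesz_relation V V setT id (fun x => inner (T x) y)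
   (M * nr y) (mulr_ge0 M0 (nr_ge0 y)) I (fun a x y _ _ => And3 I erefl
     (etrans (congr1 (fun t => inner t _) (lT _ _ _))
       (etrans (linearDl _ _ _ _) (congr1 (+%R^~ _) (linearZl_LR _ _ _ _)))))
   (fun x _ => le_trans (cm_inner_le _ _) (le_trans (ler_wpM2r (nr_ge0 y) (hM x))
     (eq_ind_r (fun t => t <= _) (lexx _) (mulrAC _ _ _)))).
by case: xgetP => [w -> //|/(_ z)]; case=> x'; exact: hz.
Qed.

Lemma rip_adj (V W : hilbertType R) (T : V -> W) x y : bounded_operator T ->
  rip (T x) y = rip x (adj T y).
Proof. by move=> bT; rewrite /rip adjP. Qed.

End Riesz.

(** * Closed quadratic forms *)

Section ClosedForms.
Context {R : realType} {V : hilbertType R}.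
Implicit Types (D : set V) (q : V -> R) (f x y z : V) (c m : R).

(* No sesquilinear form is mentioned: the parallelogram law is all that is used
   of it. *)
Record closed_form D q : Prop := ClosedForm {
  form_dom0 : D 0 ;
  form_domD : forall x y, D x -> D y -> D (x + y) ;
  form_domZ : forall a x, D x -> D (a *: x) ;
  form_ge0 : forall x, D x -> 0 <= q x ;
  form_scale : forall a x, D x -> q (a *: x) = cm a ^+ 2 * q x ;
  form_par : forall x y, D x -> D y -> q (x + y) + q (x - y) = 2 * q x + 2 * q y ;
  form_lsc : forall (u : nat -> V) x (M : R), (forall n, D (u n)) ->
    (forall n, q (u n) <= M) -> cvs u x -> D x /\ q x <= M }.

(** For q(z) = |H^(1/2) z|^2 the minimizer is (H + c)^-1 f, so minimizers provide resolvents before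
    any operator is available. *)
Definition energy q c f z := q z + c * nr z ^+ 2 - 2 * rip f z.

Definition is_minimizer D q c f y :=
  D y /\ forall z, D z -> energy q c f y <= energy q c f z.

Section OneForm.
Context {D : set V} {q : V -> R} (cf : closed_form D q).

Lemma form_domN x : D x -> D (- x).
Proof. by rewrite -scaleN1r; exact: (form_domZ cf). Qed.

Lemma form_domB x y : D x -> D y -> D (x - y).
Proof. by move=> Dx Dy; apply: (form_domD cf) => //; exact: form_domN. Qed.

Lemma form_lsc_lim (u : nat -> V) (r : nat -> R) x l : (forall n, D (u n)) ->
  (forall n, q (u n) <= r n) -> cvs u x -> r @ \oo --> l -> D x /\ q x <= l.
Proof.
move=> Du hr ux rl.
have h (e : R) : 0 < e -> D x /\ q x <= l + e.
  move=> e0; move: rl => /cvgrPdist_lt/(_ e e0)[N _ hN].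
  apply: (form_lsc cf (u := fun n => u (n + N)%N)) => [n|n|]; first exact: Du.
    rewrite (le_trans (hr _))//; have := hN (n + N)%N (leq_addl _ _).
    by rewrite /= distrC => /ltW/(le_trans (ler_norm _)); rewrite lerBlDl.
  exact: cvs_shift.
split; first by have [] := h 1 ltr01.
by apply/ler_addgt0Pr => e /h[].
Qed.

Lemma energy_par c f g y z : D y -> D z ->
  energy q c (f + g) (y + z) + energy q c (f - g) (y - z) =
  2 * energy q c f y + 2 * energy q c g z.
Proof.
move=> Dy Dz; rewrite /energy.
have := form_par cf Dy Dz; have := parallelogram y z => h1 h2.
have -> : 2 * (q y + c * nr y ^+ 2 - 2 * rip f y) +
    2 * (q z + c * nr z ^+ 2 - 2 * rip g z) =
    (2 * q y + 2 * q z) + c * (2 * nr y ^+ 2 + 2 * nr z ^+ 2)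
    - 4 * rip f y - 4 * rip g z by ring.
by rewrite -h2 -h1 !ripDl !ripDr !ripNl !ripNr; ring.
Qed.

Lemma energyZ c f y a : D y ->
  energy q c (a *: f) (a *: y) = cm a ^+ 2 * energy q c f y.
Proof.
by move=> Dy; rewrite /energy (form_scale cf)// nrZ exprMn ripZZ; ring.
Qed.

Let half : R[i] := (2^-1)%:C.

Let cm_half : cm half ^+ 2 = 4^-1.
Proof. by rewrite cm_real ger0_norm ?invr_ge0// exprVn -natrX. Qed.

Lemma form_mid x y : D x -> D y ->
  4 * q (half *: (x + y)) = 2 * q x + 2 * q y - q (x - y).
Proof.
move=> Dx Dy; rewrite (form_scale cf); last exact: (form_domD cf).
by rewrite cm_half -(form_par cf Dx Dy); field.
Qed.

Lemma energy_mid c f x y : D x -> D y ->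
  4 * energy q c f (half *: (x + y)) =
  2 * energy q c f x + 2 * energy q c f y - q (x - y) - c * nr (x - y) ^+ 2.
Proof.
move=> Dx Dy; have := form_mid Dx Dy; have := parallelogram x y.
rewrite /energy nrZ exprMn cm_half ripZr ripDr => h1 h2.
rewrite -[4 * _](_ : 4 * q (half *: (x + y)) + c * nr (x + y) ^+ 2
  - 4 * (rip f x + rip f y) = _); last by field.
rewrite h2; have -> : nr (x + y) ^+ 2 =
  2 * nr x ^+ 2 + 2 * nr y ^+ 2 - nr (x - y) ^+ 2 by rewrite -h1; ring.
by ring.
Qed.

(** Direct method: completing the square bounds the energy below, midpoint convexity makes a
    minimizing sequence converge in norm, and lower semicontinuity puts the limit in the domain. *)
Lemma ex_minimizer c f : 0 < c -> exists y, is_minimizer D q c f y.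
Proof.
move=> c0; pose F := energy q c f.
have hF x : D x -> - (nr f ^+ 2 / c) <= F x.
  move=> Dx; have := form_ge0 cf Dx; have := rip_le f x; rewrite /F /energy.
  have : 0 <= (c * nr x - nr f) ^+ 2 / c by rewrite divr_ge0 ?sqr_ge0 ?ltW.
  have -> : (c * nr x - nr f) ^+ 2 / c = c * nr x ^+ 2 - 2 * (nr f * nr x) + nr f ^+ 2 / c.
    by field; rewrite gt_eqF.
  by move: (nr f ^+ 2 / c) => K; lra.
have [|i [u [hi Du hu]]] := minimizing_seq _ hF; first by exists 0; exact: (form_dom0 cf).
have [y uy] : exists y, cvs (id \o u) y.
  apply: (minimizing_seq_cvs (P := D) (F := F) (c := c / 2) (i := i)
    (mid := fun x y => half *: (x + y))) => //; first by rewrite divr_gt0.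
  move=> x y Dx Dy; split; first by apply: (form_domZ cf); exact: (form_domD cf).
  have := energy_mid c f Dx Dy; have := form_ge0 cf (form_domB Dx Dy).
  rewrite -/F; lra.
exists y.
have [||Dy qy] := @form_lsc_lim u
    (fun n => i + n.+1%:R^-1 - c * nr (u n) ^+ 2 + 2 * rip f (u n))
    y (i - c * nr y ^+ 2 + 2 * rip f y) Du _ uy.
- by move=> n; have := hu n; rewrite /F /energy; move: n.+1%:R^-1 => d; lra.
- apply: cvgD.
    apply: cvgB.
      rewrite -[X in _ --> X]addr0; apply: cvgD; first exact: cvg_cst.
      exact: cvg_harmonic.
    apply: cvgM; first exact: cvg_cst.
    by apply: cvgM; exact: cvs_nr uy.
  apply: cvgM; first exact: cvg_cst.
  by rewrite ripC; under eq_fun do rewrite ripC; exact: cvs_rip uy.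
split=> // z /hi; apply: le_trans; rewrite /energy; lra.
Qed.

Lemma minimizer_unique c f y z : 0 < c ->
  is_minimizer D q c f y -> is_minimizer D q c f z -> y = z.
Proof.
move=> c0 [Dy hy] [Dz hz]; have := energy_mid c f Dy Dz.
have := form_ge0 cf (form_domB Dy Dz); have := hy _ Dz; have := hz _ Dy.
have := hy _ (form_domZ cf half (form_domD cf Dy Dz)) => h1 h2 h3 h4 h5.
have : c * nr (y - z) ^+ 2 <= 0 by lra.
rewrite pmulr_rle0// => h; apply/eqP; rewrite -subr_eq0 -nr_eq0 -sqrf_eq0.
by rewrite eq_le h sqr_ge0.
Qed.

(** For a competitor [w], the halves of [w + (y - z)] and [w - (y - z)] have sum [w] and difference
    [y - z]. The identities [energy_par] for this pair and for [y], [z] share the term at [f - g]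
    and [y - z], which cancels. *)
Lemma minimizerD c f g y z : is_minimizer D q c f y -> is_minimizer D q c g z ->
  is_minimizer D q c (f + g) (y + z).
Proof.
move=> [Dy hy] [Dz hz]; split=> [|w Dw]; first exact: (form_domD cf).
have Dyz := form_domB Dy Dz.
have Dp := form_domZ cf half (form_domD cf Dw Dyz).
have Dm := form_domZ cf half (form_domB Dw Dyz).
have := hy _ Dp; have := hz _ Dm.
have := energy_par c f g Dy Dz; have := energy_par c f g Dp Dm.
have half2 x : half *: x + half *: x = x.
  rewrite -scalerDl /half -rmorphD/= (_ : 2^-1 + 2^-1 = 1) ?scale1r//.
  by field.
rewrite -scalerDr -scalerBr.
have -> : w + (y - z) + (w - (y - z)) = w + w by rewrite addrACA subrr addr0.
have -> : w + (y - z) - (w - (y - z)) = (y - z) + (y - z).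
  by rewrite opprB [y - z - w]addrC addrACA subrr add0r.
rewrite 2!(scalerDr half) !half2; lra.
Qed.

Lemma minimizerZ c f y a : is_minimizer D q c f y -> 0 < c ->
  is_minimizer D q c (a *: f) (a *: y).
Proof.
move=> [Dy hy] c0; split=> [|z Dz]; first exact: (form_domZ cf).
rewrite energyZ//; have [->|a0] := eqVneq a 0.
  rewrite cm0 expr0n/= mul0r /energy scale0r rip0l mulr0 subr0.
  by rewrite addr_ge0 ?(form_ge0 cf)// mulr_ge0 ?sqr_ge0// ltW.
rewrite -[z]scale1r -(divff a0) -scalerA energyZ; last exact: (form_domZ cf).
by apply: ler_wpM2l; [exact: sqr_ge0|apply: hy; exact: (form_domZ cf)].
Qed.

(* Vary a minimizer [y] along the real and imaginary multiples of itself. *)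
Lemma minimizer_val c f y : 0 < c -> is_minimizer D q c f y ->
  inner f y = (q y + c * nr y ^+ 2)%:C.
Proof.
move=> c0 [Dy hy]; set Q := q y + _.
have h a : Q - 2 * rip f y <= cm a ^+ 2 * Q - 2 * rip f (a *: y).
  have := hy _ (form_domZ cf a Dy); rewrite /energy (form_scale cf)// nrZ exprMn /Q.
  by move=> h; apply: (le_trans h); rewrite le_eqVlt; apply/orP; left; apply/eqP; ring.
rewrite innerE; congr Complex.
  apply/eqP; rewrite -subr_eq0; apply/eqP.
  (* With the multiplier 1 - t, minimality reads t^2 Q + 2 t (Re <f, y> - Q) >= 0. *)
  apply: (@quadratic_ge0_eq0 _ Q) => t; have := h (1 - t)%:C.
  by rewrite cm_real real_normK ?num_real// ripZr; nra.
rewrite -[LHS]opprK; apply/eqP; rewrite oppr_eq0; apply/eqP.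
apply: (@quadratic_ge0_eq0 _ Q) => t; have := h (Complex 1 t).
rewrite cm_sqr/= expr1n.
have -> : Complex 1 t = 1 + t%:C * 'i.
  by apply/eqP; rewrite eq_complex/=; apply/andP; split; apply/eqP; ring.
by rewrite scalerDl scale1r -scalerA ripDr ripZr; lra.
Qed.

(* The first order condition for the perturbed problem, obtained from midpoint
   convexity along the points y + 2^-k (z - y). *)
Lemma minimizer_resolvent m x y : 0 <= m ->
  is_minimizer D q (1 + m) (m%:C *: x) y -> is_minimizer D q 1 (m%:C *: (x - y)) y.
Proof.
move=> m0 [Dy hy]; split=> // z Dz; have [h hE] : exists h, h = z - y by exists (z - y).
have Dh : D h by rewrite hE; exact: form_domB.
pose t k : R := 2^-1 ^+ k.
have Dt k : D (y + (t k)%:C *: h).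
  by apply: (form_domD cf) => //; exact: (form_domZ cf).
have convex k : q (y + (t k)%:C *: h) - q y <= t k * (q z - q y).
  elim: k => [|k IH]; first by rewrite /t expr0 scale1r mul1r hE addrCA subrr addr0.
  have := form_mid Dy (Dt k); have := form_ge0 cf (form_domB Dy (Dt k)).
  have -> : half *: (y + (y + (t k)%:C *: h)) = y + (t k.+1)%:C *: h.
    rewrite addrA scalerDr scalerA /half -rmorphM/= /t exprS; congr (_ + _).
    by rewrite -{3}[y]scale1r scalerDr -scalerDl -rmorphD/= (_ : _ + _ = 1)//; field.
  rewrite /t exprS -/(t k) => h1 h2; nra.
have ineq k : 0 <= (q z - q y + 2 * rip y h - 2 * m * rip (x - y) h) +
    t k * ((1 + m) * nr h ^+ 2).
  have tk : 0 < t k by rewrite exprn_gt0// invr_gt0.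
  have := hy _ (Dt k); have := convex k.
  rewrite /energy nr2D nrZ cm_real exprMn real_normK ?num_real// !ripZr !ripZl.
  rewrite !ripDr !ripZr ripBl => h1 h2; rewrite -(pmulr_rge0 _ tk); lra.
have : 0 <= q z - q y + 2 * rip y h - 2 * m * rip (x - y) h.
  apply: (@seq_lim_ge _ (fun k => q z - q y + 2 * rip y h - 2 * m * rip (x - y) h +
    t k * ((1 + m) * nr h ^+ 2))) => //.
  rewrite -[X in _ --> X]addr0.
  apply: cvgD; first exact: cvg_cst.
  rewrite -(mul0r ((1 + m) * nr h ^+ 2)); apply: cvgM; last exact: cvg_cst.
  apply: cvg_expr; rewrite ger0_norm ?invr_ge0// invf_lt1//; lra.
have -> : z = y + h by rewrite hE addrCA subrr addr0.
rewrite /energy nr2D ripZl ripDr !ripZl; have := sqr_ge0 (nr h); nra.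
Qed.

End OneForm.

(* Minimizing q + |.|^2 + m |. - x|^2 with m large approximates [x] by
   minimizers of the unperturbed problem, on which [q] and [q'] agree. *)
Lemma closed_form_le D q D' q' : closed_form D q -> closed_form D' q' ->
  (forall f y, is_minimizer D q 1 f y -> is_minimizer D' q' 1 f y) ->
  forall x, D x -> D' x /\ q' x <= q x.
Proof.
move=> cf cf' hmin x Dx.
have /choice[u hu] n : exists y, is_minimizer D q (1 + n.+1%:R) (n.+1%:R%:C *: x) y.
  by apply: ex_minimizer => //; rewrite addr_gt0.
have hv n : [/\ D (u n), D' (u n) & q' (u n) = q (u n)].
  have mn : is_minimizer D q 1 (n.+1%:R%:C *: (x - u n)) (u n).
    by apply: minimizer_resolvent => //; exact: hu.
  have mn' := hmin _ _ mn; split; [by case: mn|by case: mn'|].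
  (* Both forms plus |u n|^2 equal the same inner product, so they agree at [u n]. *)
  have := minimizer_val cf ltr01 mn; rewrite (minimizer_val cf' ltr01 mn').
  by move=> [/addIr].
have hx n : q (u n) + nr (u n) ^+ 2 + nr (u n - x) ^+ 2 * n.+1%:R <= q x + nr x ^+ 2.
  have [_ /(_ _ Dx)] := hu n; rewrite /energy !ripZl -nr2 nr2B (ripC (u n)).
  by move: (n.+1%:R : R) => d; lra.
have ux : cvs u x.
  apply: (@cvs_sqr _ _ _ _ (q x + nr x ^+ 2)) => n; apply: le_trans (hx n).
  by have [Dn _ _] := hv n; rewrite lerDr addr_ge0 ?sqr_ge0// (form_ge0 cf).
apply: (form_lsc_lim cf' (u := u) (r := fun n => q x + nr x ^+ 2 - nr (u n) ^+ 2)) => //.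
- by move=> n; have [] := hv n.
- move=> n; have [_ _ ->] := hv n; have := hx n.
  have : 0 <= nr (u n - x) ^+ 2 * n.+1%:R by rewrite mulr_ge0 ?sqr_ge0.
  by move: (_ * n.+1%:R) => d; lra.
- rewrite -{2}[q x](addrK (nr x ^+ 2)); apply: cvgB; first exact: cvg_cst.
  by apply: cvgM; exact: cvs_nr.
Qed.

(** The hypothesis reverses itself, by existence of minimizers for [q] and uniqueness for [q']; then
    [closed_form_le] applies both ways. *)
Lemma closed_form_eq D q D' q' : closed_form D q -> closed_form D' q' ->
  (forall f y, is_minimizer D q 1 f y -> is_minimizer D' q' 1 f y) ->
  D = D' /\ forall x, D x -> q' x = q x.
Proof.
move=> cf cf' h.
have h' f y : is_minimizer D' q' 1 f y -> is_minimizer D q 1 f y.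
  move=> hy; have [z hz] := ex_minimizer cf f ltr01.
  by rewrite (minimizer_unique cf' ltr01 hy (h _ _ hz)).
have le1 := closed_form_le cf cf' h; have le2 := closed_form_le cf' cf h'.
split=> [|x Dx].
  by apply/seteqP; split=> x; [case/le1|case/le2].
by apply/eqP; rewrite eq_le; have [D'x ->] := le1 _ Dx; have [_ ->] := le2 _ D'x.
Qed.

End ClosedForms.

(** * Square roots of bounded operators *)

Section SymmetricOperators.
Context {R : realType} {V : hilbertType R}.
Implicit Types (T L A : V -> V).

Definition symmetric_op T := forall x y, rip (T x) y = rip x (T y).

Lemma symmetric_inner T : linear T -> symmetric_op T ->
  forall x y, inner (T x) y = inner x (T y).
Proof. by move=> lT sT x y; rewrite !innerE !sT (linZ lT). Qed.

Lemma symmetric_innerr T x : linear T -> symmetric_op T ->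
  inner (T x) x = (rip (T x) x)%:C.
Proof.
move=> lT sT; have := innerC (T x) x; rewrite -symmetric_inner// /rip.
case: (inner _ _) => a b /= [/eqP]; rewrite -subr_eq0 opprK -mulr2n mulrn_eq0/=.
by move=> /eqP ->.
Qed.

(** T - T^2 = (I - T) T (I - T) + T (I - T) T, a sum of two nonnegative operators. *)
Lemma contraction_sqr T : linear T -> symmetric_op T ->
  (forall x, 0 <= rip (T x) x) -> (forall x, rip (T x) x <= nr x ^+ 2) ->
  forall x, nr (T x) ^+ 2 <= rip (T x) x.
Proof.
move=> lT sT T0 T1 x; have := T0 (x - T x); have := T1 (T x).
rewrite (linB lT) !ripBl !ripBr (sT (T x) x) -!nr2; lra.
Qed.

Lemma contraction_nr T : linear T -> symmetric_op T ->
  (forall x, 0 <= rip (T x) x) -> (forall x, rip (T x) x <= nr x ^+ 2) ->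
  forall x, nr (T x) <= nr x.
Proof.
move=> lT sT T0 T1 x; rewrite -(ler_pXn2r (ltn0Sn 1)) ?nnegrE ?nr_ge0//.
exact: le_trans (contraction_sqr _ _ _ _ _) (T1 x).
Qed.

(** The Riesz vector [z] is the projection of [x] on the closure of the range, so [T (x - z)]
    vanishes and injectivity gives x = z. *)
Lemma symmetric_dense T : linear T -> symmetric_op T ->
  (forall x, T x = 0 -> x = 0) -> dense (range T).
Proof.
move=> lT sT injT; apply/dense_closure => x.
have [|a u v _ _|u _|z [cz _ hz]] :=
    @riesz_relation _ V V setT T (fun y => inner (T y) x) (nr x) (nr_ge0 x).
- by [].
- by rewrite lT linearDl linearZl_LR.
- by rewrite mulrC cm_inner_le.
suff -> : x = z by [].
apply/eqP; rewrite -subr_eq0; apply/eqP/injT/inner_eq0.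
by rewrite -(symmetric_inner lT sT) linearBr/= hz// subrr.
Qed.

End SymmetricOperators.

(* Writing T = I - A, the square root is I - Z with Z = (A + Z^2) / 2, and Z is
   the limit of the fixed point iteration; the increments of the iterates are
   dominated in norm by those of the scalar iteration with A = 1. *)
Section SquareRoot.
Context {R : realType} {V : hilbertType R}.
Variables (A : V -> V).
Hypotheses (lA : linear A) (sA : symmetric_op A) (bA : forall x, nr (A x) <= nr x).

Let half : R[i] := (2^-1)%:C.

Fixpoint sqrt_iter n x :=
  if n is n'.+1 then half *: (A x + sqrt_iter n' (sqrt_iter n' x)) else 0.

Fixpoint sqrt_iter_bound n : R :=
  if n is n'.+1 then 2^-1 * (1 + sqrt_iter_bound n' ^+ 2) else 0.

Let Z := sqrt_iter.
Let z := sqrt_iter_bound.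

Let ZS n x : Z n.+1 x = half *: (A x + Z n (Z n x)). Proof. by []. Qed.
Let zS n : z n.+1 = 2^-1 * (1 + z n ^+ 2). Proof. by []. Qed.

Let nr_half (x : V) : nr (half *: x) = 2^-1 * nr x.
Proof. by rewrite nrZ cm_real ger0_norm// invr_ge0. Qed.

Let linZn n : linear (Z n).
Proof.
elim: n => [|n IH] a x y /=; first by rewrite scaler0 addr0.
rewrite !IH lA !scalerDr !scalerA (mulrC half) -!addrA; congr (_ + _).
by rewrite addrCA.
Qed.

Let symZn n : symmetric_op (Z n).
Proof.
elim: n => [|n IH] x y /=; first by rewrite rip0l rip0r.
by rewrite ripZl ripZr ripDl ripDr sA !IH.
Qed.

Let commZn n (L : V -> V) : linear L -> (forall x, L (A x) = A (L x)) ->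
  forall x, L (Z n x) = Z n (L x).
Proof.
move=> lL LA; elim: n => [|n IH] x /=; first exact: (lin0 lL).
by rewrite (linZ lL) (linD lL) LA !IH.
Qed.

Let commZ m n x : Z m (Z n x) = Z n (Z m x).
Proof. by apply: commZn => // y; apply/esym; exact: commZn. Qed.

Let z_bound n : 0 <= z n <= 1 /\ z n <= z n.+1.
Proof.
suff h k : 0 <= z k <= 1 by split; [exact: h|have /andP[] := h n; rewrite /=; nra].
elim: k => [|k /andP[k0 k1]] /=; first by rewrite lexx ler01.
by apply/andP; split; nra.
Qed.

Let nrZn n x : nr (Z n x) <= z n * nr x.
Proof.
elim: n x => [|n IH] x; first by rewrite nr0 mul0r.
rewrite /= nr_half -mulrA ler_pM2l ?invr_gt0// mulrDl mul1r.
rewrite (le_trans (nrD _ _))// lerD// (le_trans (IH _))//.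
have [/andP[z0 _] _] := z_bound n.
by rewrite expr2 -mulrA ler_wpM2l.
Qed.

Let nrZn1 n x : nr (Z n x) <= nr x.
Proof.
rewrite (le_trans (nrZn _ _))// ler_piMl ?nr_ge0//.
by have [/andP[]] := z_bound n.
Qed.

Let incrZ n x : nr (Z n.+1 x - Z n x) <= (z n.+1 - z n) * nr x.
Proof.
elim: n x => [|n IH] x.
  by rewrite /= !subr0 addr0 nr_half expr0n/= addr0 mulr1 ler_pM2l ?invr_gt0.
set w := Z n.+1 x - Z n x.
(* The iterates are polynomials in [A], hence commute, and the difference of their squares factors;
   the scalar iterates factor in the same way. *)
have -> : Z n.+2 x - Z n.+1 x = half *: (Z n.+1 w + Z n w).
  rewrite (ZS n.+1 x) [X in _ - X](ZS n x) -scalerBr; congr (_ *: _).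
  rewrite opprD addrACA subrr add0r /w !(linB (linZn _)) (commZ n.+1 n).
  by rewrite addrA subrK.
have [/andP[z0 _] zz] := z_bound n.
have -> : z n.+2 - z n.+1 = 2^-1 * (z n.+1 + z n) * (z n.+1 - z n).
  by rewrite (zS n.+1) [X in _ - X](zS n); field.
rewrite nr_half -!mulrA ler_pM2l ?invr_gt0// (le_trans (nrD _ _))// mulrDl.
have z1 : 0 <= z n.+1 := le_trans z0 zz.
apply: lerD; rewrite (le_trans (nrZn _ _))// ler_wpM2l//; exact: IH.
Qed.

Lemma sqrt_iter_cvs : exists Zl : V -> V, forall x, cvs (Z ^~ x) (Zl x).
Proof.
have /choice[Zl] x : exists y, cvs (Z ^~ x) y; last by exists Zl.
apply: (@dominated_cvs _ _ _ (fun n => z n * nr x)) => [n|].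
  by rewrite -mulrBl; exact: incrZ.
apply: is_cvgM; last exact: is_cvg_cst.
apply: nondecreasing_is_cvgn.
  by apply/nondecreasing_seqP => n; have [] := z_bound n.
by exists 1 => _ [n _ <-]; have [/andP[]] := z_bound n.
Qed.

Lemma sqrt_iter_limit : exists Zl : V -> V,
  [/\ linear Zl, symmetric_op Zl, forall x, nr (Zl x) <= nr x,
      forall x, Zl x = half *: (A x + Zl (Zl x)) &
      forall L M, linear L -> (forall x, nr (L x) <= M * nr x) ->
        (forall x, L (A x) = A (L x)) -> forall x, L (Zl x) = Zl (L x)].
Proof.
have [Zl hZ] := sqrt_iter_cvs; exists Zl.
have lZl : linear Zl.
  move=> a x y; apply: (cvs_unique (hZ _)).
  by under eq_fun do rewrite linZn; apply: cvsD => //; exact: cvsZ.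
split=> //.
- move=> x y; have h1 := @cvs_rip _ _ _ _ y (hZ x); have h2 := @cvs_rip _ _ _ _ x (hZ y).
  have e : (fun n => rip (Z n y) x) = (fun n => rip (Z n x) y).
    by apply/funext => n; rewrite symZn ripC.
  by rewrite e in h2; rewrite [RHS]ripC; exact: (cvg_unique _ h1 h2).
- by move=> x; apply: seq_lim_le (cvs_nr (hZ x)) => n; exact: nrZn1.
- move=> x; apply: (cvs_unique (cvs_shift 1 (hZ x))).
  under eq_fun do rewrite addn1 [Z _ _]/=.
  apply: cvsZ; apply: cvsD; first exact: cvs_cst.
  (* Pointwise convergence passes to the composite because all iterates are contractions. *)
  apply: (@cvs_le _ _ _ _ (fun n => nr (Z n x - Zl x) + nr (Z n (Zl x) - Zl (Zl x)))).
    move=> n; rewrite -/Z -(subrK (Z n (Zl x)) (Z n (Z n x))) -addrA.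
    by rewrite (le_trans (nrD _ _))// lerD2r -(linB (linZn n)) nrZn1.
  by rewrite -(addr0 0); apply: cvgD; exact: hZ.
- move=> L M lL bL LA x; apply: (cvs_unique (cvs_lin lL bL (hZ x))).
  by rewrite /comp; under eq_fun do rewrite (commZn _ lL LA); exact: hZ.
Qed.

End SquareRoot.

Section OperatorSquareRoot.
Context {R : realType} {V : hilbertType R}.

(** T = I - A and 2 Z = A + Z^2 give (I - Z)^2 = T. The commutation clause is there to let the
    square roots of [G] and I - [G] commute below. *)
Lemma ex_sqrt (T : V -> V) : linear T -> symmetric_op T ->
  (forall x, 0 <= rip (T x) x) -> (forall x, rip (T x) x <= nr x ^+ 2) ->
  exists Q : V -> V,
  [/\ linear Q /\ symmetric_op Q,
      forall x, 0 <= rip (Q x) x,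
      forall x, Q (Q x) = T x,
      forall x, nr (Q x) <= nr x &
      forall L M, linear L -> (forall x, nr (L x) <= M * nr x) ->
        (forall x, L (T x) = T (L x)) -> forall x, L (Q x) = Q (L x)].
Proof.
move=> lT sT T0 T1; pose A x := x - T x.
have lA : linear A.
  by move=> a x y; rewrite /A lT opprD addrACA -scalerBr.
have sA : symmetric_op A by move=> x y; rewrite /A ripBl ripBr sT.
have bA x : nr (A x) <= nr x.
  apply: contraction_nr => // y; rewrite /A ripBl -nr2; last by rewrite lerBlDr lerDl.
  by rewrite subr_ge0.
have [Z [lZ sZ bZ eZ cZ]] := sqrt_iter_limit lA sA bA; exists (fun x => x - Z x).
have sQ : symmetric_op (fun x => x - Z x) by move=> x y; rewrite ripBl ripBr sZ.
have QQ x : x - Z x - Z (x - Z x) = T x.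
  have := congr1 (fun t => t + t) (eZ x).
  rewrite -scalerDl -rmorphD/= (_ : 2^-1 + 2^-1 = 1); last by field.
  rewrite scale1r /A (linB lZ) => h.
  by rewrite opprB addrACA -opprD h opprD opprB addrACA subrr addr0 addrC subrK.
split=> //.
- by split=> // a x y; rewrite lZ opprD addrACA -scalerBr.
- move=> x; rewrite ripBl -nr2 subr_ge0 (le_trans (rip_le _ _))// expr2.
  by rewrite ler_wpM2r ?nr_ge0.
- move=> x; rewrite -(ler_pXn2r (ltn0Sn 1)) ?nnegrE ?nr_ge0//.
  by rewrite nr2 -sQ QQ.
- move=> L M lL bL LT x; rewrite (linB lL) (cZ L M)// => y.
  by rewrite /A (linB lL) LT.
Qed.

End OperatorSquareRoot.

(** * Selfadjoint operators and the representation of closed forms *)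

Section PartialOperators.
Context {R : realType} {V : hilbertType R}.
Implicit Types (S H : partial_op V V) (T : V -> V).

Lemma selfadjoint_symmetric S x y : selfadjoint S -> pdom S x -> pdom S y ->
  inner (S x) y = inner x (S y).
Proof.
by move=> [_ _ hS] Sx Sy; have /(_ x Sx) := (hS y (S y)).2 (conj Sy erefl).
Qed.

Lemma selfadjoint_linear S : selfadjoint S -> linear_partial_op S.
Proof. by case. Qed.

Lemma pdomZ S a x : linear_partial_op S -> pdom S x ->
  pdom S (a *: x) /\ S (a *: x) = a *: S x.
Proof.
move=> [S0 lS] Sx.
have S00 : S 0 = 0.
  have [_ +] := lS 1 0 0 S0 S0; rewrite scaler0 scale1r addr0 => /eqP.
  by rewrite -{1}[S 0]addr0 (inj_eq (addrI _)) eq_sym => /eqP.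
by have := lS a x 0 Sx S0; rewrite !addr0 S00 addr0.
Qed.

Lemma pdomD S x y : linear_partial_op S -> pdom S x -> pdom S y ->
  pdom S (x + y) /\ S (x + y) = S x + S y.
Proof. by move=> [_ lS] Sx Sy; have := lS 1 x y Sx Sy; rewrite !scale1r. Qed.

Lemma pdomB S x y : linear_partial_op S -> pdom S x -> pdom S y ->
  pdom S (x - y) /\ S (x - y) = S x - S y.
Proof.
move=> lS Sx Sy; have [Sy' ey] := pdomZ (-1) lS Sy.
by have := pdomD lS Sx Sy'; rewrite ey !scaleN1r.
Qed.

(* The domain of [S] is the set of the [x] such that [rip (S y) x] is bounded
   in terms of the norm of [y]; this is how selfadjointness gives closedness. *)
Lemma selfadjoint_dom S x M : selfadjoint S -> 0 <= M ->
  (forall y, pdom S y -> rip (S y) x <= M * nr y) -> pdom S x /\ nr (S x) <= M.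
Proof.
move=> saS M0 hM; have [lS _ hS] := saS.
have [|a u v Su Sv|y Sy|z [_ zM hz]] :=
    @riesz_relation _ V V (pdom S) id (fun y => inner (S y) x) M M0.
- by case: lS.
- by have [? ->] := lS.2 a u v Su Sv; rewrite linearDl linearZl_LR.
- apply: cm_le_Re => a ca; have [Say eay] := pdomZ a lS Sy.
  by have := hM _ Say; rewrite eay /rip linearZl_LR/= nrZ ca mul1r.
by have [Sx ->] := (hS x z).1 hz.
Qed.

(** Closedness: [rip (S y) (u n)] is at most sqrt M times [nr y]; this bound survives the limit, and
    [selfadjoint_dom] then applies. *)
Lemma selfadjoint_closed_form S : selfadjoint S ->
  closed_form (pdom S) (fun x => nr (S x) ^+ 2).
Proof.
move=> saS; have lS := selfadjoint_linear saS; split.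
- by case: lS.
- by move=> x y Sx Sy; have [] := pdomD lS Sx Sy.
- by move=> a x Sx; have [] := pdomZ a lS Sx.
- by move=> x _; exact: sqr_ge0.
- by move=> a x Sx; have [_ ->] := pdomZ a lS Sx; rewrite nrZ exprMn.
- move=> x y Sx Sy; have [_ ->] := pdomD lS Sx Sy; have [_ ->] := pdomB lS Sx Sy.
  exact: parallelogram.
- move=> u x M Su hM ux.
  have M0 : 0 <= M := le_trans (sqr_ge0 _) (hM 0%N).
  have bS n : nr (S (u n)) <= Num.sqrt M.
    by rewrite -[leLHS]ger0_norm ?nr_ge0// -sqrtr_sqr ler_wsqrtr.
  have [|Sx nSx] := selfadjoint_dom (x := x) saS (sqrtr_ge0 M).
    move=> y Sy; rewrite ripC; apply: seq_lim_le (cvs_rip ux) => n.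
    rewrite ripC /rip (selfadjoint_symmetric saS Sy (Su n)) -/(rip _ _).
    by rewrite (le_trans (rip_le _ _))// mulrC ler_wpM2r ?nr_ge0.
  by split=> //; rewrite -(sqr_sqrtr M0) ler_pXn2r ?nnegrE ?nr_ge0.
Qed.

Lemma everywhere_selfadjoint T : linear T -> symmetric_op T ->
  selfadjoint (everywhere T).
Proof.
move=> lT sT; split=> [||y z]; first by split=> // a x y _ _; rewrite /= lT.
  by apply/dense_closure => x; exact: subset_closure.
split=> [h|[_ <-] x _]; last by rewrite /= symmetric_inner.
split=> //=; apply/eqP; rewrite -subr_eq0; apply/eqP/inner_eq0.
by rewrite linearBr/= -(symmetric_inner lT sT) (h _ I) subrr.
Qed.

Lemma everywhere_nonnegative T : linear T -> symmetric_op T ->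
  nonnegative (everywhere T) <-> forall x, 0 <= rip (T x) x.
Proof.
move=> lT sT; split=> [h x|h x _].
  by have := h x I; rewrite /= symmetric_innerr// ler0c.
by rewrite /= symmetric_innerr// ler0c.
Qed.

Lemma ex_sqrt_everywhere T : linear T -> symmetric_op T ->
  (forall x, 0 <= rip (T x) x) -> (forall x, rip (T x) x <= nr x ^+ 2) ->
  exists S, is_sqrt (everywhere T) S.
Proof.
move=> lT sT T0 T1; have [Q [[lQ sQ] Q0 QQ _ _]] := ex_sqrt lT sT T0 T1.
exists (everywhere Q); split; [exact: everywhere_selfadjoint| |].
  exact/everywhere_nonnegative.
by move=> x y; split=> [[_ <-]|[_ _ <-]]; split=> //=; rewrite QQ.
Qed.

Lemma sqrt_opP H : (exists S, is_sqrt H S) -> is_sqrt H (sqrt_op H).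
Proof. by move=> [S hS]; rewrite /sqrt_op; case: xgetP => [S' _ //|/(_ S)]. Qed.

End PartialOperators.

(* The operator H with (I + H)^-1 = G.  If R and K are the square roots of G and
   I - G then H^(1/2) is K R^-1. *)
Section OperatorOfResolvent.
Context {R : realType} {V : hilbertType R}.
Variable G : V -> V.
Hypotheses (lG : linear G) (sG : symmetric_op G).
Hypothesis G0 : forall x, 0 <= rip (G x) x.
Hypothesis G1 : forall x, rip (G x) x <= nr x ^+ 2.
Hypothesis injG : forall x, G x = 0 -> x = 0.

Definition resolvent_op : partial_op V V :=
  PartialOp (range G) (fun x => xget 0 [set w | G w = x] - x).

Let G_inj w w' : G w = G w' -> w = w'.
Proof.
move=> h; apply/eqP; rewrite -subr_eq0; apply/eqP/injG.
by rewrite (linB lG) h subrr.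
Qed.

Lemma resolvent_opE w : resolvent_op (G w) = w - G w.
Proof.
rewrite /resolvent_op/=; case: xgetP => [w' -> /= /G_inj ->//|/(_ w)].
by case.
Qed.

Lemma selfadjoint_resolvent_op : selfadjoint resolvent_op.
Proof.
split.
- split; first by exists 0 => //; exact: (lin0 lG).
  move=> a _ _ [u _ <-] [v _ <-]; rewrite -lG; split; first by exists (a *: u + v).
  by rewrite !resolvent_opE lG scalerBr opprD addrACA.
- exact: symmetric_dense.
- move=> y z; split=> [h|[[w _ <-] <-] _ [v _ <-]]; last first.
    by rewrite !resolvent_opE linearBl linearBr/= (symmetric_inner lG sG v w).
  (* Testing the adjoint relation at [G t] gives <t, y> = <G t, y + z> = <t, G (y + z)>, and [t] is
     taken to be the difference of the two right-hand vectors. *)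
  suff yE : y = G (y + z).
    rewrite yE; split; first by exists (y + z).
    by rewrite resolvent_opE -yE addrAC subrr add0r.
  apply/eqP; rewrite -subr_eq0; apply/eqP/inner_eq0; set t := y - _.
  have := h (G t) (ex_intro2 _ _ t I erefl).
  rewrite resolvent_opE linearBl (symmetric_inner lG sG t z) => h1.
  rewrite {2}/t linearBr/= (linD lG) linearDr/= -(symmetric_inner lG sG t y).
  by rewrite -h1 addrCA subrr addr0 subrr.
Qed.

Lemma ex_sqrt_resolvent_op : exists S, is_sqrt resolvent_op S.
Proof.
have bG := contraction_nr lG sG G0 G1.
have [Q [[lQ sQ] Q0 QQ bQ cQ]] := ex_sqrt lG sG G0 G1.
have lI : linear (fun x => x - G x).
  by move=> a x y; rewrite lG opprD addrACA -scalerBr.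
have [|x|x|K [[lK sK] K0 KK bK cK]] := @ex_sqrt _ _ (fun x => x - G x) lI.
- by move=> x y; rewrite ripBl ripBr sG.
- by rewrite ripBl -nr2 subr_ge0.
- by rewrite ripBl -nr2 lerBlDr lerDl.
have KG x : K (G x) = G (K x).
  apply/esym/(cK G 1) => // [y|y]; first by rewrite mul1r.
  by rewrite (linB lG).
have KQ x : K (Q x) = Q (K x) by apply: (cQ K 1) => // y; rewrite mul1r.
have Q1 x : rip (Q x) x <= nr x ^+ 2.
  by rewrite (le_trans (rip_le _ _))// expr2 ler_wpM2r ?nr_ge0.
(* [P] is a fourth root of [G]; it serves to write <K w, Q w> as <K P w, P w>, which shows that [S]
   is nonnegative. *)
have [P [[lP sP] _ PP _ cP]] := ex_sqrt lQ sQ Q0 Q1.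
have KP x : K (P x) = P (K x) by apply: (cP K 1) => // y; rewrite mul1r.
have injQ x : Q x = 0 -> x = 0.
  by move=> h; apply: injG; rewrite -QQ h (lin0 lQ).
have Q_inj x y : Q x = Q y -> x = y.
  move=> h; apply/eqP; rewrite -subr_eq0; apply/eqP/injQ.
  by rewrite (linB lQ) h subrr.
have id_KQ x : x = K (K x) + Q (Q x) by rewrite KK QQ subrK.
(* K^2 + Q^2 = I puts [a] in the range of [Q] as soon as [K a] is there: this governs the domains
   both of the adjoint and of the square of [S]. *)
have solve a b : K a = Q b -> a = Q (K b + Q a).
  by move=> h; rewrite (linD lQ) -KQ -h -id_KQ.
pose S := PartialOp (range Q) (fun x => K (xget 0 [set w | Q w = x])).
have SE w : S (Q w) = K w.
  by rewrite /=; case: xgetP => [w' -> /= /Q_inj ->//|/(_ w)]; case.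
exists S; split.
- split.
  + split; first by exists 0 => //; exact: (lin0 lQ).
    move=> a _ _ [u _ <-] [v _ <-]; rewrite -lQ; split; first by exists (a *: u + v).
    by rewrite !SE lK.
  + exact: symmetric_dense.
  + move=> y z; split=> [h|[[w _ <-] <-] _ [v _ <-]]; last first.
      by rewrite !SE (symmetric_inner lK sK) KQ -(symmetric_inner lQ sQ).
    have Kyz : K y = Q z.
      apply/eqP; rewrite -subr_eq0; apply/eqP/inner_eq0; set t := _ - _.
      have := h (Q t) (ex_intro2 _ _ t I erefl); rewrite SE => h1.
      rewrite {2}/t linearBr/= -(symmetric_inner lK sK) h1.
      by rewrite -(symmetric_inner lQ sQ) subrr.
    have yE := solve _ _ Kyz; rewrite yE; split; first by exists (K z + Q y).
    by rewrite SE (linD lK) KQ Kyz -id_KQ.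
- move=> _ [w _ <-]; rewrite SE (_ : inner _ _ = (rip (K (P w)) (P w))%:C) ?ler0c//.
  by rewrite -(symmetric_innerr _ lK sK) KP (symmetric_inner lP sP) PP.
- move=> x y; split=> [[[w _ <-] <-]|[[a _ <-] [b _]]].
    rewrite resolvent_opE -(QQ w) SE KQ; split; [by exists (Q w)|by exists (K w)|].
    by rewrite SE KK QQ.
  rewrite SE => h; rewrite -h SE => <-; have aE := solve _ _ (esym h).
  rewrite {1 2}aE QQ; split; first by exists (K b + Q a).
  rewrite resolvent_opE -KK; congr (K _); apply: Q_inj.
  by rewrite -KQ -aE h.
Qed.

End OperatorOfResolvent.

Section Representation.
Context {R : realType} {V : hilbertType R}.
Variables (D : set V) (q : V -> R).
Hypotheses (cf : closed_form D q) (denseD : dense D).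

(** [G] sends [f] to its minimizer; it is linear by uniqueness, and the value <f, G f> = q(G f) + |G
    f|^2 yields positivity and the bound by 1. *)
Lemma ex_form_resolvent : exists G : V -> V,
  [/\ linear G /\ symmetric_op G,
      (forall x, 0 <= rip (G x) x), (forall x, rip (G x) x <= nr x ^+ 2),
      (forall x, G x = 0 -> x = 0) & forall f, is_minimizer D q 1 f (G f)].
Proof.
have /choice[G hG] f := ex_minimizer cf f ltr01; exists G.
have uniq f y : is_minimizer D q 1 f y -> y = G f.
  by move=> hy; exact: (minimizer_unique cf ltr01 hy (hG f)).
have lG : linear G.
  move=> a x y; apply/esym/uniq; apply: minimizerD => //.
  exact: (minimizerZ cf a (hG x) ltr01).
have GE f := minimizer_val cf ltr01 (hG f).
have GRe f : rip f (G f) = q (G f) + nr (G f) ^+ 2 by rewrite /rip GE mul1r.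
have GIm f : rip f ('i *: G f) = 0.
  by have := GE f; rewrite innerE => -[_ ->].
have DG f : D (G f) by case: (hG f).
have qG f : 0 <= q (G f) by exact: (form_ge0 cf).
have sG : symmetric_op G.
  (* <f, G f> is real for every f; at [x + 'i *: y] this says that the two cross terms agree. *)
  move=> x y; have := GIm (x + 'i *: y).
  have ii : ('i : R[i]) * 'i = -1 by rewrite -expr2 sqr_i.
  rewrite (linD lG) (linZ lG) scalerDr scalerA ii scaleN1r !ripDl !ripDr GIm !ripNr.
  have -> : rip ('i *: y) (G y) = 0 by rewrite ripi GIm oppr0.
  by rewrite subr0 ripZZ cmI expr1n mul1r add0r [rip (G x) y]ripC => /eqP;
    rewrite addrC subr_eq0 => /eqP.
split=> //.
- by move=> x; rewrite ripC GRe addr_ge0 ?sqr_ge0.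
- move=> x; rewrite ripC; have := GRe x; have := rip_le x (G x).
  have := qG x; have := nr_ge0 x; have := nr_ge0 (G x).
  by move=> g0 x0 q0 h1 h2; have : nr (G x) <= nr x; nra.
(* If 0 is the minimizer for [f], the first variation makes [f] orthogonal to the dense domain. *)
- move=> f Gf0; suff h y : D y -> rip f y = 0.
    apply: rip_eq0; have /dense_closure/(_ f)/closure_cvs[u Du uf] := denseD.
    apply/eqP; rewrite eq_le; apply/andP; split.
      by apply: seq_lim_le (cvs_rip uf) => n; rewrite ripC h.
    by apply: seq_lim_ge (cvs_rip uf) => n; rewrite ripC h.
  move=> Dy; apply/eqP; rewrite -oppr_eq0; apply/eqP.
  apply: (@quadratic_ge0_eq0 _ (q y + nr y ^+ 2)) => t.
  have [_ /(_ _ (form_domZ cf t%:C Dy))] := hG f.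
  rewrite Gf0 /energy (form_scale cf)// nrZ ripZr cm_real exprMn real_normK ?num_real//.
  have := form_scale cf 0 (form_dom0 cf); rewrite scale0r cm0 expr0n/= mul0r => ->.
  by rewrite nr0 rip0r expr0n/=; lra.
Qed.

(** The last clause quantifies over all square roots because [sqrt_op] picks an unspecified one. *)
Lemma form_representation : exists H : partial_op V V,
  [/\ selfadjoint H, (exists S, is_sqrt H S) &
      forall S, is_sqrt H S -> D = pdom S /\ forall x, D x -> nr (S x) ^+ 2 = q x].
Proof.
have [G [[lG sG] G0 G1 injG hG]] := ex_form_resolvent.
exists (resolvent_op G); split.
- exact: selfadjoint_resolvent_op.
- exact: ex_sqrt_resolvent_op.
move=> S [saS _ hS]; apply: (closed_form_eq cf (selfadjoint_closed_form saS)).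
move=> f y hy; have -> := minimizer_unique cf ltr01 hy (hG f).
(* Since S (S (G f)) = f - G f, the terms linear in [h] cancel when the energy is expanded at
   [G f + h]: [G f] is a minimizer for |S z|^2 as well. *)
have [//|Sy SSy eS] := (hS (G f) (f - G f)).1.
  by split; [exists f|exact: resolvent_opE].
split=> // z Sz; have lS := selfadjoint_linear saS.
have [h zE] : exists h, z = G f + h by exists (z - G f); rewrite addrCA subrr addr0.
have [Sh eh] : pdom S h /\ S z = S (G f) + S h.
  have -> : h = z - G f by rewrite zE addrAC subrr add0r.
  by have [? ->] := pdomB lS Sz Sy; rewrite addrCA subrr addr0.
have := selfadjoint_symmetric saS Sh SSy; rewrite eS => /(congr1 (@complex.Re _)).
rewrite -!/(rip _ _) ripBr (ripC (S h)) !(ripC h) => e1.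
rewrite /energy eh zE !nr2D ripDr e1.
by have := sqr_ge0 (nr h); have := sqr_ge0 (nr (S h)); lra.
Qed.

End Representation.

(** * The pseudo-inverse and Douglas' lemma *)

Section PseudoInverse.
Context {R : realType} {V : hilbertType R}.

Lemma inner_ext (x y : V) : (forall v, inner v x = inner v y) -> x = y.
Proof.
move=> h; apply/eqP; rewrite -subr_eq0; apply/eqP/inner_eq0.
by rewrite linearBr/= h subrr.
Qed.

Variable T : V -> V.
Hypotheses (lT : linear T) (sT : symmetric_op T).

Lemma closure_range_orthogonal x y : closure (range T) x -> T y = 0 -> rip x y = 0.
Proof.
move=> /closure_cvs[u ru ux] Ty.
have h n : rip (u n) y = 0 by have [v _ <-] := ru n; rewrite sT Ty rip0r.
apply/eqP; rewrite eq_le; apply/andP; split.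
  by apply: seq_lim_le (cvs_rip ux) => n; rewrite h.
by apply: seq_lim_ge (cvs_rip ux) => n; rewrite h.
Qed.

Lemma pinvE x : closure (range T) x -> Defs.pinv T (T x) = x.
Proof.
move=> cx; rewrite /Defs.pinv/=; case: xgetP => [y _ [cy Ty]|/(_ x)]; last first.
  by case; split=> //; rewrite subrr (lin0 lT).
rewrite -(linB lT) in Ty; have Txy : T (x - y) = 0.
  by apply: rip_eq0; rewrite sT Ty rip0r.
apply/esym/eqP; rewrite -subr_eq0; apply/eqP/rip_eq0.
by rewrite ripBl !closure_range_orthogonal// subrr.
Qed.

(** The projection [z] of [w] on the closure of the range has the same image as [w] under [T], so
    the pseudo-inverse is meaningful at every [T w]. *)
Lemma pinv_range w :
  closure (range T) (Defs.pinv T (T w)) /\ T (Defs.pinv T (T w)) = T w.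
Proof.
have [|a u v _ _|u _|z [cz _ hz]] :=
    @riesz_relation _ V V setT T (fun u => inner (T u) w) (nr w) (nr_ge0 w).
- by [].
- by rewrite lT linearDl linearZl_LR.
- by rewrite mulrC cm_inner_le.
have Tz : T w = T z.
  by apply: inner_ext => v; rewrite -!(symmetric_inner lT sT) hz.
by rewrite Tz pinvE.
Qed.

Lemma discriminant_le (k a b : R) : 0 <= a ->
  (forall t, 0 <= k - 2 * t * b + t ^+ 2 * a) -> b ^+ 2 <= k * a.
Proof.
rewrite le_eqVlt => /orP[/eqP <-|a0] h.
  have [->|b0] := eqVneq b 0; first by rewrite mulr0 expr0n.
  (* With a = 0 the expression is affine in t, and here takes the value -1. *)
  have := h ((k + 1) / (2 * b)).
  have -> : 2 * ((k + 1) / (2 * b)) * b = k + 1 by field.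
  by rewrite mulr0; lra.
have := h (b / a).
have -> : k - 2 * (b / a) * b + (b / a) ^+ 2 * a = (k * a - b ^+ 2) / a.
  by field; rewrite gt_eqF.
by rewrite pmulr_lge0 ?invr_gt0// subr_ge0.
Qed.

(** The discriminant gives |<u, c>|^2 <= k |T u|^2, so [T u |-> <u, c>] is a bounded functional on
    the range of [T]. Its Riesz vector lies in the closure of the range, has norm at most sqrt k and
    is mapped to [c] by [T]: it is the pseudo-inverse at [c]. *)
Lemma douglas c k : 0 <= k ->
  (forall u, 0 <= k - 2 * rip c u + nr (T u) ^+ 2) ->
  range T c /\ nr (Defs.pinv T c) ^+ 2 <= k.
Proof.
move=> k0 hk.
have [|a u v _ _|u _|z [cz nz hz]] :=
    @riesz_relation _ V V setT T (fun u => inner u c) (Num.sqrt k) (sqrtr_ge0 k).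
- by [].
- by rewrite lT linearDl linearZl_LR.
- apply: cm_le_Re => a ca; rewrite -[nr (T u)]mul1r -ca -nrZ -(linZ lT).
  have -> : a * inner u c = inner (a *: u) c by rewrite linearZl_LR.
  rewrite -/(rip _ _); set v := a *: u.
  have [|/ltW v0] := leP (rip v c) 0.
    by move=> h; rewrite (le_trans h)// mulr_ge0 ?sqrtr_ge0 ?nr_ge0.
  rewrite -(ler_pXn2r (ltn0Sn 1)) ?nnegrE ?mulr_ge0 ?sqrtr_ge0 ?nr_ge0//.
  rewrite exprMn sqr_sqrtr//; apply: discriminant_le => [|t]; first exact: sqr_ge0.
  have := hk (t%:C *: v); rewrite ripZr (linZ lT) nrZ cm_real exprMn.
  by rewrite real_normK ?num_real// (ripC c) mulrA.
have cE : c = T z by apply: inner_ext => v; rewrite -(symmetric_inner lT sT) hz.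
rewrite cE pinvE//; split; first by exists z.
by rewrite -(sqr_sqrtr k0) ler_pXn2r ?nnegrE ?nr_ge0 ?sqrtr_ge0.
Qed.

End PseudoInverse.

Section Adjoints.
Context {R : realType} {V W : hilbertType R} {T : V -> W}.
Hypothesis bT : bounded_operator T.

Lemma adj_linear : linear (adj T).
Proof.
move=> a x y; apply: inner_ext => v; rewrite -adjP// linearDr/= linearDr/=.
by rewrite !linearZr_LR/= !adjP.
Qed.

Lemma ripl_adj x y : rip (adj T y) x = rip y (T x).
Proof. by rewrite ripC -rip_adj// ripC. Qed.

End Adjoints.

(** * The available storage *)

Section Storage.
Context {R : realType} {X U Y : hilbertType R}.
Variable Sigma : system X U Y.
Let A := sA Sigma.
Let B := sB Sigma.
Let C := sC Sigma.
Let D := sD Sigma.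
Let lA : linear A. Proof. by case: (sA_bounded Sigma). Qed.
Let lB : linear B. Proof. by case: (sB_bounded Sigma). Qed.
Let lC : linear C. Proof. by case: (sC_bounded Sigma). Qed.
Let lD : linear D. Proof. by case: (sD_bounded Sigma). Qed.

(* [energy_gain N x w] is the output energy minus the input energy over the first
   N steps, starting from the state [x] with the input [w]; its supremum, the
   available storage of Willems, is the form of a solution. *)
Fixpoint energy_gain N (x : X) (w : nat -> U) : R :=
  if N is N'.+1 then nr (C x + D (w 0%N)) ^+ 2 - nr (w 0%N) ^+ 2 +
    energy_gain N' (A x + B (w 0%N)) (fun k => w k.+1) else 0.

Lemma energy_gain_par N x y w v :
  energy_gain N (x + y) (fun k => w k + v k) + energy_gain N (x - y) (fun k => w k - v k)
  = 2 * energy_gain N x w + 2 * energy_gain N y v.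
Proof.
elim: N x y w v => [|N IH] x y w v /=; first by rewrite !mulr0 addr0.
rewrite !(linD lA) !(linD lB) !(linD lC) !(linD lD) !(linN lA) !(linN lB) !(linN lC) !(linN lD).
rewrite (addrACA (C x) (C y)) (addrACA (C x) (- C y)) (addrACA (A x) (A y)).
rewrite (addrACA (A x) (- A y)) -!opprD.
set a := nr (w _ + v _) ^+ 2; set b := nr (w _ - v _) ^+ 2.
have e1 : a + b = 2 * nr (w 0%N) ^+ 2 + 2 * nr (v 0%N) ^+ 2 by exact: parallelogram.
set c := nr (C x + D _ + _) ^+ 2; set d := nr (C x + D _ - _) ^+ 2.
have e2 : c + d = 2 * nr (C x + D (w 0%N)) ^+ 2 + 2 * nr (C y + D (v 0%N)) ^+ 2.
  exact: parallelogram.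
have e3 := IH (A x + B (w 0%N)) (A y + B (v 0%N)) (fun k => w k.+1) (fun k => v k.+1).
lra.
Qed.

Lemma energy_gainZ N a x w :
  energy_gain N (a *: x) (fun k => a *: w k) = cm a ^+ 2 * energy_gain N x w.
Proof.
elim: N x w => [|N IH] x w /=; first by rewrite mulr0.
rewrite (linZ lA) (linZ lB) (linZ lC) (linZ lD) -!scalerDr !nrZ !exprMn IH.
by ring.
Qed.

Lemma cvs_energy_gain N (u : nat -> X) x w : cvs u x ->
  energy_gain N (u n) w @[n --> \oo] --> energy_gain N x w.
Proof.
elim: N u x w => [|N IH] u x w ux /=; first exact: cvg_cst.
have [/bounded_operatorP[_ [a a0 ha]] /bounded_operatorP[_ [c c0 hc]]] :=
  (sA_bounded Sigma, sC_bounded Sigma).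
apply: cvgD.
  apply: cvgB; last exact: cvg_cst.
  have h : cvs (fun n => C (u n) + D (w 0%N)) (C x + D (w 0%N)).
    by apply: cvsD (cvs_cst _); exact: cvs_lin lC hc ux.
  by apply: cvgM; exact: cvs_nr.
by apply: IH; apply: cvsD (cvs_cst _); exact: cvs_lin lA ha ux.
Qed.

(** Under zero input each further step contributes a squared output. Gains over different horizons
    thereby become comparable. *)
Lemma energy_gain_truncate N k x w :
  energy_gain N x w <= energy_gain (N + k) x (fun i => if (i < N)%N then w i else 0).
Proof.
elim: N x w => [|N IH] x w /=.
  elim: k x => [|k IHk] x //=; rewrite nr0 expr0n/= subr0.
  by rewrite addr_ge0 ?sqr_ge0.
by rewrite lerD2l; exact: IH.
Qed.

Definition storage_dom : set X :=
  [set x | exists M, forall N w, energy_gain N x w <= M].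

Definition storage x := sup [set e | exists N w, e = energy_gain N x w].

Lemma energy_gain_le_storage N x w : storage_dom x -> energy_gain N x w <= storage x.
Proof.
move=> [M hM]; apply: ub_le_sup; last by exists N, w.
by exists M => _ [N' [w' ->]].
Qed.

Lemma storage_le x M : (forall N w, energy_gain N x w <= M) -> storage x <= M.
Proof.
move=> hM; apply: ge_sup; first by exists 0, 0%N, (fun=> 0).
by move=> _ [N [w ->]].
Qed.

Lemma storage_ge0 x : storage_dom x -> 0 <= storage x.
Proof. by move=> Dx; exact: (@energy_gain_le_storage 0 _ (fun=> 0)). Qed.

(** Inputs for the state [A x + B u] become inputs for [x] when [u] is put in front. *)
Lemma storage_step x u : storage_dom x -> storage_dom (A x + B u) /\
  storage (A x + B u) + nr (C x + D u) ^+ 2 - nr u ^+ 2 <= storage x.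
Proof.
move=> Dx; have h N w : energy_gain N (A x + B u) w <=
    storage x - nr (C x + D u) ^+ 2 + nr u ^+ 2.
  by have := @energy_gain_le_storage N.+1 _ (fun k => if k is k'.+1 then w k' else u) Dx;
    rewrite /=; lra.
split; first by eexists; exact: h.
by have := storage_le h; lra.
Qed.

Hypothesis passive : forall N w, energy_gain N 0 w <= 0.

Let half : R[i] := (2^-1)%:C.

(** Arbitrary inputs for [x + y] and [x - y], padded to a common horizon, are the sum and the
    difference of two inputs for [x] and [y]; so the parallelogram identity of the gains passes to
    their suprema as an inequality. *)
Let gain2 N M x y w v : storage_dom x -> storage_dom y ->
  energy_gain N (x + y) w + energy_gain M (x - y) v <= 2 * storage x + 2 * storage y.
Proof.
move=> Dx Dy; pose w' i := if (i < N)%N then w i else 0.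
pose v' i := if (i < M)%N then v i else 0.
apply: (@le_trans _ _ (energy_gain (N + M) (x + y) w' + energy_gain (N + M) (x - y) v')).
  by apply: lerD; [|rewrite addnC]; exact: energy_gain_truncate.
have h (z t : U) : half *: (z + t) + half *: (z - t) = z.
  rewrite -scalerDr addrACA subrr addr0 scalerDr -scalerDl.
  by rewrite /half -rmorphD/= (_ : 2^-1 + 2^-1 = 1) ?scale1r//; field.
have h' (z t : U) : half *: (z + t) - half *: (z - t) = t.
  by rewrite -[RHS](h t z) -scalerN opprB (addrC t z).
have := energy_gain_par (N + M) x y (fun k => half *: (w' k + v' k))
  (fun k => half *: (w' k - v' k)).
have -> : (fun k => half *: (w' k + v' k) + half *: (w' k - v' k)) = w'.
  by apply/funext => k; rewrite h.
have -> : (fun k => half *: (w' k + v' k) - half *: (w' k - v' k)) = v'.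
  by apply/funext => k; rewrite h'.
move=> ->.
by apply: lerD; rewrite ler_pM2l//; exact: energy_gain_le_storage.
Qed.

Lemma storage_dom0 : storage_dom 0.
Proof. by exists 0 => N w; exact: passive. Qed.

Lemma storage0 : storage 0 = 0.
Proof.
apply/eqP; rewrite eq_le storage_ge0 ?andbT; last exact: storage_dom0.
by apply: storage_le => N w; exact: passive.
Qed.

Let storage_domD x y : storage_dom x -> storage_dom y -> storage_dom (x + y).
Proof.
move=> Dx Dy; exists (2 * storage x + 2 * storage y) => N w.
by have := gain2 N 0 w (fun=> 0) Dx Dy; rewrite /= addr0.
Qed.

Let storage_domZ a x : storage_dom x ->
  storage_dom (a *: x) /\ storage (a *: x) <= cm a ^+ 2 * storage x.
Proof.
have [->|a0] := eqVneq a 0.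
  by rewrite scale0r cm0 expr0n/= mul0r storage0 lexx; split=> //; exact: storage_dom0.
move=> Dx; have h N w : energy_gain N (a *: x) w <= cm a ^+ 2 * storage x.
  have -> : w = (fun k => a *: (a^-1 *: w k)).
    by apply/funext => k; rewrite scalerA divff// scale1r.
  rewrite energy_gainZ ler_wpM2l ?sqr_ge0//; exact: energy_gain_le_storage.
by split; [eexists; exact: h|exact: storage_le].
Qed.

Let storageZ a x : storage_dom x -> storage (a *: x) = cm a ^+ 2 * storage x.
Proof.
move=> Dx; have [->|a0] := eqVneq a 0.
  by rewrite scale0r cm0 expr0n/= mul0r storage0.
have [Dax le1] := storage_domZ a Dx; apply/eqP; rewrite eq_le le1/=.
have [_] := storage_domZ a^-1 Dax; rewrite scalerA mulVf// scale1r cmV exprVn.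
by rewrite mulrC ler_pdivlMr ?exprn_gt0 ?cm_gt0// mulrC.
Qed.

Let storage_domB x y : storage_dom x -> storage_dom y -> storage_dom (x - y).
Proof.
move=> Dx Dy; rewrite -scaleN1r; apply: storage_domD => //.
by have [] := storage_domZ (-1) Dy.
Qed.

Let storage_par_le x y : storage_dom x -> storage_dom y ->
  storage (x + y) + storage (x - y) <= 2 * storage x + 2 * storage y.
Proof.
move=> Dx Dy; rewrite -lerBrDl; apply: storage_le => M v.
rewrite lerBrDl -lerBrDr; apply: storage_le => N w; rewrite lerBrDr.
exact: gain2.
Qed.

Lemma storage_closed_form : closed_form storage_dom storage.
Proof.
split=> //.
- exact: storage_dom0.
- by move=> a x Dx; have [] := storage_domZ a Dx.
- exact: storage_ge0.
(* The reverse inequality is [storage_par_le] at [x + y] and [x - y], whose sum and difference are 2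
   x and 2 y. *)
- move=> x y Dx Dy; apply/eqP; rewrite eq_le storage_par_le//=.
  have := storage_par_le (storage_domD Dx Dy) (storage_domB Dx Dy).
  rewrite addrACA subrr addr0 opprB [x + y + _]addrACA [y - x]addrC addrACA subrr add0r.
  have twoE (V : hilbertType R) (z : V) : z + z = (2 : R)%:C *: z.
    by rewrite -mulr2n -scaler_nat; congr (_ *: _); rewrite rmorph_nat.
  rewrite !twoE !storageZ// cm_real ger0_norm//; lra.
(* A supremum of continuous functions is lower semicontinuous. *)
- move=> u x M Du hM ux; have h N w : energy_gain N x w <= M.
    apply: (@seq_lim_le _ (fun n => energy_gain N (u n) w)) => [n|]; last exact: cvs_energy_gain.
    by rewrite (le_trans _ (hM n))// energy_gain_le_storage.
  by split; [exists M|exact: storage_le].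
Qed.

(** Under zero input the storage pays for the squared outputs; starting from zero it stays zero, and
    every C A^n x vanishes. *)
Lemma storage_eq0 x : storage_dom x -> storage x = 0 ->
  unobservable_space Sigma x.
Proof.
move=> Dx sx n _.
suff h : storage_dom (iter n A x) /\ storage (iter n A x) = 0.
  have [Dn sn] := h; have [DA] := storage_step 0 Dn; rewrite sn.
  rewrite (lin0 lD) addr0 nr0 expr0n/= subr0 => h1; apply/eqP.
  rewrite -nr_eq0 -sqrf_eq0 eq_le sqr_ge0 andbT; have := storage_ge0 DA; lra.
elim: n => [//|n [Dn sn]]; have [DA hA] := storage_step 0 Dn.
have s0 := storage_ge0 DA; move: DA hA s0; rewrite (lin0 lB) addr0 sn nr0 expr0n/= subr0.
move=> DA hA s0; split=> //; apply/eqP; rewrite eq_le s0 andbT.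
have := sqr_ge0 (nr (C (iter n A x) + D 0)); rewrite -/A; lra.
Qed.

Lemma reachable_storage_dom : reachable_space Sigma `<=` storage_dom.
Proof.
have DB u : storage_dom (B u).
  by have [] := storage_step u storage_dom0; rewrite (lin0 lA) add0r.
have DA x : storage_dom x -> storage_dom (A x).
  by move=> /(storage_step 0)[]; rewrite (lin0 lB) addr0.
move=> _ [n [a [v [hv ->]]]]; elim/big_ind: _ => //.
  exact: storage_dom0.
move=> i _; have [k _ [u _ <-]] := hv i.
suff h : storage_dom ((iter k A \o B) u) by have [] := storage_domZ (a i) h.
by elim: k => [|k IH] //=; exact: DA.
Qed.

End Storage.

(** * From the available storage to a solution of the Riccati inequality *)

Section RiccatiSolution.
Context {R : realType} {X U Y : hilbertType R}.
Variable Sigma : system X U Y.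
Let A := sA Sigma.
Let B := sB Sigma.
Let C := sC Sigma.
Let D := sD Sigma.
Let lA : linear A. Proof. by case: (sA_bounded Sigma). Qed.
Let lB : linear B. Proof. by case: (sB_bounded Sigma). Qed.
Let lC : linear C. Proof. by case: (sC_bounded Sigma). Qed.
Let lD : linear D. Proof. by case: (sD_bounded Sigma). Qed.

Lemma passive_RI : minimal Sigma -> (forall N w, energy_gain Sigma N 0 w <= 0) ->
  RI Sigma !=set0.
Proof.
move=> [reach obs] passive.
have cf := storage_closed_form passive.
have dD : dense (storage_dom Sigma).
  apply/dense_closure => x; move/dense_closure/(_ x): reach.
  exact/closureS/reachable_storage_dom.
have [H [saH exH hH]] := form_representation cf dD; exists H.
have sqH := sqrt_opP exH; have [saS nS hS] := sqH.
have [domE nE] := hH _ sqH; set S := sqrt_op H in sqH saS nS hS domE nE *.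
have lS := selfadjoint_linear saS.
pose q := storage Sigma.
have qE x : pdom S x -> nr (S x) ^+ 2 = q x by rewrite -domE => /nE.
have step x u : pdom S x -> pdom S (A x + B u) /\
    q (A x + B u) + nr (C x + D u) ^+ 2 - nr u ^+ 2 <= q x.
  by rewrite -domE; exact: storage_step.
have S0 : pdom S 0 by case: lS.
have q0 : q 0 = 0 by exact: storage0.
have SA x : pdom S x -> pdom S (A x).
  by move=> /(step _ 0)[]; rewrite (lin0 lB) addr0.
have SB u : pdom S (B u).
  by have [] := step _ u S0; rewrite (lin0 lA) add0r.
(* A step from the state 0 gives |S B u|^2 + |D u|^2 <= |u|^2. *)
have bSB : bounded_operator (fun u => S (B u)).
  apply/bounded_operatorP; split.
    by move=> a u v; rewrite lB; have [_ ->] := lS.2 a _ _ (SB u) (SB v).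
  exists 1 => // u; rewrite mul1r -(ler_pXn2r (ltn0Sn 1)) ?nnegrE ?nr_ge0//.
  have [_] := step _ u S0; rewrite qE// (lin0 lA) (lin0 lC) !add0r q0.
  have := sqr_ge0 (nr (D u)); lra.
have bD := sD_bounded Sigma.
set delta := riccati_delta Sigma H; set cross := riccati_cross Sigma H.
have ripd u v : rip (delta u) v = rip u v - rip (D u) (D v) - rip (S (B u)) (S (B v)).
  by rewrite /delta /riccati_delta !ripBl !ripl_adj.
have ripc x u : rip (cross x) u = rip (C x) (D u) + rip (S (A x)) (S (B u)).
  by rewrite /cross /riccati_cross ripDl !ripl_adj.
have ldelta : linear delta.
  move=> a u v; rewrite /delta /riccati_delta -/D -/B.
  have [lSB _] := bSB; rewrite lD lSB !(adj_linear bD) !(adj_linear bSB).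
  by rewrite !opprD !scalerDr !scalerN !addrA; congr (_ + _); rewrite addrAC;
     congr (_ + _); rewrite -!addrA; congr (_ + _); rewrite addrC -addrA;
     congr (_ + _); rewrite addrC.
have sdelta : symmetric_op delta.
  by move=> u v; rewrite ripd [RHS]ripC ripd (ripC v u) (ripC (D v)) (ripC (S (B v))).
(* The dissipation inequality with its squares expanded: [cross] collects the part linear in [u],
   [delta] the quadratic part. *)
have key x u : pdom S x ->
    0 <= q x - q (A x) - nr (C x) ^+ 2 - 2 * rip (cross x) u + rip (delta u) u.
  move=> Sx; have [SAB] := step x u Sx.
  rewrite -(qE _ SAB) (nr2D (C x)).
  have [_ ->] := pdomD lS (SA _ Sx) (SB u); rewrite nr2D (qE _ (SA _ Sx)) ripc ripd.
  by rewrite -!nr2; lra.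
have d0 u : 0 <= rip (delta u) u.
  have := key _ u S0; rewrite ripc (lin0 lA) (lin0 lC) q0 nr0 rip0l.
  have [S0' e0] := pdomZ 0 lS S0; move: e0; rewrite !scale0r => ->.
  by rewrite rip0l expr0n/=; lra.
have d1 u : rip (delta u) u <= nr u ^+ 2.
  rewrite ripd -!nr2; have := sqr_ge0 (nr (D u)); have := sqr_ge0 (nr (S (B u))); lra.
have exd := ex_sqrt_everywhere ldelta sdelta d0 d1.
have [saQ _ hQ] := sqrt_opP exd.
have Qdom u : pdom (sqrt_op (everywhere delta)) u.
  by have [] := (hQ u (delta u)).1 (conj I erefl).
set Q := sqrt_op (everywhere delta) in saQ hQ Qdom.
have QQ u : Q (Q u) = delta u by have [] := (hQ u (delta u)).1 (conj I erefl).
have lQ : linear Q.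
  move=> a u v; have [_ hl] := selfadjoint_linear saQ.
  by have [_ ->] := hl a u v (Qdom u) (Qdom v).
have sQ : symmetric_op Q.
  by move=> u v; rewrite /rip (selfadjoint_symmetric saQ (Qdom u) (Qdom v)).
have dg x : pdom S x -> range Q (cross x) /\ nr (Defs.pinv Q (cross x)) ^+ 2 <=
    q x - q (A x) - nr (C x) ^+ 2.
  move=> Sx; apply: (douglas lQ sQ) => [|u].
    by have := key x 0 Sx; rewrite rip0r (lin0 ldelta) rip0l; lra.
  by rewrite (nr2 (Q u)) sQ QQ (ripC u); exact: key.
split.
- split=> // x Hx x0.
  have [Sx SSx <-] := (hS x (H x)).1 (conj Hx erefl).
  rewrite (selfadjoint_symmetric saS SSx Sx) inner_nr2 ltr0c lt_def sqr_ge0 andbT.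
  apply/eqP => h; have : storage_dom Sigma x by rewrite domE.
  move=> /storage_eq0; rewrite -/q -(qE _ Sx) h => /(_ erefl).
  by rewrite obs => /= xE; rewrite xE eqxx in x0.
- by split.
- split=> [||x /dg[]//].
    by apply/bounded_operatorP; split=> //; exists 1 => // u; rewrite mul1r;
      exact: contraction_nr.
  exact/everywhere_nonnegative.
- move=> x Sx; have [_ hx] := dg x Sx.
  rewrite !nrE -!rmorphXn -!rmorphB/= lecR (qE _ Sx) -/A -/C.
  by rewrite -[sqrt_op H]/S (qE _ (SA _ Sx)).
Qed.

End RiccatiSolution.

(** * Vector valued power series *)

Section PowerSeries.
Context {R : realType} {Y : completeNormedModType R[i]}.
Implicit Types (c : nat -> Y) (z w : R[i]) (M rho : R).

Definition psum c z n : Y := \sum_(k < n) z ^+ k *: c k.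

Definition psval c z : Y := xget 0 [set l | cvs (psum c z) l].

Lemma psval_cvs c z l : cvs (psum c z) l -> psval c z = l.
Proof.
move=> h; rewrite /psval; case: xgetP => [l' _ /= h'|/(_ l)//].
exact: cvs_unique h' h.
Qed.

Lemma psum_recl c z n : psum c z n.+1 = c 0%N + z *: psum (fun k => c k.+1) z n.
Proof.
rewrite /psum big_ord_recl expr0 scale1r scaler_sumr; congr (_ + _).
by apply: eq_bigr => i _; rewrite scalerA -exprS.
Qed.

Lemma psvalP c M rho z : 0 <= M -> 0 <= rho -> (forall n, nr (c n) <= M * rho ^+ n) ->
  rho * cm z < 1 ->
  cvs (psum c z) (psval c z) /\ nr (psval c z) <= M / (1 - rho * cm z).
Proof.
move=> M0 r0 hc z1; set x := rho * cm z; have x0 : 0 <= x by rewrite mulr_ge0 ?cm_ge0.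
have x1 : 0 < 1 - x by rewrite subr_gt0.
have hk n : nr (z ^+ n *: c n) <= M * x ^+ n.
  by rewrite nrZ cmX exprMn mulrA mulrC ler_wpM2r ?exprn_ge0 ?cm_ge0.
have [||l hl] := @dominated_cvs _ _ (psum c z) (fun n => - (M * x ^+ n / (1 - x))).
- move=> n; rewrite /psum big_ord_recr/= addrAC subrr add0r (le_trans (hk n))//.
  rewrite le_eqVlt; apply/orP; left; apply/eqP; rewrite exprS; field.
  by rewrite gt_eqF.
- apply: is_cvgN; apply: is_cvgM; last exact: is_cvg_cst.
  apply: is_cvgM; first exact: is_cvg_cst.
  by apply/cvg_ex; exists 0; apply: cvg_expr; rewrite ger0_norm.
rewrite (psval_cvs hl); split=> //; apply: seq_lim_le (cvs_nr hl) => n.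
suff : nr (psum c z n) <= M * (1 - x ^+ n) / (1 - x).
  move/le_trans; apply; rewrite ler_pM2r ?invr_gt0// ler_piMr//.
  by rewrite gerBl exprn_ge0.
elim: n => [|n IH]; first by rewrite /psum big_ord0 nr0 subrr mulr0 mul0r.
rewrite /psum big_ord_recr/= (le_trans (nrD _ _))// (le_trans (lerD IH (hk n)))//.
rewrite le_eqVlt; apply/orP; left; apply/eqP; rewrite exprS; field.
by rewrite gt_eqF.
Qed.

Lemma psval_recl c M rho z : 0 <= M -> 0 <= rho ->
  (forall n, nr (c n) <= M * rho ^+ n) -> rho * cm z < 1 ->
  psval c z = c 0%N + z *: psval (fun k => c k.+1) z.
Proof.
move=> M0 r0 hc z1; have hc' n : nr (c n.+1) <= (M * rho) * rho ^+ n.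
  by rewrite -mulrA -exprS.
have [h _] := psvalP M0 r0 hc z1.
have [h' _] := psvalP (mulr_ge0 M0 r0) r0 hc' z1.
apply: (cvs_unique (cvs_shift 1 h)).
under eq_fun do rewrite addn1 psum_recl.
by apply: cvsD; [exact: cvs_cst|exact: cvsZ].
Qed.

(* The coefficients at 0 of (f - f(w)) / (z - w), for f the sum of [c]. *)
Definition bshift w c : nat -> Y := fun m => psval (fun k => c (m.+1 + k)%N) w.

Section Shift.
Variables (w : R[i]) (rho : R).
Hypotheses (rho0 : 0 <= rho) (w1 : rho * cm w < 1).

Lemma tail_bound c M m : 0 <= M -> (forall n, nr (c n) <= M * rho ^+ n) ->
  nr (psval (fun k => c (m + k)%N) w) <= M * rho ^+ m / (1 - rho * cm w).
Proof.
move=> M0 hc; have hc' n : nr (c (m + n)%N) <= M * rho ^+ m * rho ^+ n.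
  by rewrite -mulrA -exprD.
by have [] := psvalP (mulr_ge0 M0 (exprn_ge0 m rho0)) rho0 hc' w1.
Qed.

Lemma bshift_bound c M m : 0 <= M -> (forall n, nr (c n) <= M * rho ^+ n) ->
  nr (bshift w c m) <= M * (rho / (1 - rho * cm w)) * rho ^+ m.
Proof.
move=> M0 hc; rewrite (le_trans (tail_bound _ M0 hc))// exprS.
by rewrite le_eqVlt; apply/orP; left; apply/eqP; ring.
Qed.

(** The tails [d m] obey the Horner recursion d m = c m + w d (m + 1), so the partial sums telescope
    up to z^N d N, which tends to 0. *)
Lemma psval_bshift c M z : 0 <= M -> (forall n, nr (c n) <= M * rho ^+ n) ->
  rho * cm z < 1 -> psval c z = psval c w + (z - w) *: psval (bshift w c) z.
Proof.
move=> M0 hc z1; pose d m := psval (fun k => c (m + k)%N) w.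
have K0 : 0 <= M * (rho / (1 - rho * cm w)).
  by rewrite mulr_ge0// divr_ge0// subr_ge0 ltW.
have [h _] := psvalP M0 rho0 hc z1.
have [h' _] := psvalP K0 rho0 (fun m => bshift_bound m M0 hc) z1.
have dE m : d m = c m + w *: d m.+1.
  have hm n : nr (c (m + n)%N) <= M * rho ^+ m * rho ^+ n by rewrite -mulrA -exprD.
  rewrite /d (psval_recl (mulr_ge0 M0 (exprn_ge0 m rho0)) rho0 hm w1) addn0.
  have -> // : (fun k => c (m + k.+1)%N) = (fun k => c (m.+1 + k)%N).
  by apply/funext => k; rewrite addnS.
have telescope N : psum c z N - d 0%N + z ^+ N *: d N = (z - w) *: psum (bshift w c) z N.
  elim: N => [|N IH]; first by rewrite /psum !big_ord0 expr0 scale1r sub0r addNr scaler0.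
  rewrite /psum !big_ord_recr/= -!/(psum _ _ _) scalerDr -IH -!addrA; congr (_ + _).
  rewrite addrCA; congr (_ + _); rewrite {1}[d N]dE -/(d N.+1).
  rewrite !scalerDr -addrA; congr (_ + _).
  rewrite !scalerA -scalerDl exprS; congr (_ *: _); ring.
have -> : psval c w = d 0%N by rewrite /d.
have hd N : nr (d N) <= M * rho ^+ N / (1 - rho * cm w) by exact: tail_bound.
clearbody d.
apply/eqP; rewrite addrC -subr_eq; apply/eqP.
have : cvs (fun N => psum c z N - d 0%N + z ^+ N *: d N) (psval c z - d 0%N + 0).
  apply: (cvsD (x := fun N => psum c z N - d 0%N) (y := fun N => z ^+ N *: d N)).
    exact: (cvsB h (cvs_cst _)).
  apply: (@cvs_le _ _ _ _ (fun N => M / (1 - rho * cm w) * (rho * cm z) ^+ N)).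
    move=> N; rewrite subr0 nrZ cmX mulrC.
    rewrite (le_trans (ler_wpM2r _ (hd N))) ?exprn_ge0 ?cm_ge0//.
    by rewrite exprMn le_eqVlt; apply/orP; left; apply/eqP; ring.
  rewrite -(mulr0 (M / (1 - rho * cm w))); apply: cvgM; first exact: cvg_cst.
  by apply: cvg_expr; rewrite ger0_norm// mulr_ge0 ?cm_ge0.
rewrite addr0 => h1; apply: (cvs_unique h1).
by under eq_fun do rewrite telescope; exact: cvsZ.
Qed.

Lemma iter_bshift_bound c M k m : 0 <= M -> (forall n, nr (c n) <= M * rho ^+ n) ->
  nr (iter k (bshift w) c m) <= M * (rho / (1 - rho * cm w)) ^+ k * rho ^+ m.
Proof.
move=> M0 hc; have K0 : 0 <= rho / (1 - rho * cm w) by rewrite divr_ge0// subr_ge0 ltW.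
elim: k m => [|k IH] m; first by rewrite mulr1.
rewrite iterS (le_trans (bshift_bound _ _ IH)) ?mulr_ge0 ?exprn_ge0//.
by rewrite exprSr !mulrA.
Qed.

(** Iterating [psval_bshift] gives the Taylor expansion at [w] with an exact remainder; by
    [iter_bshift_bound] each shift costs one factor rho / (1 - rho |w|). *)
Lemma psval_expand c M z n : 0 <= M -> (forall n, nr (c n) <= M * rho ^+ n) ->
  rho * cm z < 1 ->
  psval c z = \sum_(k < n) (z - w) ^+ k *: psval (iter k (bshift w) c) w +
    (z - w) ^+ n *: psval (iter n (bshift w) c) z.
Proof.
move=> M0 hc z1; elim: n => [|n IH]; first by rewrite big_ord0 add0r expr0 scale1r.
rewrite big_ord_recr/= IH -addrA; congr (_ + _).
have K0 : 0 <= rho / (1 - rho * cm w) by rewrite divr_ge0// subr_ge0 ltW.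
rewrite [X in _ *: X = _](psval_bshift (M := M * (rho / (1 - rho * cm w)) ^+ n))//.
- by rewrite scalerDr scalerA -exprSr.
- by rewrite mulr_ge0// exprn_ge0.
- by move=> m; exact: iter_bshift_bound.
Qed.

Lemma psval_iter_bound c M z n : 0 <= M -> (forall n, nr (c n) <= M * rho ^+ n) ->
  rho * cm z < 1 ->
  nr (psval (iter n (bshift w) c) z) <=
    M * (rho / (1 - rho * cm w)) ^+ n / (1 - rho * cm z).
Proof.
move=> M0 hc z1; have K0 : 0 <= rho / (1 - rho * cm w) by rewrite divr_ge0// subr_ge0 ltW.
by have [] := psvalP (mulr_ge0 M0 (exprn_ge0 n K0)) rho0
  (fun m => iter_bshift_bound n m M0 hc) z1.
Qed.

End Shift.
End PowerSeries.

Section Neighbourhoods.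
Context {R : realType}.

Lemma near_complexP (P : R[i] -> Prop) :
  (\forall h \near (0 : R[i]^o), P h) <->
  exists2 e : R, 0 < e & forall h, cm h < e -> P h.
Proof.
split=> [/nbhs_norm0P[/= e e0 he]|[e e0 he]].
  have ee : e = (complex.Re e)%:C by rewrite RRe_real// gtr0_real.
  exists (complex.Re e); first by rewrite -ltr0c -ee.
  by move=> h hr; apply: he; rewrite /= ee cmE ltcR.
apply/nbhs_norm0P; exists e%:C; first by rewrite /= ltr0c.
by move=> h /=; rewrite cmE ltcR; exact: he.
Qed.

End Neighbourhoods.

(* Coordinates with respect to three vectors, to reduce vector identities to
   scalar ones. *)
Lemma lincomb3 (K : pzRingType) (V : lmodType K) (x y z : V) :
  exists L : K -> K -> K -> V,
  [/\ L 1 0 0 = x, L 0 1 0 = y & L 0 0 1 = z] /\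
  [/\ forall a b c a' b' c', L a b c + L a' b' c' = L (a + a') (b + b') (c + c'),
      forall a b c, - L a b c = L (- a) (- b) (- c) &
      forall k a b c, k *: L a b c = L (k * a) (k * b) (k * c)].
Proof.
exists (fun a b c => a *: x + b *: y + c *: z); split; split.
- by rewrite !scale0r scale1r !addr0.
- by rewrite !scale0r scale1r addr0 add0r.
- by rewrite !scale0r scale1r !add0r.
- by move=> *; rewrite !scalerDl addrACA (addrACA (_ *: x)).
- by move=> *; rewrite !scaleNr !opprD.
- by move=> *; rewrite !scalerDr !scalerA.
Qed.

(** * Means over circles *)

Section LocallySmooth.
Context {R : realType} {Y : completeNormedModType R[i]}.
Implicit Types (f g : R[i] -> Y) (z w : R[i]) (K eta M rho : R).

(* A first order Taylor expansion with quadratic remainder, uniform near [w0];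
   unlike analyticity it is visibly stable under products. *)
Definition loc_smooth f w0 := exists d K eta, 0 < eta /\
  forall w h, cm (w - w0) <= eta -> cm h <= eta ->
    [/\ nr (f w) <= K, nr (d w) <= K &
        nr (f (w + h) - f w - h *: d w) <= K * cm h ^+ 2].

Lemma loc_smooth_psval c M rho w0 : 0 <= M -> 0 < rho ->
  (forall n, nr (c n) <= M * rho ^+ n) ->
  loc_smooth (fun z => psval c (z - w0)) w0.
Proof.
move=> M0 r0 hc; have r0' := ltW r0.
(* This radius keeps rho |a + h| below 1/2, so the geometric denominators cost a factor 2 and each
   shift a factor 2 rho; the constant covers orders 0, 1 and 2. *)
exists (fun z => psval (bshift (z - w0) c) (z - w0)), (2 * M * (1 + 2 * rho) ^+ 2), (4 * rho)^-1.
split=> [|w h]; first by rewrite invr_gt0 mulr_gt0.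
have q (x : R) : x <= (4 * rho)^-1 -> rho * x <= 4^-1.
  by rewrite [rho * x]mulrC -ler_pdivlMr// invfM.
set a := w - w0 => /q a4 /q h4.
have ah : rho * cm (a + h) <= 2^-1.
  have := ler_wpM2l r0' (cmD a h); rewrite mulrDr; move: a4 h4; lra.
have a1 : rho * cm a < 1 by lra.
have ah1 : rho * cm (a + h) < 1 by lra.
have -> : w + h - w0 = a + h by rewrite /a addrAC.
have Ka : rho / (1 - rho * cm a) <= 2 * rho.
  by rewrite ler_pdivrMr ?subr_gt0//; nra.
have K0 : 0 <= rho / (1 - rho * cm a) by rewrite divr_ge0// subr_ge0 ltW.
have frac (x b k : R) : 0 <= k -> k <= b -> x <= 2^-1 -> M * k / (1 - x) <= 2 * M * b.
  move=> k0 kb x2; have Mk := ler_wpM2l M0 kb.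
  have Mb : 0 <= M * b by rewrite mulr_ge0// (le_trans k0).
  by rewrite ler_pdivrMr ?subr_gt0; nra.
have r2 : 0 <= 2 * rho by rewrite mulr_ge0.
have hb n : nr (psval (iter n (bshift a) c) (a + h)) <= 2 * M * (2 * rho) ^+ n.
  rewrite (le_trans (psval_iter_bound r0' a1 n M0 hc ah1))// frac ?exprn_ge0//.
  by rewrite lerXn2r ?nnegrE.
have hb' n : nr (psval (iter n (bshift a) c) a) <= 2 * M * (2 * rho) ^+ n.
  rewrite (le_trans (psval_iter_bound r0' a1 n M0 hc a1))// frac ?exprn_ge0//.
    by rewrite lerXn2r ?nnegrE.
  by lra.
have le1 n : (n <= 2)%N -> 2 * M * (2 * rho) ^+ n <= 2 * M * (1 + 2 * rho) ^+ 2.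
  move=> n2; rewrite ler_wpM2l ?mulr_ge0//.
  apply: (@le_trans _ _ ((1 + 2 * rho) ^+ n)).
    by rewrite lerXn2r ?nnegrE ?addr_ge0 ?mulr_ge0// lerDr.
  by rewrite ler_weXn2l// lerDl mulr_ge0.
split; [exact: le_trans (hb' 0%N) (le1 0%N _)|exact: le_trans (hb' 1%N) (le1 1%N _)|].
rewrite (psval_expand r0' a1 2 M0 hc ah1) !big_ord_recl big_ord0 /=.
have -> : a + h - a = h by rewrite addrAC subrr add0r.
rewrite -[bump 0 0]/1%N.
have [L [[L0 L1 L2] [LD LN LZ]]] := lincomb3 (psval c a) (psval (bshift a c) a)
  (psval (bshift a (bshift a c)) (a + h)).
rewrite [X in nr X](_ : _ = h ^+ 2 *: psval (bshift a (bshift a c)) (a + h)); last first.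
  by rewrite addr0 -L0 -L1 -L2 !(LZ, LD, LN); congr L; ring.
rewrite nrZ cmX mulrC ler_wpM2r ?sqr_ge0//.
exact: le_trans (hb 2%N) (le1 2%N _).
Qed.

Lemma loc_smooth_eq f g w0 (e : R) : 0 < e ->
  (forall z, cm (z - w0) < e -> f z = g z) -> loc_smooth f w0 -> loc_smooth g w0.
Proof.
move=> e0 fg [d [K [eta [eta0 h]]]].
have m0 : 0 < Num.min eta (e / 4) by rewrite lt_min eta0 divr_gt0.
exists d, K, (Num.min eta (e / 4)); split=> // w k.
rewrite !le_min => /andP[w1 w2] /andP[k1 k2].
have [h1 h2 h3] := h w k w1 k1; have we : cm (w - w0) < e by lra.
have wke : cm (w + k - w0) < e.
  by rewrite addrAC (le_lt_trans (cmD _ _))//; lra.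
by rewrite -!fg.
Qed.

Lemma loc_smooth0 w0 : loc_smooth (fun=> 0) w0.
Proof.
exists (fun=> 0), 0, 1; split=> // w h _ _.
by rewrite scaler0 !subr0 nr0 mul0r.
Qed.

Lemma loc_smoothD f g w0 : loc_smooth f w0 -> loc_smooth g w0 ->
  loc_smooth (fun z => f z + g z) w0.
Proof.
move=> [d [K [eta [eta0 h]]]] [d' [K' [eta' [eta0' h']]]].
exists (fun z => d z + d' z), (K + K'), (Num.min eta eta').
split=> [|w k]; first by rewrite lt_min eta0.
rewrite !le_min => /andP[w1 w2] /andP[k1 k2].
have [h1 h2 h3] := h w k w1 k1; have [h1' h2' h3'] := h' w k w2 k2.
split; [exact: le_trans (nrD _ _) (lerD _ _)|exact: le_trans (nrD _ _) (lerD _ _)|].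
rewrite mulrDl opprD (addrACA (f (w + k))) scalerDr opprD (addrACA (f (w + k) - f w)).
exact: le_trans (nrD _ _) (lerD h3 h3').
Qed.

Lemma loc_smooth_sum n (f : 'I_n -> R[i] -> Y) w0 : (forall i, loc_smooth (f i) w0) ->
  loc_smooth (fun z => \sum_(i < n) f i z) w0.
Proof.
elim: n f => [|n IH] f hf.
  by under eq_fun do rewrite big_ord0; exact: loc_smooth0.
under eq_fun do rewrite big_ord_recl.
by apply: loc_smoothD => //; exact: IH.
Qed.

Lemma loc_smoothM f w0 : loc_smooth f w0 -> loc_smooth (fun z => z *: f z) w0.
Proof.
move=> [d [K [eta [eta0 h]]]]; set m := cm w0 + 2 * eta + 1.
have eta0' := ltW eta0.
have K0 : 0 <= K.
  by have [|| + _ _] := h w0 0; rewrite ?subrr ?cm0//; apply: le_trans; exact: nr_ge0.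
have m1 : 1 <= m by rewrite /m; have := cm_ge0 w0; lra.
exists (fun z => f z + z *: d z), (2 * m * K), eta; split=> // w k w1 k1.
have [h1 h2 h3] := h w k w1 k1.
have wm : cm w + eta <= m.
  have := cmD w0 (w - w0); rewrite addrCA subrr addr0 /m; lra.
have wm' : cm w <= m by lra.
have wkm : cm (w + k) <= m by rewrite (le_trans (cmD _ _))//; lra.
have := nr_ge0 (f w); have := nr_ge0 (d w); have := cm_ge0 w => w0' d0 f0.
split.
- by rewrite nrZ; nra.
- by rewrite (le_trans (nrD _ _))// nrZ; nra.
have [e eE] : exists e, f (w + k) = f w + k *: d w + e.
  by exists (f (w + k) - (f w + k *: d w)); rewrite [RHS]addrC subrK.
have [L [[Lf Ld Le] [LD LN LZ]]] := lincomb3 (f w) (d w) e.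
have -> : (w + k) *: f (w + k) - w *: f w - k *: (f w + w *: d w) =
  (w + k) *: e + (k ^+ 2) *: d w.
  by rewrite eE -Lf -Ld -Le !(LZ, LD, LN); congr L; ring.
have e2 : nr e <= K * cm k ^+ 2.
  suff <- : f (w + k) - f w - k *: d w = e by [].
  by rewrite eE -Lf -Ld -Le !(LZ, LD, LN); congr L; ring.
rewrite (le_trans (nrD _ _))// !nrZ cmX.
have := nr_ge0 e; have := sqr_ge0 (cm k).
have := cm_ge0 (w + k); nra.
Qed.

Lemma loc_smoothV f w0 : w0 != 0 -> loc_smooth f w0 -> loc_smooth (fun z => z^-1 *: f z) w0.
Proof.
move=> wn0 [d [K [eta [eta0 h]]]].
have c0 : 0 < cm w0 by rewrite cm_gt0.
have K0 : 0 <= K.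
  by have [|| + _ _] := h w0 0; rewrite ?subrr ?cm0 ?(ltW eta0)//; apply: le_trans; exact: nr_ge0.
pose m := 1 + 2 / cm w0.
have m1 : 1 <= m by rewrite lerDl divr_ge0 ?ltW.
(* A quarter of |w0| for each of [w - w0] and [k] leaves both [w] and [w + k] of modulus at least
   |w0| / 2, so their inverses are at most [m]. *)
have e0 : 0 < Num.min eta (cm w0 / 4) by rewrite lt_min eta0 divr_gt0.
exists (fun z => z^-1 *: d z - (z ^- 2) *: f z), (3 * m ^+ 3 * K), (Num.min eta (cm w0 / 4)).
split=> // w k; rewrite !le_min => /andP[w1 w2] /andP[k1 k2].
have [h1 h2 h3] := h w k w1 k1.
have far z : cm w0 / 2 <= cm z -> z != 0 /\ cm z^-1 <= m.
  move=> hz; have z0 : 0 < cm z by apply: lt_le_trans hz; rewrite divr_gt0.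
  split; first by rewrite -cm_gt0.
  rewrite cmV (@le_trans _ _ (2 / cm w0))// ?lerDr//.
  by rewrite -[2 / _]invf_div lef_pV2 ?posrE// divr_gt0.
have [wn wi] : w != 0 /\ cm w^-1 <= m.
  apply: far; have := cmD (w0 - w) w; rewrite subrK -(cmN (w0 - w)) opprB; lra.
have [wkn wki] : w + k != 0 /\ cm (w + k)^-1 <= m.
  apply: far; have := cmD (w0 - w - k) (k + w); rewrite addrA subrK subrK (addrC k).
  have := cmD (w0 - w) (- k); rewrite cmN -(cmN (w0 - w)) opprB; lra.
have m0 : 0 <= m by lra.
have i0 := cm_ge0 w^-1; have i0' := cm_ge0 (w + k)^-1.
have mm : m <= m ^+ 3 by rewrite -[leLHS]expr1 ler_weXn2l.
have mm2 : m ^+ 2 <= m ^+ 3 by rewrite ler_weXn2l.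
have m3 : 0 <= m ^+ 3 by rewrite exprn_ge0.
have w2' : cm (w ^- 2) <= m ^+ 2 by rewrite cmV cmX -exprVn -cmV lerXn2r ?nnegrE.
have f0 := nr_ge0 (f w); have d0 := nr_ge0 (d w).
have bnd (x b y : R) : 0 <= x -> 0 <= y -> x <= b -> b <= m ^+ 3 -> y <= K -> x * y <= m ^+ 3 * K.
  by move=> x0 y0 xb bm yK; apply: ler_pM => //; exact: le_trans bm.
have mK : 0 <= m ^+ 3 * K by rewrite mulr_ge0.
split.
- by rewrite nrZ (le_trans (bnd _ m _ _ _ _ _ _))//; lra.
- rewrite (le_trans (nrB _ _))// !nrZ.
  have := bnd _ _ _ i0 d0 wi mm h2; have := bnd _ _ _ (cm_ge0 _) f0 w2' mm2 h1; lra.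
have [e eE] : exists e, f (w + k) = f w + k *: d w + e.
  by exists (f (w + k) - (f w + k *: d w)); rewrite [RHS]addrC subrK.
have [L [[Lf Ld Le] [LD LN LZ]]] := lincomb3 (f w) (d w) e.
(* The remainder splits into three terms, each at most m^3 K |k|^2: hence the factor 3. *)
have -> : (w + k)^-1 *: f (w + k) - w^-1 *: f w - k *: (w^-1 *: d w - w ^- 2 *: f w) =
   (w + k)^-1 *: e + (k ^+ 2 *: ((w ^- 2 * (w + k)^-1) *: f w) -
      k ^+ 2 *: ((w^-1 * (w + k)^-1) *: d w)).
  by rewrite eE -Lf -Ld -Le !(LZ, LD, LN); congr L; field; rewrite wn wkn.
have e2 : nr e <= K * cm k ^+ 2.
  suff <- : f (w + k) - f w - k *: d w = e by [].
  by rewrite eE -Lf -Ld -Le !(LZ, LD, LN); congr L; ring.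
have k2' := sqr_ge0 (cm k).
have b1 : cm (w + k)^-1 * nr e <= m ^+ 3 * K * cm k ^+ 2.
  rewrite -mulrA; apply: ler_pM => //; [exact: nr_ge0|exact: le_trans mm].
have b2 : cm (w ^- 2 * (w + k)^-1) * nr (f w) <= m ^+ 3 * K.
  by rewrite ler_pM ?cm_ge0// cmM [m ^+ 3]exprSr ler_pM ?cm_ge0.
have b3 : cm (w^-1 * (w + k)^-1) * nr (d w) <= m ^+ 3 * K.
  by rewrite ler_pM ?cm_ge0// (le_trans _ mm2)// cmM expr2 ler_pM.
rewrite (le_trans (nrD _ _))// (le_trans (lerD (lexx _) (nrB _ _)))// !nrZ cmX.
have := ler_wpM2r k2' b2; have := ler_wpM2r k2' b3; lra.
Qed.

End LocallySmooth.

Section RootsOfUnity.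
Context {R : realType}.
Implicit Types (t : R) (w x : R[i]) (M k : nat).

Definition expi t : R[i] := cos t +i* sin t.

Lemma expiX t n : expi t ^+ n = expi (t * n%:R).
Proof.
elim: n => [|n IH]; first by rewrite mulr0 /expi cos0 sin0.
rewrite exprS IH -natr1 mulrDr mulr1 addrC /expi cosD sinD.
by apply/eqP; rewrite eq_complex/=; apply/andP; split; apply/eqP; ring.
Qed.

Lemma cm_expi t : cm (expi t) = 1.
Proof.
apply/eqP; rewrite -(@eqrXn2 _ 2)// ?cm_ge0//.
by rewrite cm_sqr/= cos2Dsin2 expr1n.
Qed.

Lemma sin_le t : 0 <= t -> sin t <= t.
Proof.
rewrite le_eqVlt => /orP[/eqP <-|t0]; first by rewrite sin0.
have [|c _] := @MVT R sin cos 0 t t0 (fun (x : R) _ => is_derive_sin x) _.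
  by apply: continuous_subspaceT => x; exact: continuous_sin.
rewrite sin0 !subr0 => ->; rewrite ler_piMl ?(ltW t0)//; exact: cos_le1.
Qed.

(** The chord has length 2 sin(t / 2). *)
Lemma cm_expi_sub1 t : 0 <= t -> t <= pi *+ 2 -> cm (expi t - 1) <= t.
Proof.
move=> t0 t1; rewrite -(ler_pXn2r (ltn0Sn 1)) ?nnegrE ?cm_ge0// cm_sqr/= subr0.
have tE : t = (t / 2) *+ 2 by rewrite -mulr_natr divfK.
have s0 : 0 <= sin (t / 2).
  by apply: sin_ge0_pi; rewrite divr_ge0//= ler_pdivrMr// mulr_natr.
have s1 : sin (t / 2) <= t / 2 by apply: sin_le; rewrite divr_ge0.
have ct : cos t = cos (t / 2) ^+ 2 *+ 2 - 1 by rewrite {1}tE cos_mulr2n.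
have st : sin t = cos (t / 2) * sin (t / 2) *+ 2 by rewrite {1}tE sin_mulr2n.
have := cos2Dsin2 (t / 2); rewrite ct st.
move: (cos (t / 2)) (sin (t / 2)) s0 s1 => c s s0 s1 h.
have c2 : c ^+ 2 = 1 - s ^+ 2 by rewrite -h addrK.
have -> : (c ^+ 2 *+ 2 - 1 - 1) ^+ 2 + (c * s *+ 2) ^+ 2 = 4 * s ^+ 2.
  transitivity ((2 * c ^+ 2 - 2) ^+ 2 + 4 * c ^+ 2 * s ^+ 2); first by ring.
  by rewrite c2; ring.
have : s ^+ 2 <= (t / 2) ^+ 2 by rewrite lerXn2r ?nnegrE// divr_ge0.
by rewrite exprMn; lra.
Qed.

Definition unity_pt M : R[i] := expi (pi *+ 2 / M%:R).

Lemma unity_ptX M : (0 < M)%N -> unity_pt M ^+ M = 1.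
Proof.
by move=> M0; rewrite expiX divfK ?pnatr_eq0 -?lt0n// /expi cos2pi sin2pi.
Qed.

Lemma cm_unity_pt M : cm (unity_pt M) = 1.
Proof. exact: cm_expi. Qed.

(** The arc has length 2 pi / M, and pi < 4. *)
Lemma unity_pt_dist M : (0 < M)%N -> cm (unity_pt M - 1) <= 8 / M%:R.
Proof.
move=> M0; have Mr : 0 < M%:R :> R by rewrite ltr0n.
have p0 := @pi_ge0 R.
rewrite (le_trans (cm_expi_sub1 _ _))//.
- by apply: divr_ge0; [exact: mulrn_wge0|exact: ler0n].
- rewrite ler_pdivrMr// -[leLHS]mulr1; apply: ler_wpM2l; first exact: mulrn_wge0.
  by rewrite ler1n.
- by rewrite ler_pM2r ?invr_gt0//; have := @pihalf_lt2 R; rewrite -mulr_natr; lra.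
Qed.

Lemma unity_pt_neq1 M k : (0 < k < M)%N -> unity_pt M ^+ k != 1.
Proof.
move=> /andP[k0 kM]; rewrite expiX; have M0 : (0 < M)%N by exact: ltn_trans kM.
have Mr : 0 < M%:R :> R by rewrite ltr0n.
set t := _ * _; have tE : t = (t / 2) *+ 2 by rewrite -mulr_natr divfK.
have t2 : t / 2 = pi * (k%:R / M%:R).
  by rewrite /t -mulr_natr; field; rewrite gt_eqF.
have s0 : 0 < sin (t / 2).
  apply: sin_gt0_pi; rewrite t2 mulr_gt0 ?pi_gt0 ?divr_gt0 ?ltr0n//=.
  by rewrite gtr_pMr ?pi_gt0// ltr_pdivrMr// mul1r ltr_nat.
apply/eqP => -[c1 _]; move: c1; rewrite tE cos_mulr2n -[cos _ ^+ 2]subr0.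
have := cos2Dsin2 (t / 2); have : 0 < sin (t / 2) ^+ 2 by rewrite exprn_gt0.
by rewrite subr0 -mulr_natr; lra.
Qed.

Lemma geometric_root M x : x != 1 -> x ^+ M = 1 -> \sum_(j < M) x ^+ j = 0.
Proof.
move=> x1 xM; have := subrX1 x M; rewrite xM subrr => /esym/eqP.
by rewrite mulf_eq0 subr_eq0 (negbTE x1) => /eqP.
Qed.

End RootsOfUnity.

Section AnnulusMean.
Context {R : realType} {Y : completeNormedModType R[i]}.
Variables (g : R[i] -> Y) (s r : R).
Hypotheses (s0 : 0 < s) (sr : s <= r).
Hypothesis smooth_g : forall w0, s <= cm w0 <= r -> loc_smooth g w0.

(** Compactness of the square [-r, r]^2, with a vacuous claim off the annulus. A single integer
    serves as constant and as inverse radius, so that the local claims hold for all large N. *)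
Lemma uniform_smooth : exists N : nat, forall w, s <= cm w <= r ->
  exists d : Y, forall h, cm h <= N.+1%:R^-1 ->
    nr (g (w + h) - g w - h *: d) <= N.+1%:R * cm h ^+ 2.
Proof.
pose P (N : nat) (x : R * R) := let w := x.1 +i* x.2 in s <= cm w <= r ->
  exists d : Y, forall h, cm h <= N.+1%:R^-1 ->
    nr (g (w + h) - g w - h *: d) <= N.+1%:R * cm h ^+ 2.
have cm_le (a b : R) : cm (a +i* b) <= `|a| + `|b|.
  rewrite -(ler_pXn2r (ltn0Sn 1)) ?nnegrE ?cm_ge0 ?addr_ge0// cm_sqr/=.
  by rewrite sqrrD !real_normK ?num_real// addrAC lerDl mulrn_wge0//.
have near_pt (x : R * R) (e : R) : 0 < e ->
    nbhs x [set y : R * R | cm ((y.1 +i* y.2) - (x.1 +i* x.2)) < e].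
  move=> e0; have := nbhsx_ballx x (e / 2); rewrite divr_gt0// => /(_ isT).
  apply: filterS => y [/= y1 y2].
  rewrite /ball/= in y1 y2; rewrite (le_lt_trans (cm_le _ _))//.
  by rewrite -(normrN (y.1 - _)) -(normrN (y.2 - _)) !opprB; lra.
have far (x : R * R) (e : R) : 0 < e ->
    (forall w, cm (w - (x.1 +i* x.2)) < e -> ~ (s <= cm w <= r)) ->
    \forall x' \near x & i \near \oo, P i x'.
  move=> e0 hw; exists ([set y | cm ((y.1 +i* y.2) - (x.1 +i* x.2)) < e], setT).
    by split; [exact: near_pt|exact: filterT].
  by move=> [y N] [/= hy _] w hyr; have := hw _ hy hyr.
have cover (x : R * R) : \forall x' \near x & i \near \oo, P i x'.
  set w0 := x.1 +i* x.2.
  have [ws|sw] := ltP (cm w0) s.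
    apply: (far x (s - cm w0)); first by rewrite subr_gt0.
    move=> w hw /andP[+ _]; apply/negP; rewrite -ltNge.
    by have := cmD (w - w0) w0; rewrite subrK; lra.
  have [rw|wr] := ltP r (cm w0).
    apply: (far x (cm w0 - r)); first by rewrite subr_gt0.
    move=> w hw /andP[_]; apply/negP; rewrite -ltNge.
    by have := cmD (w0 - w) w; rewrite subrK -(cmN (w0 - w)) opprB; lra.
  have [|d [K [eta [eta0 h]]]] := smooth_g (w0 := w0); first by rewrite sw.
  have [N1 hN1] := exists_nat_gt K; have [N2 hN2] := exists_inv_lt eta0.
  exists ([set y | cm ((y.1 +i* y.2) - w0) < eta], [set N | (maxn N1 N2 <= N)%N]).
    split; first exact: near_pt.
    by exists (maxn N1 N2).
  move=> [y N] [/= /ltW hy]; rewrite geq_max => /andP[n1 n2] w _.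
  exists (d w) => k hk.
  have [|_ _ hd] := h w k hy; first by rewrite (le_trans hk)// ltW// hN2.
  apply: (le_trans hd); rewrite ler_wpM2r ?sqr_ge0// ltW// (lt_le_trans hN1)//.
  by rewrite ler_nat leqW.
have cpt := compact_setX (@segment_compact R (- r) r) (@segment_compact R (- r) r).
have [N _ hN] := (compact_near_coveringP _).1 cpt nat \oo P _ (fun x _ => cover x).
exists N => -[a b] /[dup] hw /andP[_ wr].
have hc := cm_sqr (a +i* b); rewrite /= in hc.
have r0 : 0 <= r by rewrite (le_trans _ sr)// ltW.
have cr : cm (a +i* b) ^+ 2 <= r ^+ 2 by rewrite lerXn2r ?nnegrE ?cm_ge0.
apply: (hN N (leqnn N) (a, b)) hw; split; rewrite /= in_itv/= -ler_norml.
- by rewrite -(ler_pXn2r (ltn0Sn 1)) ?nnegrE// real_normK ?num_real//; have := sqr_ge0 b; lra.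
- by rewrite -(ler_pXn2r (ltn0Sn 1)) ?nnegrE// real_normK ?num_real//; have := sqr_ge0 a; lra.
Qed.

(* Summing the Taylor expansion along the circle makes the first order terms
   telescope; hence the sums over the roots of unity hardly depend on the
   radius.  This replaces Cauchy's theorem. *)
Lemma annulus_mean : exists (C : R) (M0 : nat), forall M, (M0 <= M)%N ->
  forall w, w ^+ M = 1 -> w != 1 -> cm w = 1 -> cm (w - 1) <= 8 / M%:R ->
  nr (\sum_(j < M) g (r%:C * w ^+ j) - \sum_(j < M) g (s%:C * w ^+ j)) <= C.
Proof.
have [N hN] := uniform_smooth; set K : R := N.+1%:R in hN.
have K0 : 0 < K by rewrite ltr0n.
have r0 : 0 < r := lt_le_trans s0 sr.
have /choice[d hd] w : exists d : Y, s <= cm w <= r -> forall h, cm h <= K^-1 ->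
    nr (g (w + h) - g w - h *: d) <= K * cm h ^+ 2.
  have [/hN[d hd]|nw] := boolP (s <= cm w <= r); first by exists d.
  by exists 0.
(* Neighbouring sample points are at distance at most 8 r / M, which is then within the radius 1 /
   K. *)
have [M0 hM0] := exists_nat_gt (r * 8 * K).
exists ((r - s) * (8 * K * r) + 1), M0 => M M0M w wM wn1 cw w8.
have Mr : r * 8 * K < M%:R by rewrite (lt_le_trans hM0)// ler_nat.
have M1 : 0 < M%:R :> R by rewrite (le_lt_trans _ Mr)// !mulr_ge0// ltW.
have cwj j : cm (w ^+ j) = 1 by rewrite cmX cw expr1n.
pose S (t : R) := \sum_(j < M) g (t%:C * w ^+ j).
pose D (t : R) := \sum_(j < M) w ^+ j *: d (t%:C * w ^+ j).
have cmt t j : 0 <= t -> cm (t%:C * w ^+ j) = t.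
  by move=> t0; rewrite cmM cwj mulr1 cm_real ger0_norm.
(* [h j] leads to the next sample point, so the values of [g] cancel cyclically and t (w - 1) D(t)
   is minus the sum of M quadratic remainders. Dividing by t |w - 1| leaves K t M |w - 1|, bounded
   independently of M. *)
have hD t : s <= t <= r -> nr (D t) <= 8 * K * r.
  move=> /andP[st tr]; have t0 : 0 < t := lt_le_trans s0 st.
  pose h j := t%:C * w ^+ j * (w - 1).
  have hj j : cm (h j) = t * cm (w - 1) by rewrite cmM cmt// ltW.
  have hjK j : cm (h j) <= K^-1.
    rewrite hj -[K^-1]mul1r ler_pdivlMr// -(ler_pM2r M1).
    have a1 : cm (w - 1) * M%:R <= 8 by rewrite -ler_pdivlMr.
    have a2 := ler_wpM2l (mulr_ge0 (ltW t0) (ltW K0)) a1.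
    have a3 := ler_wpM2r (ltW K0) tr.
    lra.
  pose e j := g (t%:C * w ^+ j + h j) - g (t%:C * w ^+ j) - h j *: d (t%:C * w ^+ j).
  have he j : nr (e j) <= K * (t * cm (w - 1)) ^+ 2.
    by rewrite -(hj j); apply: hd; rewrite ?cmt ?st// ltW.
  have sume : \sum_(j < M) e j = - ((t%:C * (w - 1)) *: D t).
    rewrite /e !sumrB /D scaler_sumr.
    under [X in _ - X]eq_bigr => j _ do rewrite /h mulrAC -scalerA.
    under [X in X - _ - _]eq_bigr => j _ do
      rewrite /h mulrBr mulr1 addrC subrK -mulrA -exprSr.
    have -> : \sum_(j < M) g (t%:C * w ^+ j.+1) = \sum_(j < M) g (t%:C * w ^+ j).
      case: (M) wM => [|M'] wM; first by rewrite !big_ord0.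
      by rewrite [LHS]big_ord_recr [RHS]big_ord_recl/= wM expr0 addrC.
    by rewrite subrr sub0r.
  have hw1 : 0 < cm (w - 1) by rewrite cm_gt0 subr_eq0.
  have : t * cm (w - 1) * nr (D t) <= M%:R * (K * (t * cm (w - 1)) ^+ 2).
    apply: (@le_trans _ _ (nr (\sum_(j < M) e j))); last exact: nr_sum_le.
    by rewrite sume nrN nrZ cmM cm_real ger0_norm ?(ltW t0).
  have -> : M%:R * (K * (t * cm (w - 1)) ^+ 2) =
     t * cm (w - 1) * (K * t * (M%:R * cm (w - 1))) by ring.
  rewrite ler_pM2l ?mulr_gt0// => /le_trans; apply.
  have : M%:R * cm (w - 1) <= 8 by rewrite mulrC -ler_pdivlMr.
  move=> h8; rewrite -[8 * K * r]mulrA mulrC ler_pM ?mulr_ge0 ?cm_ge0 ?(ltW K0) ?(ltW t0)//.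
  by rewrite ler_pM2l.
have hS t e : s <= t <= r -> 0 <= e -> e <= K^-1 ->
    nr (S (t + e) - S t) <= e * (8 * K * r) + M%:R * (K * e ^+ 2).
  move=> tr e0 eK; have t0 : 0 <= t by case/andP: tr => st _; rewrite (le_trans _ st)// ltW.
  pose x j := g (t%:C * w ^+ j + e%:C * w ^+ j) - g (t%:C * w ^+ j) -
    (e%:C * w ^+ j) *: d (t%:C * w ^+ j).
  have hx j : nr (x j) <= K * e ^+ 2.
    by rewrite -(cmt e j)//; apply: hd; rewrite cmt.
  have -> : S (t + e) - S t = e%:C *: D t + \sum_(j < M) x j.
    rewrite /x !sumrB /D scaler_sumr.
    under [X in _ = _ + (_ - X)]eq_bigr => j _ do rewrite -scalerA.
    rewrite [RHS]addrC subrK; congr (_ - _).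
    by apply: eq_bigr => j _; rewrite rmorphD/= mulrDl.
  rewrite (le_trans (nrD _ _))// nrZ cm_real ger0_norm// lerD ?ler_wpM2l ?hD//.
  exact: nr_sum_le.
(* The segment from [s] to [r] is cut into L pieces: the first bound keeps each within 1 / K, the
   second makes the total quadratic error at most 1. L may depend on M, the resulting constant does
   not. *)
have [L1 hL1] := exists_nat_gt ((r - s) * K).
have [L2 hL2] := exists_nat_gt (M%:R * K * (r - s) ^+ 2).
pose L := (maxn L1 L2).+1; have L0 : 0 < L%:R :> R by rewrite ltr0n.
have LL1 : (r - s) * K <= L%:R by rewrite ltW// (lt_le_trans hL1)// ler_nat leqW// leq_maxl.
have LL2 : M%:R * K * (r - s) ^+ 2 <= L%:R.
  by rewrite ltW// (lt_le_trans hL2)// ler_nat leqW// leq_maxr.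
pose e := (r - s) / L%:R; have e0 : 0 <= e by rewrite divr_ge0 ?subr_ge0// ltW.
have LE : L%:R * e = r - s by rewrite /e mulrCA divff ?gt_eqF// mulr1.
have eK : e <= K^-1 by rewrite ler_pdivrMr// mulrC ler_pdivlMr.
have hk k : (k <= L)%N -> nr (S (s + k%:R * e) - S s) <=
    k%:R * (e * (8 * K * r) + M%:R * (K * e ^+ 2)).
  elim: k => [|k IH] kL; first by rewrite !mul0r addr0 subrr nr0.
  have step (x : R) : k.+1%:R * x = x + k%:R * x by rewrite -natr1 mulrDl mul1r addrC.
  rewrite !step -(subrK (S (s + k%:R * e)) (S (s + _))) -addrA.
  rewrite (le_trans (nrD _ _))// lerD//; last by rewrite IH// ltnW.
  rewrite [e + _]addrC addrA.
  apply: hS => //; rewrite lerDl mulr_ge0//=.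
  have : k%:R * e <= L%:R * e by rewrite ler_wpM2r// ler_nat ltnW.
  by rewrite LE; lra.
have := hk L (leqnn _); rewrite LE addrCA subrr addr0 => /le_trans; apply.
rewrite mulrDr mulrA LE lerD2l.
have -> : L%:R * (M%:R * (K * e ^+ 2)) = M%:R * K * (L%:R * e) ^+ 2 / L%:R.
  by field; rewrite gt_eqF.
by rewrite LE ler_pdivrMr// mul1r.
Qed.

End AnnulusMean.

(** * Finite Fourier analysis on a circle *)

Section CircleSums.
Context {R : realType} {V : hilbertType R}.
Variables (M : nat) (r : R).
Hypotheses (M0 : (0 < M)%N) (r0 : 0 < r).

Definition circle_pt (j : nat) : R[i] := r%:C * unity_pt M ^+ j.

Lemma cm_circle_pt j : cm (circle_pt j) = r.
Proof. by rewrite cmM cmX cm_unity_pt expr1n mulr1 cm_real gtr0_norm. Qed.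

Lemma circle_pt_neq0 j : circle_pt j != 0.
Proof. by rewrite -cm_gt0 cm_circle_pt. Qed.

Lemma circle_sum k n : (k < M)%N -> (n < M)%N -> k != n ->
  \sum_(j < M) circle_pt j ^- n * circle_pt j ^+ k = 0.
Proof.
move=> kM nM kn; pose x := (unity_pt M : R[i]) ^- n * unity_pt M ^+ k.
have wn0 : (unity_pt M : R[i]) != 0.
  by rewrite -cm_gt0 cm_unity_pt.
have -> : \sum_(j < M) circle_pt j ^- n * circle_pt j ^+ k =
    \sum_(j < M) (r%:C ^- n * r%:C ^+ k) * x ^+ j.
  apply: eq_bigr => j _; rewrite /circle_pt !exprMn invfM mulrACA; congr (_ * _).
  by rewrite -!exprVn -!exprM (mulnC j n) (mulnC j k).
rewrite -mulr_sumr geometric_root ?mulr0//.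
  apply/eqP => x1; have : (unity_pt M : R[i]) ^+ k = unity_pt M ^+ n.
    by rewrite -[RHS]mulr1 -x1 /x mulrA divff ?mul1r// expf_neq0.
  move=> e; have [lt|lt|e'] := ltngtP k n; last by rewrite e' eqxx in kn.
    have := @unity_pt_neq1 R M (n - k).
    rewrite subn_gt0 lt (leq_ltn_trans (leq_subr _ _) nM) => /(_ isT)/eqP; apply.
    apply: (mulIf (expf_neq0 k wn0)); rewrite -exprD subnK ?(ltnW lt)// mul1r.
    by rewrite e.
  have := @unity_pt_neq1 R M (k - n).
  rewrite subn_gt0 lt (leq_ltn_trans (leq_subr _ _) kM) => /(_ isT)/eqP; apply.
  apply: (mulIf (expf_neq0 n wn0)); rewrite -exprD subnK ?(ltnW lt)// mul1r.
  by rewrite e.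
rewrite /x exprMn -exprVn -!exprM (mulnC n) (mulnC k) !exprM exprVn.
by rewrite unity_ptX// invr1 !expr1n mulr1.
Qed.

Lemma circle_sum_diag n : \sum_(j < M) circle_pt j ^- n * circle_pt j ^+ n = M%:R.
Proof.
under eq_bigr => j _ do rewrite mulVf ?expf_neq0 ?circle_pt_neq0//.
by rewrite sumr_const card_ord.
Qed.

Lemma rip_scaler_inv a (x y : V) : a != 0 -> rip x (a *: y) = cm a ^+ 2 * rip (a^-1 *: x) y.
Proof. by move=> a0; rewrite -ripZZ scalerA divff// scale1r. Qed.

Lemma rip_sumr n (x : V) (F : 'I_n -> V) :
  rip x (\sum_(i < n) F i) = \sum_(i < n) rip x (F i).
Proof. by apply: (big_morph (rip x) (fun u v => ripDr u v x) (rip0r x)). Qed.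

Lemma rip_suml n (x : V) (F : 'I_n -> V) :
  rip (\sum_(i < n) F i) x = \sum_(i < n) rip (F i) x.
Proof. by rewrite ripC rip_sumr; apply: eq_bigr => i _; exact: ripC. Qed.

Lemma circle_rip (f : nat -> V) y n :
  \sum_(j < M) rip (f j) (circle_pt j ^+ n *: y) =
  r ^+ n ^+ 2 * rip (\sum_(j < M) circle_pt j ^- n *: f j) y.
Proof.
rewrite rip_suml mulr_sumr; apply: eq_bigr => j _.
by rewrite rip_scaler_inv ?expf_neq0 ?circle_pt_neq0// cmX cm_circle_pt.
Qed.

(** N <= M excludes aliasing: the monomials involved are pairwise orthogonal on the sample
    points. *)
Lemma circle_parseval N (v : nat -> V) : (N <= M)%N ->
  \sum_(j < M) nr (\sum_(k < N) circle_pt j ^+ k *: v k) ^+ 2 =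
  M%:R * \sum_(k < N) r ^+ k ^+ 2 * nr (v k) ^+ 2.
Proof.
elim: N => [|N IH] NM.
  rewrite big_ord0 mulr0; apply: big1 => j _.
  by rewrite big_ord0 nr0 expr0n.
under eq_bigr => j _ do rewrite big_ord_recr/= nr2D nrZ cmX cm_circle_pt exprMn.
rewrite !big_split/= IH ?(ltnW NM)// -!mulr_sumr.
rewrite (circle_rip (fun j => \sum_(k < N) circle_pt j ^+ k *: v k)).
have -> : \sum_(j < M) circle_pt j ^- N *: \sum_(k < N) circle_pt j ^+ k *: v k = 0.
  under eq_bigr => j _ do rewrite scaler_sumr.
  rewrite exchange_big big1//= => k _.
  under eq_bigr => j _ do rewrite scalerA.
  rewrite -scaler_suml circle_sum ?scale0r ?(ltn_trans (ltn_ord k))//.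
  by rewrite ltn_eqF.
rewrite rip0l !mulr0 addr0 big_ord_recr/= mulrDr; congr (_ + _).
by rewrite sumr_const card_ord -mulr_natl; ring.
Qed.

(** Expansion of the nonnegative sum of |f - q|^2 for the polynomial [q] with coefficients [y].
    Since [y] is arbitrary, the exact output can be inserted although the Fourier sums of [f] only
    approximate it. *)
Lemma circle_bessel N (f y : nat -> V) : (N <= M)%N ->
  2 * \sum_(n < N) r ^+ n ^+ 2 * rip (\sum_(j < M) circle_pt j ^- n *: f j) (y n) <=
  \sum_(j < M) nr (f j) ^+ 2 + M%:R * \sum_(n < N) r ^+ n ^+ 2 * nr (y n) ^+ 2.
Proof.
move=> NM; pose q j := \sum_(k < N) circle_pt j ^+ k *: y k.
have : 0 <= \sum_(j < M) nr (f j - q j) ^+ 2 by apply: sumr_ge0 => j _; exact: sqr_ge0.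
under eq_bigr => j _ do rewrite nr2B.
rewrite sumrB big_split/= circle_parseval// subr_ge0; apply: le_trans.
rewrite -mulr_sumr ler_pM2l// le_eqVlt; apply/orP; left; apply/eqP.
under [RHS]eq_bigr => j _ do rewrite rip_sumr.
by rewrite exchange_big/=; apply: eq_bigr => n _; rewrite circle_rip.
Qed.

End CircleSums.

Section AnalyticSmooth.
Context {R : realType} {U Y : hilbertType R}.

Lemma cvs_bounded (V : normedModType R[i]) (x : nat -> V) l : cvs x l ->
  exists2 B : R, 0 <= B & forall n, nr (x n) <= B.
Proof.
move=> /cvsP/(_ 1 ltr01)[N hN]; exists (nr l + 1 + \sum_(k < N) nr (x k)).
  by rewrite !addr_ge0 ?nr_ge0// sumr_ge0// => k _; exact: nr_ge0.
move=> n; have [Nn|nN] := leqP N n.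
  have := nrD (x n - l) l; rewrite subrK; have := hN n Nn.
  have : 0 <= \sum_(k < N) nr (x k) by rewrite sumr_ge0// => k _; exact: nr_ge0.
  lra.
rewrite (bigD1 (Ordinal nN))//= addrCA lerDl !addr_ge0 ?nr_ge0//.
by rewrite sumr_ge0// => k _; exact: nr_ge0.
Qed.

Lemma analytic_loc_smooth (theta : R[i] -> U -> Y) z0 u :
  op_analytic_at theta z0 -> loc_smooth (fun z => theta z u) z0.
Proof.
move=> [c [_ /near_complexP[e e0 he]]].
have hc h : cm h < e -> cvs (psum (fun k => c k u) h) (theta (z0 + h) u).
  move=> /he hh; apply/cvsP => eps eps0.
  have n1 : 0 < nr u + 1 by rewrite ltr_wpDl ?nr_ge0.
  have [|N _ hN] := hh (eps / (nr u + 1))%:C; first by rewrite ltr0c divr_gt0.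
  exists N => n Nn; rewrite nrBC; have := hN n Nn u.
  rewrite !nrE -rmorphM/= lecR; move/le_lt_trans; apply.
  rewrite mulrAC ltr_pdivrMr// ltr_pM2l//; lra.
(* Convergence at this one point bounds the terms there, which gives geometric bounds on all
   coefficients. *)
pose h1 := (e / 2)%:C : R[i].
have ch1 : cm h1 = e / 2 by rewrite cm_real ger0_norm// divr_ge0// ltW.
have [|B B0 hB] := cvs_bounded (hc h1 _); first by rewrite ch1; lra.
have e20 : 0 < e / 2 by rewrite divr_gt0.
have cb k : nr (c k u) <= (2 * B) * (e / 2)^-1 ^+ k.
  rewrite exprVn ler_pdivlMr ?exprn_gt0// mulrC -ch1 -cmX -nrZ.
  have -> : h1 ^+ k *: c k u = psum (fun k => c k u) h1 k.+1 - psum (fun k => c k u) h1 k.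
    by rewrite /psum big_ord_recr/= addrAC subrr add0r.
  by rewrite (le_trans (nrB _ _))//; have := hB k; have := hB k.+1; lra.
apply: (@loc_smooth_eq _ _ (fun z => psval (fun k => c k u) (z - z0)) _ _ e) => //.
  by move=> z /hc/psval_cvs ->; rewrite addrC subrK.
by apply: (@loc_smooth_psval _ _ _ (2 * B) (e / 2)^-1) => //; [exact: mulr_ge0|rewrite invr_gt0].
Qed.

End AnalyticSmooth.

(** * Transfer functions in the Schur class *)

Section Passivity.
Context {R : realType} {X U Y : hilbertType R}.
Variable Sigma : system X U Y.
Let A := sA Sigma.
Let B := sB Sigma.
Let C := sC Sigma.
Let D := sD Sigma.
Let lA : linear A. Proof. by case: (sA_bounded Sigma). Qed.
Let lC : linear C. Proof. by case: (sC_bounded Sigma). Qed.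

Fixpoint state (x : X) (w : nat -> U) n : X :=
  if n is n'.+1 then state (A x + B (w 0%N)) (fun k => w k.+1) n' else x.

Definition output x w n : Y := C (state x w n) + D (w n).

Lemma energy_gainE N x w : energy_gain Sigma N x w =
  \sum_(n < N) (nr (output x w n) ^+ 2 - nr (w n) ^+ 2).
Proof.
elim: N x w => [|N IH] x w; first by rewrite big_ord0.
by rewrite big_ord_recl /= IH.
Qed.

Definition resolvent z (b : X) : X := xget 0 [set x | pencil Sigma z x = b].

Lemma transferE z u : transfer Sigma z u = D u + z *: C (resolvent z (B u)).
Proof. by []. Qed.

Let linP z : linear (pencil Sigma z).
Proof.
move=> a x y; rewrite /pencil -/A lA (scalerDr z) (scalerBr a) !scalerA (mulrC z a).
by rewrite opprD addrACA.
Qed.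

Section AtPoint.
Variable z : R[i].
Hypothesis dz : transfer_dom Sigma z.

Let pencil_inj x y : pencil Sigma z x = pencil Sigma z y -> x = y.
Proof. by case: dz => T [_ k1 _] h; rewrite -(k1 x) h k1. Qed.

Lemma pencil_resolvent b : pencil Sigma z (resolvent z b) = b.
Proof.
case: dz => T [_ _ k2]; rewrite /resolvent.
by case: xgetP => [x _ //|/(_ (T b))]; case; exact: k2.
Qed.

Let resolvent_unique x b : pencil Sigma z x = b -> x = resolvent z b.
Proof. by move=> h; apply: pencil_inj; rewrite pencil_resolvent. Qed.

Lemma resolvent_linear : linear (resolvent z).
Proof. by move=> a x y; apply/esym/resolvent_unique; rewrite linP !pencil_resolvent. Qed.

Lemma resolvent_comm b : A (resolvent z b) = resolvent z (A b).
Proof.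
apply: resolvent_unique; rewrite -{2}(pencil_resolvent b) /pencil -/A.
by rewrite (linB lA) (linZ lA).
Qed.

Lemma resolventE b : resolvent z b = b + z *: A (resolvent z b).
Proof. by rewrite -{2}(pencil_resolvent b) /pencil subrK. Qed.

Lemma resolvent_bound a b : (forall x, nr (A x) <= a * nr x) -> cm z * a <= 2^-1 ->
  nr (resolvent z b) <= 2 * nr b.
Proof.
move=> ha za; set x := resolvent z b.
have := nrD b (z *: A x); rewrite -resolventE -/x nrZ => h.
have := ler_wpM2l (cm_ge0 z) (ha x); have := nr_ge0 x; nra.
Qed.

End AtPoint.

Variable theta : R[i] -> U -> Y.
Hypothesis schur : schur_class theta.
Hypothesis theta_transfer : \forall z \near (0 : R[i]^o),
  transfer_dom Sigma z /\ forall u, transfer Sigma z u = theta z u.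

(** Where [theta] is the transfer function, this is the generating function of the output from the
    state [x] under the first N inputs followed by zeros. *)
Definition response N (x : X) (w : nat -> U) z : Y :=
  C (resolvent z x) + \sum_(k < N) z ^+ k *: theta z (w k).

Lemma responseS N x w z : transfer_dom Sigma z ->
  (forall u, transfer Sigma z u = theta z u) ->
  response N.+1 x w z = output x w 0 +
    z *: response N (A x + B (w 0%N)) (fun k => w k.+1) z.
Proof.
move=> dz tz; have lR := resolvent_linear dz.
rewrite /response big_ord_recl expr0 scale1r -tz transferE {1}(resolventE dz x).
rewrite (linD lC) (linZ lC) resolvent_comm// (linD lR) (linD lC) !scalerDr.
rewrite scaler_sumr /output/=.
under [in RHS]eq_bigr => i _ do rewrite scalerA -exprS.
by rewrite -!addrA; congr (_ + _); rewrite (addrCA (D (w 0%N))).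
Qed.

Lemma response_expand n N x w z : transfer_dom Sigma z ->
  (forall u, transfer Sigma z u = theta z u) -> (n <= N)%N ->
  response N x w z = \sum_(m < n) z ^+ m *: output x w m +
    z ^+ n *: response (N - n) (state x w n) (fun k => w (n + k)%N) z.
Proof.
move=> dz tz; elim: n N x w => [|n IH] N x w.
  by rewrite big_ord0 add0r expr0 scale1r subn0.
case: N => // N nN; rewrite responseS// (IH N)// [in RHS]big_ord_recl expr0 scale1r -[RHS]addrA.
congr (_ + _); rewrite scalerDr scaler_sumr scalerA -exprS subSS; congr (_ + _).
by apply: eq_bigr => i _; rewrite scalerA -exprS.
Qed.

(** The remainder is z^(n+1) times the response from the state reached, bounded near 0: the
    resolvent has norm at most 2 when |z| a <= 1/2, and [theta] is contractive. *)
Lemma response_taylor N w n : (n < N)%N -> exists K e : R, [/\ 0 <= K, 0 < e & forall z,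
  cm z < e -> nr (response N 0 w z - \sum_(m < n.+1) z ^+ m *: output 0 w m) <=
    K * cm z ^+ n.+1].
Proof.
move=> nN; have [e1 e10 he1] := (near_complexP _).1 theta_transfer.
have [/bounded_operatorP[_ [a a0 ha]] /bounded_operatorP[_ [c c0 hc]]] :=
  (sA_bounded Sigma, sC_bounded Sigma).
set x := state 0 w n.+1; set w' := fun k => w (n.+1 + k)%N.
exists (c * (2 * nr x) + \sum_(k < N - n.+1) nr (w' k)).
exists (Num.min e1 (Num.min 1 (2 * (a + 1))^-1)); split.
- by rewrite addr_ge0 ?mulr_ge0 ?nr_ge0// sumr_ge0// => k _; exact: nr_ge0.
- by rewrite !lt_min e10 ltr01 invr_gt0 mulr_gt0// ltr_wpDl.
move=> z; rewrite !lt_min => /and3P[/he1[dz tz] z1 za].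
rewrite (response_expand _ _ dz tz nN) addrAC subrr add0r nrZ cmX mulrC.
rewrite ler_wpM2r ?exprn_ge0 ?cm_ge0// (le_trans (nrD _ _))// lerD//.
  rewrite (le_trans (hc _))// ler_wpM2l// (@resolvent_bound _ dz a)//.
  have a1 : 0 < 2 * (a + 1) by rewrite mulr_gt0// ltr_wpDl.
  move: za; rewrite -[X in _ < X]mul1r ltr_pdivlMr//; have := cm_ge0 z; nra.
apply: le_trans (nr_sum _) _; apply: ler_sum => k _.
have [] := schur (z := z); first by rewrite cmE -[1]/(1%:C) ltcR.
move=> _ _ /(_ (w' k)); rewrite !nrE lecR => h; rewrite nrZ cmX.
rewrite (le_trans _ h)// ler_piMl ?nr_ge0// exprn_ile1 ?cm_ge0// ltW//.
Qed.

Let f N (w : nat -> U) (z : R[i]) : Y := \sum_(k < N) z ^+ k *: theta z (w k).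

Let f_response N w z : transfer_dom Sigma z -> f N w z = response N 0 w z.
Proof.
by move=> dz; rewrite /response (lin0 (resolvent_linear dz)) (lin0 lC) add0r.
Qed.

Let smooth_f N w z0 : cm z0 < 1 -> loc_smooth (f N w) z0.
Proof.
move=> z01; apply: loc_smooth_sum => k.
have [|_ an _] := schur (z := z0); first by rewrite cmE -[1]/(1%:C) ltcR.
suff h j u : loc_smooth (fun z => z ^+ j *: theta z u) z0 by exact: h.
elim: j => [|j IH].
  by under eq_fun do rewrite expr0 scale1r; exact: analytic_loc_smooth.
by under eq_fun do rewrite exprS -scalerA; exact: loc_smoothM.
Qed.

(** On a small circle the Taylor expansion identifies the coefficient; [annulus_mean] carries it to
    radius [r] with an error bounded in M, hence o(M). *)
Lemma fourier_coef N w n (r e : R) : (n < N)%N -> 0 < r -> r < 1 -> 0 < e ->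
  exists M0, forall M, (M0 <= M)%N ->
    nr (\sum_(j < M) circle_pt M r j ^- n *: f N w (circle_pt M r j) -
        M%:R *: output 0 w n) <= e * M%:R.
Proof.
move=> nN r0 r1 e0; have [K [e1 [K0 e10 hK]]] := response_taylor w nN.
have [e2 e20 he2] := (near_complexP _).1 theta_transfer.
(* The four bounds place the circle inside radius [r], the Taylor disc and the disc of agreement,
   and make [K * s] at most e / 2. *)
pose s := Num.min (r / 2) (Num.min (e1 / 2) (Num.min (e2 / 2) (e / (2 * (K + 1))))).
have K1 : 0 < 2 * (K + 1) by rewrite mulr_gt0// ltr_wpDl.
have s0 : 0 < s by rewrite !lt_min !divr_gt0.
have [sr se1 se2 sK] : [/\ s <= r / 2, s <= e1 / 2, s <= e2 / 2 & s <= e / (2 * (K + 1))].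
  by split; rewrite !ge_min lexx ?orbT.
pose g z := z ^- n *: f N w z.
have smooth_g w0 : s <= cm w0 <= r -> loc_smooth g w0.
  move=> /andP[sw wr]; have wn : w0 != 0 by rewrite -cm_gt0 (lt_le_trans s0).
  rewrite /g; elim: (n) => [|k IH].
    under eq_fun do rewrite expr0 invr1 scale1r.
    by apply: smooth_f; exact: le_lt_trans r1.
  under eq_fun do rewrite exprS invfM -scalerA.
  exact: loc_smoothV.
have [|C1 [M0 hC]] := @annulus_mean _ _ g s r s0 _ smooth_g; first by lra.
have [M1 hM1] := exists_nat_gt (2 * C1 / e).
exists (maxn (maxn M0 M1) n.+2) => M; rewrite !geq_max -andbA => /and3P[m0 m1 nM2].
have nM : (n < M)%N by exact: ltnW.
have M2 : (1 < M)%N by exact: leq_ltn_trans nM2.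
have Mp : (0 < M)%N := leq_ltn_trans (leq0n _) nM.
have MR : 0 < M%:R :> R by rewrite ltr0n.
have CM : 2 * C1 <= e * M%:R.
  by rewrite [e * _]mulrC -ler_pdivrMr// ltW// (lt_le_trans hM1)// ler_nat.
have w1 : (unity_pt M : R[i]) != 1.
  by have := @unity_pt_neq1 R M 1; rewrite M2 expr1; exact.
have hM := hC M m0 (unity_pt M) (unity_ptX Mp) w1 (cm_unity_pt M) (unity_pt_dist Mp).
have hs : nr (\sum_(j < M) g (circle_pt M s j) - M%:R *: output 0 w n) <= M%:R * (K * s).
  have -> : \sum_(j < M) g (circle_pt M s j) - M%:R *: output 0 w n =
    \sum_(j < M) circle_pt M s j ^- n *: (f N w (circle_pt M s j) -
        \sum_(m < n.+1) circle_pt M s j ^+ m *: output 0 w m).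
    under [RHS]eq_bigr => j _ do rewrite scalerBr.
    rewrite sumrB; congr (_ - _).
    under [RHS]eq_bigr => j _ do rewrite scaler_sumr.
    rewrite exchange_big/= big_ord_recr/= big1 ?add0r.
      under eq_bigr => j _ do rewrite scalerA.
      by rewrite -scaler_suml circle_sum_diag.
    move=> m _; under eq_bigr => j _ do rewrite scalerA.
    rewrite -scaler_suml circle_sum ?scale0r//.
      by rewrite (ltn_trans (ltn_ord m)).
    by rewrite ltn_eqF.
  apply: nr_sum_le => j; have cs := cm_circle_pt M s0 j.
  have [|dz _] := he2 (circle_pt M s j); first by rewrite cs; lra.
  rewrite nrZ cmV cmX cs f_response// ler_pdivrMl ?exprn_gt0//.
  have := hK (circle_pt M s j); rewrite cs => /(_ _)/le_trans; apply; first by lra.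
  by rewrite exprS le_eqVlt; apply/orP; left; apply/eqP; ring.
have sKe : K * s <= e / 2.
  move: sK; rewrite ler_pdivlMr//; nra.
rewrite -(subrK (\sum_(j < M) g (circle_pt M s j)) (\sum_(j < M) _)) -addrA.
rewrite (le_trans (nrD _ _))// (le_trans (lerD hM hs))//; nra.
Qed.

(** With the output as [y] in [circle_bessel], twice the weighted output energy is at most itself
    plus the input energy, up to the error of the Fourier sums; M cancels. *)
Lemma weighted_passive N w (r : R) : 0 < r -> r < 1 ->
  \sum_(n < N) r ^+ n ^+ 2 * nr (output 0 w n) ^+ 2 <= \sum_(n < N) nr (w n) ^+ 2.
Proof.
move=> r0 r1; set Y2 := \sum_(n < N) _; set W := \sum_(n < N) _.
pose y n := output 0 w n; pose T := \sum_(n < N) nr (y n).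
have T0 : 0 <= T by rewrite sumr_ge0// => n _; exact: nr_ge0.
apply/ler_addgt0Pr => e e0; pose e' := e / (2 * (T + 1)).
have T1 : 0 < 2 * (T + 1) by rewrite mulr_gt0// ltr_wpDl.
have e'0 : 0 < e' by rewrite divr_gt0.
have /choice[M0 hM0] (n : 'I_N) : exists M0, forall M, (M0 <= M)%N ->
    nr (\sum_(j < M) circle_pt M r j ^- n *: f N w (circle_pt M r j) -
        M%:R *: y n) <= e' * M%:R.
  exact: fourier_coef.
pose M := maxn (\max_(n < N) M0 n) N.+1.
have NM : (N <= M)%N by rewrite leq_max leqnSn orbT.
have Mp : (0 < M)%N by rewrite leq_max orbT.
have MR : 0 < M%:R :> R by rewrite ltr0n.
have hM (n : 'I_N) : (M0 n <= M)%N by rewrite leq_max leq_bigmax.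
pose a n := \sum_(j < M) circle_pt M r j ^- n *: f N w (circle_pt M r j).
have ha (n : 'I_N) : M%:R * nr (y n) ^+ 2 - e' * M%:R * nr (y n) <= rip (a n) (y n).
  have -> : rip (a n) (y n) = rip (M%:R *: y n) (y n) + rip (a n - M%:R *: y n) (y n).
    by rewrite -ripDl addrC subrK.
  have -> : (M%:R : R[i]) = (M%:R : R)%:C by rewrite rmorph_nat.
  rewrite ripZl -nr2 lerD2l lerNl -ripNl (le_trans (rip_le _ _))// nrN.
  rewrite ler_wpM2r ?nr_ge0//; have := hM0 n M (hM n).
  by rewrite -/(a n) (_ : (M%:R : R[i]) = (M%:R : R)%:C)// rmorph_nat.
have fle : \sum_(j < M) nr (f N w (circle_pt M r j)) ^+ 2 <= M%:R * W.
  apply: (@le_trans _ _ (\sum_(j < M) nr (\sum_(k < N) circle_pt M r j ^+ k *: w k) ^+ 2)).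
    apply: ler_sum => j _; rewrite lerXn2r ?nnegrE ?nr_ge0//.
    have [|[lt _] _ ct] := schur (z := circle_pt M r j).
      by rewrite cmE cm_circle_pt// -[1]/(1%:C) ltcR.
    have -> : f N w (circle_pt M r j) =
        theta (circle_pt M r j) (\sum_(k < N) circle_pt M r j ^+ k *: w k).
      by rewrite (lin_sum lt); apply: eq_bigr => k _; rewrite (linZ lt).
    by have := ct (\sum_(k < N) circle_pt M r j ^+ k *: w k); rewrite !nrE lecR.
  rewrite circle_parseval// ler_pM2l//; apply: ler_sum => k _.
  rewrite ler_piMl ?sqr_ge0// -exprM exprn_ile1 ?ltW//.
have := circle_bessel Mp r0 (fun j => f N w (circle_pt M r j)) y NM.
rewrite -/Y2 => hb.
have : 2 * \sum_(n < N) r ^+ n ^+ 2 * (M%:R * nr (y n) ^+ 2 - e' * M%:R * nr (y n)) <=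
    M%:R * W + M%:R * Y2.
  apply: le_trans (le_trans hb _); last by rewrite lerD2r.
  rewrite ler_pM2l//; apply: ler_sum => n _.
  by apply: ler_wpM2l; [exact: sqr_ge0|exact: ha].
have -> : \sum_(n < N) r ^+ n ^+ 2 * (M%:R * nr (y n) ^+ 2 - e' * M%:R * nr (y n)) =
    M%:R * (Y2 - e' * \sum_(n < N) r ^+ n ^+ 2 * nr (y n)).
  rewrite mulrBr /Y2 !mulr_sumr -sumrB; apply: eq_bigr => n _; rewrite -/(y n); ring.
have : \sum_(n < N) r ^+ n ^+ 2 * nr (y n) <= T.
  apply: ler_sum => n _; rewrite ler_piMl ?nr_ge0// -exprM exprn_ile1 ?ltW//.
move: (\sum_(n < N) r ^+ n ^+ 2 * nr (y n)) => T' T'T.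
rewrite -mulrDr mulrCA ler_pM2l// => h1.
have h2 : e' * T' <= e' * T by rewrite ler_pM2l.
have h3 : e' * (2 * (T + 1)) = e by rewrite /e' divfK// gt_eqF.
nra.
Qed.

Lemma schur_passive N w : energy_gain Sigma N 0 w <= 0.
Proof.
rewrite energy_gainE sumrB subr_le0.
have bernoulli (d : R) n : 0 <= d -> d <= 1 -> 1 - n%:R * d <= (1 - d) ^+ n.
  move=> d0 d1; elim: n => [|n IH]; first by rewrite mul0r subr0.
  rewrite exprS; have := ler_wpM2l (_ : 0 <= 1 - d) IH.
  have : 0 <= n%:R * d ^+ 2 by rewrite mulr_ge0 ?sqr_ge0.
  by rewrite -natr1 subr_ge0 => h /(_ d1); lra.
set S := \sum_(n < N) nr (output 0 w n) ^+ 2; set W := \sum_(n < N) _.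
have S0 : 0 <= S by rewrite sumr_ge0// => n _; exact: sqr_ge0.
(* The radius 1 - 1/(k+2) is positive even at k = 0, and Bernoulli bounds the weights r^(2n)
   below. *)
have h k : (1 - (2 * N)%:R * k.+2%:R^-1) * S <= W.
  have d0 : 0 < k.+2%:R^-1 :> R by rewrite invr_gt0.
  have d1 : k.+2%:R^-1 < 1 :> R by rewrite invf_lt1// ltr1n.
  apply: le_trans (weighted_passive N w (r := 1 - k.+2%:R^-1) _ _); last 2 first.
    by rewrite subr_gt0.
    by rewrite gtrBl.
  rewrite mulr_sumr; apply: ler_sum => n _; apply: ler_wpM2r; first exact: sqr_ge0.
  rewrite -exprM (le_trans _ (bernoulli _ (n * 2)%N (ltW d0) (ltW d1)))//.
  rewrite lerD2l lerN2 ler_wpM2r ?(ltW d0)// ler_nat mulnC leq_mul2l/=.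
  exact: ltnW.
have hk k : (1 - (2 * N)%:R * k.+1%:R^-1) * S <= W + k.+1%:R^-1 * ((2 * N)%:R * S).
  have := h k; have : 0 <= (k.+2%:R^-1 : R) * ((2 * N)%:R * S) by rewrite !mulr_ge0 ?invr_ge0.
  have : (k.+2%:R^-1 : R) <= k.+1%:R^-1 by rewrite lef_pV2 ?posrE// ler_nat.
  have : 0 <= (2 * N)%:R * S by rewrite mulr_ge0.
  move: (k.+2%:R^-1 : R) (k.+1%:R^-1 : R) ((2 * N)%:R : R) => p p' L; nra.
rewrite -subr_ge0; apply: (@seq_lim_ge _ (fun k => W + k.+1%:R^-1 * ((2 * N)%:R * S)
  - (1 - (2 * N)%:R * k.+1%:R^-1) * S)); first by move=> k; rewrite subr_ge0.
rewrite -[X in X - _]addr0 -[X in _ - X](mul1r S) -[X in _ - X * _](subr0 1).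
have hh : (fun k => k.+1%:R^-1 : R) @ \oo --> (0 : R) by exact: cvg_harmonic.
apply: cvgB.
  apply: cvgD; first exact: cvg_cst.
  by rewrite -(mul0r ((2 * N)%:R * S)); apply: cvgM => //; exact: cvg_cst.
apply: cvgM; last exact: cvg_cst.
apply: cvgB; first exact: cvg_cst.
by rewrite -(mulr0 (2 * N)%:R); apply: cvgM => //; exact: cvg_cst.
Qed.

End Passivity.

(** * The dissipation inequality of a solution *)

Section ClosedGraph.
Context {R : realType} {U X : hilbertType R}.
Variables (S : partial_op X X) (B : U -> X).
Hypotheses (saS : selfadjoint S) (bB : bounded_operator B).
Hypothesis domB : forall u, pdom S (B u).

Let T u := S (B u).
Let lS := selfadjoint_linear saS.
Let lB : linear B. Proof. by case: bB. Qed.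

Lemma selfadjoint_comp_linear : linear T.
Proof. by move=> a u v; rewrite /T lB; have [_ ->] := lS.2 a _ _ (domB u) (domB v). Qed.

(** Sublevel sets of |T| are closed because [B] is continuous and the form of [S] is closed; this
    stands in for continuity of [T]. *)
Let closed_level (v : nat -> U) u (M : R) : cvs v u -> (forall n, nr (T (v n)) <= M) ->
  nr (T u) <= M.
Proof.
move=> vu hM; have M0 : 0 <= M := le_trans (nr_ge0 _) (hM 0%N).
have [_ [b _ hb]] := (bounded_operatorP _).1 bB.
have Bvu := cvs_lin lB hb vu.
have [||_ h] := form_lsc (selfadjoint_closed_form saS) (u := B \o v) (M := M ^+ 2) _ _ Bvu.
- by move=> n; exact: domB.
- by move=> n /=; rewrite lerXn2r ?nnegrE ?nr_ge0//; exact: hM.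
by rewrite -(ler_pXn2r (ltn0Sn 1)) ?nnegrE ?nr_ge0.
Qed.

(* A gliding hump: if T is unbounded there are nested balls of radii tending to
   0, on the n-th of which |T| > n. *)
Lemma selfadjoint_comp_bounded : bounded_operator T.
Proof.
have lT := selfadjoint_comp_linear.
apply/bounded_operatorP; split=> //; apply: contrapT => unb.
have large (e L : R) : 0 < e -> 0 <= L -> exists2 v, nr v <= e & L < nr (T v).
  move=> e0 L0; apply: contrapT => h; apply: unb; exists (L / e).
    by rewrite divr_ge0// ltW.
  move=> v; have [->|v0] := eqVneq v 0; first by rewrite (lin0 lT) !nr0 mulr0.
  have nv : 0 < nr v by rewrite nr_gt0.
  have env : 0 <= e / nr v by rewrite divr_ge0 ?ltW.
  rewrite leNgt; apply/negP => hv; apply: h; exists ((e / nr v)%:C *: v).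
    by rewrite nrZ cm_real (ger0_norm env) divfK// gt_eqF.
  rewrite (linZ lT) nrZ cm_real (ger0_norm env).
  move: hv; rewrite mulrAC ltr_pdivrMr// mulrAC ltr_pdivlMr//.
  by rewrite (mulrC (nr (T v))).
have step (q : nat * (U * R)) : exists p' : U * R, 0 < q.2.2 ->
    [/\ 0 < p'.2, p'.2 <= q.2.2 / 2 & forall v, nr (v - p'.1) <= p'.2 ->
        nr (v - q.2.1) <= q.2.2 /\ q.1%:R < nr (T v)].
  case: q => n [u e] /=; have [e0|] := ltP 0 e; last by exists (u, 1).
  have e2 : 0 < e / 2 by rewrite divr_gt0.
  have [v ve hv] := large _ n%:R e2 (ler0n _ n).
  (* T(u + v) and T(u - v) differ by 2 T v, so one of them has norm above n. *)
  have [u' u'e hu'] : exists2 u', nr (u' - u) <= e / 2 & n%:R < nr (T u').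
    have [h1|h1] := ltP n%:R (nr (T (u + v))).
      by exists (u + v) => //; rewrite addrAC subrr add0r.
    exists (u - v); first by rewrite addrAC subrr add0r nrN.
    have := nrB (T (u + v)) (T (u - v)); rewrite -(linB lT) opprB addrC addrA subrK.
    have -> : T (v + v) = (2 : R)%:C *: T v by rewrite (linD lT) rmorph_nat scaler_nat mulr2n.
    by rewrite nrZ cm_real ger0_norm//; lra.
  have [d d0 hd] : exists2 d, 0 < d & forall w, nr (w - u') <= d -> n%:R < nr (T w).
    apply: contrapT => h.
    have /choice[w hw] k : exists w, nr (w - u') <= k.+1%:R^-1 /\ nr (T w) <= n%:R.
      apply: contrapT => hk; apply: h; exists k.+1%:R^-1; first by rewrite invr_gt0.
      by move=> w hw; rewrite ltNge; apply/negP => hw'; apply: hk; exists w.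
    have : nr (T u') <= n%:R.
      apply: (@closed_level w); last by move=> k; have [] := hw k.
      apply: (@cvs_le _ _ _ _ (fun k => k.+1%:R^-1)); last exact: cvg_harmonic.
      by move=> k; have [] := hw k.
    by rewrite leNgt hu'.
  exists (u', Num.min d (e / 2)) => _ /=; split.
  - by rewrite lt_min d0.
  - by rewrite ge_min lexx orbT.
  move=> w; rewrite le_min => /andP[wd we]; split; last exact: hd.
  by rewrite -(subrK u' w) -addrA (le_trans (nrD _ _))//; lra.
have [F hF] := choice step.
pose p := fix p n : U * R := if n is n'.+1 then F (n', p n') else (0, 1).
have p0 n : 0 < (p n).2.
  by elim: n => [|n IH] //=; have [] := hF (n, p n) IH.
have nested k n v : nr (v - (p (n + k)%N).1) <= (p (n + k)%N).2 ->
    nr (v - (p n).1) <= (p n).2.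
  elim: k => [|k IH]; first by rewrite addn0.
  by rewrite addnS /= => h; apply: IH; have [_ _ /(_ v h)[]] := hF ((n + k)%N, p (n + k)%N) (p0 _).
have pm n m : (n <= m)%N -> nr ((p m).1 - (p n).1) <= (p n).2.
  move=> nm; apply: (@nested (m - n)%N); rewrite subnKC//.
  by rewrite subrr nr0 ltW.
have small n : (p n).2 <= 2^-1 ^+ n.
  elim: n => [|n IH]; first by rewrite expr0.
  by rewrite exprS /=; have [_ h _] := hF (n, p n) (p0 n); move: h => /=; lra.
have [l hl] : exists l, cvs (fun n => (p n).1) l.
  apply: cauchy_cvs => e e0.
  have : (fun n => 2^-1 ^+ n : R) @ \oo --> (0 : R).
    by apply: cvg_expr; rewrite ger0_norm ?invr_ge0// invf_lt1//; lra.
  have e2 : 0 < e / 2 by rewrite divr_gt0.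
  move=> /cvgrPdist_lt/(_ _ e2)[N _ hN]; exists N => m n Nm Nn.
  have := nrD ((p m).1 - (p N).1) ((p N).1 - (p n).1).
  rewrite addrA subrK (nrBC (p N).1 (p n).1).
  have := pm N m Nm; have := pm N n Nn; have := small N; have := hN N (leqnn N).
  rewrite /= sub0r normrN ger0_norm ?exprn_ge0 ?invr_ge0//; lra.
have inball n : nr (l - (p n).1) <= (p n).2.
  apply: (seq_lim_le _ (cvs_nr (cvsB (cvs_shift n hl) (cvs_cst (p n).1)))) => k.
  by apply: pm; rewrite leq_addl.
have [N hN] := exists_nat_gt (nr (T l)).
have [_ _ /(_ l (inball N.+1))[_]] := hF (N, p N) (p0 N).
by rewrite ltNge ltW.
Qed.

End ClosedGraph.

Section RiccatiDissipation.
Context {R : realType} {X U Y : hilbertType R}.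
Variable Sigma : system X U Y.
Let A := sA Sigma.
Let B := sB Sigma.
Let C := sC Sigma.
Let D := sD Sigma.

(* [sqrt_op H] falls back to [H] when [H] has no square root; both are selfadjoint. *)
Lemma selfadjoint_sqrt_op (V : hilbertType R) (H : partial_op V V) :
  selfadjoint H -> selfadjoint (sqrt_op H).
Proof. by move=> saH; rewrite /sqrt_op; case: xgetP => [S _ []|_]. Qed.

Lemma RI_dissipative H : RI Sigma H -> exists S : partial_op X X,
  [/\ linear_partial_op S,
      (forall x, pdom S x -> pdom S (A x)), (forall u, pdom S (B u)) &
      forall x u, pdom S x -> nr (S (A x + B u)) ^+ 2 + nr (C x + D u) ^+ 2 <=
        nr (S x) ^+ 2 + nr u ^+ 2].
Proof.
move=> [[saH _] [SA SB] [bdelta ndelta rdelta] hric].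
have saS := selfadjoint_sqrt_op saH; exists (sqrt_op H).
set S := sqrt_op H in saS SA SB hric rdelta *.
have lS := selfadjoint_linear saS; split=> //.
have bSB := selfadjoint_comp_bounded saS (sB_bounded Sigma) SB.
have bD := sD_bounded Sigma.
set delta := riccati_delta Sigma H in bdelta ndelta rdelta hric.
have ripd u v : rip (delta u) v = rip u v - rip (D u) (D v) - rip (S (B u)) (S (B v)).
  by rewrite /delta /riccati_delta !ripBl !ripl_adj.
have ripc x u : rip (riccati_cross Sigma H x) u = rip (C x) (D u) + rip (S (A x)) (S (B u)).
  by rewrite /riccati_cross ripDl !ripl_adj.
have ldelta : linear delta by case: bdelta.
have sdelta : symmetric_op delta.
  by move=> u v; rewrite ripd [RHS]ripC ripd (ripC v u) (ripC (D v)) (ripC (S (B v))).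
have d0 u : 0 <= rip (delta u) u by have /everywhere_nonnegative := ndelta; exact.
have d1 u : rip (delta u) u <= nr u ^+ 2.
  rewrite ripd -!nr2; have := sqr_ge0 (nr (D u)); have := sqr_ge0 (nr (S (B u))); lra.
(* Should [sqrt_op] return its default [delta], the bound |Q u|^2 <= <delta u, u> still holds by
   [contraction_sqr]; nothing else about the square root is used. *)
have [lQ sQ Qle] : [/\ linear (sqrt_op (everywhere delta)),
    symmetric_op (sqrt_op (everywhere delta)) &
    forall u, nr (sqrt_op (everywhere delta) u) ^+ 2 <= rip (delta u) u].
  rewrite /sqrt_op; case: xgetP => [Q _ [saQ _ hQ]|_]; last first.
    by split=> //; exact: contraction_sqr.
  have Qdom u : pdom Q u by have [] := (hQ u (delta u)).1 (conj I erefl).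
  have QQ u : Q (Q u) = delta u by have [] := (hQ u (delta u)).1 (conj I erefl).
  have sQ : symmetric_op Q.
    by move=> u v; rewrite /rip (selfadjoint_symmetric saQ (Qdom u) (Qdom v)).
  split=> // [a u v|u]; last by rewrite nr2 sQ QQ ripC.
  by have [_ hl] := selfadjoint_linear saQ; have [_ ->] := hl a u v (Qdom u) (Qdom v).
move=> x u Sx; have [w _ wE] := rdelta x Sx.
set Q := sqrt_op (everywhere delta) in lQ sQ Qle wE *.
have hp : nr (Defs.pinv Q (riccati_cross Sigma H x)) ^+ 2 <=
    nr (S x) ^+ 2 - nr (S (A x)) ^+ 2 - nr (C x) ^+ 2.
  have := hric x Sx; move: (Defs.pinv Q _) => p.
  by rewrite -lecR !rmorphB !rmorphXn/= -!nrE.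
have [_ QpE] := pinv_range lQ sQ w; rewrite wE in QpE.
set p := Defs.pinv Q _ in QpE hp.
have [_ ->] := pdomD lS (SA _ Sx) (SB u); rewrite !nr2D.
have := ripc x u; rewrite -QpE sQ => e1.
have := rip_le p (Q u); have := Qle u; rewrite ripd -!nr2 => h1 h2.
(* The cross term is split into |p|^2, controlled by the Riccati inequality, and |Q u|^2, controlled
   by [delta]. *)
have := sqr_ge0 (nr p - nr (Q u)) => h3.
have h4 : 2 * rip p (Q u) <= nr p ^+ 2 + nr (Q u) ^+ 2 by nra.
rewrite -/A -/B -/D in e1 *; lra.
Qed.

End RiccatiDissipation.

(** * The transfer function of a dissipative system *)

Section OperatorSeries.
Context {R : realType} {U Y : hilbertType R}.
Implicit Types (c : nat -> U -> Y) (z : R[i]) (M rho : R).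

Lemma psval_linear c M rho z : 0 <= M -> 0 <= rho -> (forall k, linear (c k)) ->
  (forall k u, nr (c k u) <= M * nr u * rho ^+ k) -> rho * cm z < 1 ->
  linear (fun u => psval (c^~ u) z).
Proof.
move=> M0 r0 lc hc z1 a u v.
have h w : cvs (psum (c^~ w) z) (psval (c^~ w) z).
  by have [] := psvalP (mulr_ge0 M0 (nr_ge0 w)) r0 (hc^~ w) z1.
apply: (cvs_unique (h _)).
have -> : psum (c^~ (a *: u + v)) z = fun n => a *: psum (c^~ u) z n + psum (c^~ v) z n;
  last by apply: cvsD (h v); exact: cvsZ.
apply/funext => n; rewrite /psum scaler_sumr -big_split/=; apply: eq_bigr => k _.
by rewrite lc scalerDr !scalerA mulrC.
Qed.

Section Family.
Variables (c : nat -> U -> Y) (M rho : R) (z : R[i]).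
Hypotheses (M0 : 0 <= M) (rho0 : 0 <= rho) (z1 : rho * cm z < 1).
Hypothesis lc : forall k, linear (c k).
Hypothesis hc : forall k u, nr (c k u) <= M * nr u * rho ^+ k.

Let q := rho / (1 - rho * cm z).
Let q0 : 0 <= q. Proof. by rewrite divr_ge0// subr_ge0 ltW. Qed.
Let Mu0 (u : U) : 0 <= M * nr u. Proof. by rewrite mulr_ge0// nr_ge0. Qed.

Lemma psval_bounded : bounded_operator (fun u => psval (c^~ u) z).
Proof.
apply/bounded_operatorP; split; first exact: psval_linear lc hc z1.
exists (M / (1 - rho * cm z)); first by rewrite divr_ge0// subr_ge0 ltW.
by move=> u; rewrite mulrAC; have [] := psvalP (Mu0 u) rho0 (hc^~ u) z1.
Qed.

Let iter_bound k m u :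
  nr (iter k (bshift z) (c^~ u) m) <= M * q ^+ k * nr u * rho ^+ m.
Proof. by rewrite [_ * nr u]mulrAC; exact: (iter_bshift_bound rho0 z1 k m (Mu0 u) (hc^~ u)). Qed.

Let iter_linear k m : linear (fun u => iter k (bshift z) (c^~ u) m).
Proof.
elim: k m => [|k IH] m; first exact: lc.
have Mk : 0 <= M * q ^+ k * rho ^+ m.+1 by rewrite !mulr_ge0// exprn_ge0.
apply: (psval_linear (c := fun j u => iter k (bshift z) (c^~ u) (m.+1 + j)%N) Mk rho0) => //.
move=> j u; apply: le_trans (iter_bound _ _ _) _; rewrite exprD.
by rewrite le_eqVlt; apply/orP; left; apply/eqP; ring.
Qed.

Lemma psval_analytic : op_analytic_at (fun z u => psval (c^~ u) z) z.
Proof.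
exists (fun k u => psval (iter k (bshift z) (c^~ u)) z); split=> [k|].
  apply/bounded_operatorP; split.
    exact: (psval_linear (c := fun j u => iter k (bshift z) (c^~ u) j)
      (mulr_ge0 M0 (exprn_ge0 k q0)) rho0 (iter_linear k) (fun j u => iter_bound k j u) z1).
  exists (M * q ^+ k / (1 - rho * cm z)).
    by rewrite !mulr_ge0 ?exprn_ge0// invr_ge0 subr_ge0 ltW.
  move=> u; apply: le_trans (psval_iter_bound rho0 z1 k (Mu0 u) (hc^~ u) z1) _.
  by rewrite -/q le_eqVlt; apply/orP; left; apply/eqP; ring.
have s0 : 0 < 1 - rho * cm z by rewrite subr_gt0.
have r1 : 0 < 2 * (rho + 1) by rewrite mulr_gt0// ltr_wpDl.
(* Within this radius [q * cm h] is at most 1/2 and 1 - rho |z + h| at least half of 1 - rho |z|, so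
   the remainders decay like 2^-n. *)
apply/near_complexP; exists ((1 - rho * cm z) / (2 * (rho + 1))); first by rewrite divr_gt0.
move=> h; rewrite ltr_pdivlMr// => hh.
have h2 : rho * cm h <= (1 - rho * cm z) / 2 by have := cm_ge0 h; nra.
have zh : rho * cm (z + h) <= (1 + rho * cm z) / 2.
  by have := ler_wpM2l rho0 (cmD z h); rewrite mulrDr; lra.
have zh1 : rho * cm (z + h) < 1 by lra.
have qh : q * cm h <= 2^-1 by rewrite /q mulrAC ler_pdivrMr// [2^-1 * _]mulrC.
set K := M * 2 / (1 - rho * cm z).
have K0 : 0 <= K by rewrite !mulr_ge0// invr_ge0 ltW.
have K2 n : 0 <= K * 2^-1 ^+ n by rewrite mulr_ge0// exprn_ge0// invr_ge0.
move=> eps eps0; have epsE : eps = (complex.Re eps)%:C by rewrite RRe_real// gtr0_real.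
set e := complex.Re eps in epsE; have e0 : 0 < e by rewrite -ltr0c -epsE.
have : (fun n => K * 2^-1 ^+ n : R) @ \oo --> (0 : R).
  rewrite -(mulr0 K); apply: cvgM; first exact: cvg_cst.
  by apply: cvg_expr; rewrite ger0_norm ?invr_ge0// invf_lt1//; lra.
move=> /cvgrPdist_lt/(_ e e0)[N _ hN]; exists N => // n /hN /=.
rewrite sub0r normrN ger0_norm// => Kn u.
rewrite epsE !nrE -rmorphM lecR.
rewrite (psval_expand rho0 z1 n (Mu0 u) (hc^~ u) zh1).
have -> : z + h - z = h by rewrite addrAC subrr add0r.
rewrite addrAC subrr add0r nrZ cmX.
apply: (@le_trans _ _ (K * 2^-1 ^+ n * nr u)); last first.
  by rewrite ler_wpM2r ?nr_ge0// ltW.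
have := psval_iter_bound rho0 z1 n (Mu0 u) (hc^~ u) zh1; rewrite -/q => hb.
apply: le_trans (ler_wpM2l (exprn_ge0 n (cm_ge0 h)) hb) _.
have -> : cm h ^+ n * (M * nr u * q ^+ n / (1 - rho * cm (z + h))) =
  (M * nr u) * ((q * cm h) ^+ n * (1 - rho * cm (z + h))^-1).
  by rewrite [(q * _) ^+ n]exprMn; ring.
have -> : K * 2^-1 ^+ n * nr u = (M * nr u) * (2^-1 ^+ n * (2 / (1 - rho * cm z))).
  by rewrite /K; ring.
apply: ler_wpM2l => //; apply: ler_pM.
- by rewrite exprn_ge0// mulr_ge0// cm_ge0.
- by rewrite invr_ge0 subr_ge0 ltW.
- by rewrite lerXn2r ?nnegrE ?invr_ge0//; exact: mulr_ge0 q0 (cm_ge0 _).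
- by rewrite -[2 / _]invf_div lef_pV2 ?posrE ?divr_gt0 ?subr_gt0//; lra.
Qed.

End Family.

Lemma lin_psum (V W : hilbertType R) (T : V -> W) (b : nat -> V) z n : linear T ->
  T (psum b z n) = psum (T \o b) z n.
Proof. by move=> lT; rewrite /psum (lin_sum lT); apply: eq_bigr => k _; rewrite (linZ lT). Qed.

End OperatorSeries.

Section TransferSeries.
Context {R : realType} {X U Y : hilbertType R}.
Variable Sigma : system X U Y.
Let A := sA Sigma.
Let B := sB Sigma.
Let C := sC Sigma.
Let D := sD Sigma.
Let lA : linear A. Proof. by case: (sA_bounded Sigma). Qed.
Let lB : linear B. Proof. by case: (sB_bounded Sigma). Qed.
Let lC : linear C. Proof. by case: (sC_bounded Sigma). Qed.
Let lD : linear D. Proof. by case: (sD_bounded Sigma). Qed.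

Definition markov k (u : U) : Y := if k is k'.+1 then C (iter k' A (B u)) else D u.

Definition transfer_series z u : Y := psval (markov^~ u) z.

Let lin_iter k : linear (iter k A).
Proof. by elim: k => [//|k IH] a x y; rewrite !iterS IH lA. Qed.

Lemma markov_linear k : linear (markov k).
Proof. by case: k => [|k] a u v /=; [exact: lD|rewrite lB lin_iter lC]. Qed.

Lemma transfer_series_near : \forall z \near (0 : R[i]^o),
  transfer_dom Sigma z /\ forall u, transfer Sigma z u = transfer_series z u.
Proof.
have /bounded_operatorP[_ [a a0 ha]] := sA_bounded Sigma.
have /bounded_operatorP[_ [c c0 hc]] := sC_bounded Sigma.
have a1 : 0 < a + 1 by rewrite ltr_wpDl.
apply/near_complexP; exists (a + 1)^-1; first by rewrite invr_gt0.
move=> z; rewrite -[_^-1]mul1r ltr_pdivlMr// => za.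
have za1 : a * cm z < 1 by have := cm_ge0 z; nra.
have hA k b : nr (iter k A b) <= nr b * a ^+ k.
  elim: k => [|k IH]; first by rewrite mulr1.
  by rewrite iterS (le_trans (ha _))// exprS mulrCA ler_wpM2l.
pose T b := psval (fun k => iter k A b) z.
have Tcvs b : cvs (psum (fun k => iter k A b) z) (T b).
  by have [] := psvalP (nr_ge0 b) a0 (fun k => hA k b) za1.
have bT : bounded_operator T.
  apply: (psval_bounded (c := fun k b => iter k A b) ler01 a0 za1 lin_iter) => k b.
  by rewrite mul1r.
have TE b : T b = b + z *: A (T b).
  apply: (cvs_unique (cvs_shift 1 (Tcvs b))).
  under eq_fun => n.
    rewrite addn1 psum_recl (_ : (fun k => _) = A \o (fun k => iter k A b))//.
    rewrite -(lin_psum _ _ _ lA).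
  over.
  by apply: cvsD; [exact: cvs_cst|exact/cvsZ/(cvs_lin lA ha (Tcvs b))].
have pT b : pencil Sigma z (T b) = b by rewrite /pencil -/A {1}TE addrK.
(* The difference [y] of the two sides satisfies y = z A y with |z| a < 1, hence vanishes. *)
have Tp : cancel (pencil Sigma z) T.
  move=> x; apply/eqP; rewrite -subr_eq0 -nr_eq0; set y := _ - x.
  have : y = z *: A y.
    rewrite /y (linB lA) scalerBr {1}TE /pencil -/A.
    by rewrite addrAC (addrAC x) subrr add0r addrC.
  move=> yE; have := nr_ge0 y; have : nr y <= cm z * (a * nr y).
    by rewrite {1}yE nrZ ler_wpM2l ?cm_ge0.
  move=> h1 h2; apply/eqP; nra.
have dz : transfer_dom Sigma z by exists T; split.
split=> // u; rewrite transferE.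
have -> : resolvent Sigma z (B u) = T (B u).
  by apply: (can_inj Tp); rewrite pT pencil_resolvent.
apply/esym/psval_cvs/cvsP => e e0.
have : cvs (fun n => D u + z *: C (psum (fun k => iter k A (B u)) z n)) (D u + z *: C (T (B u))).
  by apply: cvsD; [exact: cvs_cst|exact/cvsZ/(cvs_lin lC hc (Tcvs _))].
move=> /cvsP/(_ e e0)[N hN]; exists N.+1 => -[//|n] Nn.
by rewrite psum_recl/=; have := hN n Nn; rewrite (lin_psum _ _ _ lC).
Qed.

Variable S : partial_op X X.
Hypotheses (lS : linear_partial_op S) (SA : forall x, pdom S x -> pdom S (A x)).
Hypothesis SB : forall u, pdom S (B u).
Hypothesis dissip : forall x u, pdom S x ->
  nr (S (A x + B u)) ^+ 2 + nr (C x + D u) ^+ 2 <= nr (S x) ^+ 2 + nr u ^+ 2.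

Let S0 : S 0 = 0.
Proof. by have [_] := pdomZ 0 lS lS.1; rewrite !scale0r. Qed.

(** These are the outputs after the impulse [u] at time 0 from the state 0, and the later inputs
    vanish: no output can exceed the energy |u|^2 supplied. *)
Lemma markov_bound k u : nr (markov k u) <= nr u.
Proof.
have dA x : pdom S x -> nr (S (A x)) ^+ 2 + nr (C x) ^+ 2 <= nr (S x) ^+ 2.
  by move=> /(dissip 0); rewrite (lin0 lB) (lin0 lD) !addr0 nr0 expr0n addr0.
have dB : nr (S (B u)) ^+ 2 + nr (D u) ^+ 2 <= nr u ^+ 2.
  by have := dissip u lS.1; rewrite (lin0 lA) (lin0 lC) !add0r S0 nr0 expr0n add0r.
have it j : pdom S (iter j A (B u)) /\ nr (S (iter j A (B u))) ^+ 2 <= nr u ^+ 2.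
  elim: j => [|j [IH1 IH2]]; first by split=> //=; have := sqr_ge0 (nr (D u)); lra.
  split; first exact: SA.
  by have := dA _ IH1; have := sqr_ge0 (nr (C (iter j A (B u)))); rewrite iterS; lra.
rewrite -(ler_pXn2r (ltn0Sn 1)) ?nnegrE ?nr_ge0//; case: k => [|k] /=.
  by have := sqr_ge0 (nr (S (B u))); lra.
have [h1 h2] := it k; have := dA _ h1; have := sqr_ge0 (nr (S (A (iter k A (B u))))); lra.
Qed.

Let markov_bound1 k u : nr (markov k u) <= 1 * nr u * 1 ^+ k.
Proof. by rewrite expr1n mulr1 mul1r markov_bound. Qed.

(* With x_0 = 0 and x_(n+1) = z (A x_n + B u) the outputs C x_n + D u converge to
   theta(z) u, while |S x_(n+1)|^2 <= |z|^2 (|S x_n|^2 + |u|^2 - |C x_n + D u|^2):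
   were |theta(z) u| > |u|, the energies |S x_n|^2 would become negative. *)
Lemma transfer_series_contractive z u : cm z < 1 -> nr (transfer_series z u) <= nr u.
Proof.
move=> z1; have z1' : 1 * cm z < 1 by rewrite mul1r.
have mb k : nr (markov k u) <= nr u * 1 ^+ k by rewrite expr1n mulr1 markov_bound.
have [z0|zn0] := eqVneq z 0.
  rewrite /transfer_series (psval_recl (nr_ge0 u) ler01 mb z1') z0 scale0r addr0.
  exact: (markov_bound 0).
have [hcv _] := psvalP (nr_ge0 u) ler01 mb z1'.
pose x n := z *: psum (fun k => iter k A (B u)) z n.
have xS n : x n.+1 = z *: (A (x n) + B u).
  rewrite /x psum_recl/= (linZ lA) (lin_psum _ _ _ lA) addrC; congr (z *: (_ *: _ + _)).
have yE n : C (x n) + D u = psum (markov^~ u) z n.+1.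
  by rewrite psum_recl /x (linZ lC) (lin_psum _ _ _ lC) addrC.
have xdom n : pdom S (x n).
  elim: n => [|n IH]; first by rewrite /x /psum big_ord0 scaler0; exact: lS.1.
  by rewrite xS; apply: (pdomZ z lS _).1; apply: (pdomD lS (SA IH) (SB u)).1.
pose e n := nr (S (x n)) ^+ 2.
have eS n : e n.+1 <= cm z ^+ 2 * (e n + nr u ^+ 2 - nr (psum (markov^~ u) z n.+1) ^+ 2).
  have [d _] := pdomD lS (SA (xdom n)) (SB u).
  rewrite /e xS; have [_ ->] := pdomZ z lS d; rewrite nrZ exprMn ler_wpM2l ?sqr_ge0//.
  by rewrite -yE; have := dissip u (xdom n); lra.
rewrite leNgt; apply/negP => gt.
set g := nr (transfer_series z u) ^+ 2 - nr u ^+ 2.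
have g0 : 0 < g by rewrite subr_gt0 ltrXn2r ?nnegrE ?nr_ge0.
have : (fun n => nr (psum (markov^~ u) z n) ^+ 2) @ \oo --> nr (transfer_series z u) ^+ 2.
  by under eq_fun do rewrite expr2; rewrite expr2; apply: cvgM; exact: cvs_nr.
have g2 : 0 < g / 2 by rewrite divr_gt0.
move=> /cvgrPdist_lt/(_ _ g2)[N _ hN].
have c0 : 0 < cm z ^+ 2 by rewrite exprn_gt0// cm_gt0.
have c1 : cm z ^+ 2 <= 1 by rewrite exprn_ile1 ?cm_ge0// ltW.
(* Beyond [N] the squared outputs exceed |u|^2 by at least g / 2, so each step lowers the energy by
   at least |z|^2 g / 2. *)
have dec k : e (N + k)%N <= e N - k%:R * (cm z ^+ 2 * (g / 2)).
  elim: k => [|k IH]; first by rewrite addn0 mul0r subr0.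
  rewrite addnS (le_trans (eS _))//.
  have := hN (N + k).+1 (leqW (leq_addr _ _)); rewrite /= ltr_norml => /andP[_ hk].
  have : 0 <= e (N + k)%N by exact: sqr_ge0.
  move: (e (N + k)%N) (e N) (nr (psum _ z _) ^+ 2) IH hk => E E0 y IH hk E0'.
  have hy : E + nr u ^+ 2 - y <= E - g / 2 by move: hk; rewrite /g; lra.
  apply: le_trans (ler_wpM2l (ltW c0) hy) _.
  have -> : k.+1%:R = k%:R + 1 :> R by rewrite natr1.
  have := ler_wpM2r E0' c1; lra.
have [k hk] := exists_nat_gt (e N / (cm z ^+ 2 * (g / 2))).
move: hk; rewrite ltr_pdivrMr; last by rewrite mulr_gt0.
move=> hk.
by have := dec k; have : 0 <= e (N + k)%N by [exact: sqr_ge0]; lra.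
Qed.

Lemma transfer_series_schur : schur_class transfer_series.
Proof.
move=> z; rewrite cmE -[1]/(1%:C) ltcR => z1; have z1' : 1 * cm z < 1 by rewrite mul1r.
split=> [||u].
- exact: psval_bounded ler01 ler01 z1' markov_linear markov_bound1.
- exact: psval_analytic ler01 ler01 z1' markov_linear markov_bound1.
- by rewrite !nrE lecR transfer_series_contractive.
Qed.

End TransferSeries.

Lemma RI_schur (R : realType) (X U Y : hilbertType R) (Sigma : system X U Y) :
  RI Sigma !=set0 -> exists theta : R[i] -> U -> Y, schur_class theta /\
    \forall z \near (0 : R[i]^o), transfer_dom Sigma z /\
      forall u, transfer Sigma z u = theta z u.
Proof.
move=> [H /RI_dissipative[S [lS SA SB dissip]]]; exists (transfer_series Sigma).
split; [exact: transfer_series_schur lS SA SB dissip|exact: transfer_series_near].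
Qed.

Unset Implicit Arguments.
Unset Strict Implicit.

Theorem theorem1p4 (R : realType) (X U Y : hilbertType R)
    (sepX : separable X) (sepU : separable U) (sepY : separable Y)
    (Sigma : system X U Y) (min_Sigma : minimal Sigma) :
  RI Sigma !=set0 <->
  exists theta : R[i] -> U -> Y, schur_class theta /\
    \forall lambda \near (0 : R[i]^o),
      transfer_dom Sigma lambda /\
      forall u, transfer Sigma lambda u = theta lambda u.
Proof.
split=> [|[theta [schur near0]]]; first exact: RI_schur.
exact: passive_RI min_Sigma (schur_passive schur near0).
Qed.
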